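(* Let $g\ge2$ and let $\mu$ be a universal genus-$g$ polarization of degree $d$. The generalized cone complex $P^{\mathrm{trop}}_{\mu,g}$ parametrizes equivalence classes of pairs $(X,\mathcal D)$, where $X$ is a stable tropical curve of genus $g$ and $\mathcal D$ is a $\mu$-polystable divisor on $X$, and where two pairs $(X_1,\mathcal D_1)$ and $(X_2,\mathcal D_2)$ are equivalent if there exists an isomorphism $\iota\colon X_1\to X_2$ such that $\iota_*(\mathcal D_1)$ is linearly equivalent to $\mathcal D_2$. That is, sending $(X,\mathcal D)$ to the associated point of $P^{\mathrm{trop}}_{\mu,g}$ (see context) induces a bijection from the set of equivalence classes of such pairs onto the set of points of $P^{\mathrm{trop}}_{\mu,g}$.
   Context: Graphs. Graphs are finite, with loops and multiple edges allowed; graph morphisms are understood on half-edges, so isomorphisms may flip loops. For $\mathcal E\subset E(\Gamma)$: $\Gamma_{\mathcal E}$ is $\Gamma$ with the edges of $\mathcal E$ removed; $\Gamma^{\mathcal E}$ is $\Gamma$ with one new (exceptional) vertex $v_e$ inserted in the interior of each $e\in\mathcal E$, so that there are exactly two edges of $\Gamma^{\mathcal E}$ over each $e\in\mathcal E$ (an edge not in $\mathcal E$ lies over itself). For $V\subset V(\Gamma)$, $E(V,V^c)$ is the set of edges joining $V$ to its complement and $\delta_{\Gamma,V}=|E(V,V^c)|$. $\mathrm{val}_{\mathcal E}(v)$ is the number of edges of $\mathcal E$ incident to $v$, loops counted twice. A specialization $\iota\colon\Gamma\to\Gamma'$ is an identification of $\Gamma'$ with a contraction of $\Gamma$ along some set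 of edges; it gives a surjection on vertices and an inclusion $E(\Gamma')\subset E(\Gamma)$. Weighted graphs. A weighted graph is a connected graph with weights $w\colon V(\Gamma)\to\mathbb Z_{\ge0}$; its genus is $b_1(\Gamma)+\sum_v w(v)$; it is stable if $\mathrm{val}(v)+2w(v)\ge3$ for every vertex. For specializations of weighted graphs, the weight of a vertex $v'$ of $\Gamma'$ is required to be the genus of the contracted weighted subgraph over $v'$. Pseudo-divisors. A divisor on $\Gamma$ is a function $V(\Gamma)\to\mathbb Z$, with degree the sum of its values. A pseudo-divisor on $\Gamma$ is a pair $(\mathcal E,D)$, $\mathcal E\subset E(\Gamma)$, $D$ a divisor on $\Gamma^{\mathcal E}$ with $D(v_e)=-1$ for all $e\in\mathcal E$; its degree is $\deg D$. A specialization of triples $(\Gamma_1,\mathcal E_1,D_1)\to(\Gamma_2,\mathcal E_2,D_2)$ is a specialization $\iota\colon\Gamma_1\to\Gamma_2$ with $\mathcal E_2\subset\mathcal E_1\cap E(\Gamma_2)$, together with a compatible specialization $\Gamma_1^{\mathcal E_1}\to\Gamma_2^{\mathcal E_2}$ pushing $D_1$ forward to $D_2$ (values are summed over fibres). Polarizations and polystability. A degree-$d$ polarization on $\Gamma$ ($d\in\mathbb Z$) is $\mu\colon V(\Gamma)\to\mathbb R$ with $\sum_v\mu(v)=d$; $\iota_*\mu$ is defined by summing over fibres. A universal genus-$g$ polarization of degree $d$ is a choice of degree-$d$ polarization $\mu_\Gamma$ for each stable weighted graph $\Gamma$ of genus $g$ with $\mu_{\Gamma'}=\iota_*\mu_\Gamma$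 for every specialization $\iota\colon\Gamma\to\Gamma'$. For a pseudo-divisor $(\mathcal E,D)$ of degree $d$ and $V\subset V(\Gamma)$ put $$\beta_{\mathcal E,D}(V)=\sum_{v\in V}D(v)-\sum_{v\in V}\Bigl(\mu(v)+\tfrac12\mathrm{val}_{\mathcal E}(v)\Bigr)+\tfrac12\delta_{\Gamma_{\mathcal E},V}.$$ $(\mathcal E,D)$ is $\mu$-polystable if $\beta_{\mathcal E,D}(V)\ge0$ for every $V\subset V(\Gamma)$, with strict inequality whenever $E(V,V^c)\not\subset\mathcal E$. $\mathbf{PSD}_{\mu,g}$ is the category of triples $(\Gamma,\mathcal E,D)$ with $\Gamma$ a stable weighted graph of genus $g$ and $(\mathcal E,D)$ a $\mu_\Gamma$-polystable pseudo-divisor, with specializations of triples as morphisms. Tropical curves. A tropical curve is a connected metric space $X$ obtained from a weighted graph $\Gamma$ and lengths $\ell\colon E(\Gamma)\to\mathbb R_{>0}$ by gluing segments of length $\ell(e)$ according to $\Gamma$ (a model of $X$), with the weight function extended by zero; isomorphisms are weight-preserving isometries. It is stable of genus $g$ if it has a model that is a stable weighted graph of genus $g$ (its stable model). A divisor on $X$ is a finitely supported function $X\to\mathbb Z$. Two divisors are linearly equivalent if they differ by the divisor $\mathrm{Div}(f)=\sum_p\mathrm{ord}_p(f)\,p$ of a continuous piecewise linear function $f\colon X\to\mathbb R$ with integer slopes, $\mathrm{ord}_p(f)$ being the sum of the incoming slopes of $f$ at $p$. A divisor $\mathcal D$ on the stable tropical curve $X$ with stable model $\Gamma$ is $\mu$-polystable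 if in the interior $e^\circ$ of each edge $e$ of $\Gamma$ it vanishes except at at most one point $p_{\mathcal D,e}$, where it takes the value $-1$, and its combinatorial type $(\mathcal E,D)$ is $\mu_\Gamma$-polystable; here $\mathcal E$ is the set of edges $e$ for which $p_{\mathcal D,e}$ exists, $D(v)=\mathcal D(v)$ for $v\in V(\Gamma)$, and $D(v_e)=-1$ for $e\in\mathcal E$. The complex. For $V\subset V(\Gamma)$ with $E(V,V^c)\subset\mathcal E$ let $w_V=\sum_{e'}\alpha_V(e')u_{e'}\in\mathbb R^{E(\Gamma^{\mathcal E})}$, where $u_{e'}$ is the standard basis, $\alpha_V(e')=1$ (resp. $-1$) if $e'$ lies over an edge of $E(V,V^c)$ and is incident to $V$ (resp. $V^c$), and $\alpha_V(e')=0$ otherwise. Let $\mathcal L_{\mathcal E}$ be the span of these $w_V$, and let $\sigma_{(\Gamma,\mathcal E,D)}$ be the image of $\mathbb R_{\ge0}^{E(\Gamma^{\mathcal E})}$ in $\mathbb R^{E(\Gamma^{\mathcal E})}/\mathcal L_{\mathcal E}$. A specialization of triples gives an inclusion $E(\Gamma_2^{\mathcal E_2})\subset E(\Gamma_1^{\mathcal E_1})$, which induces a face morphism $\sigma_{(\Gamma_2,\mathcal E_2,D_2)}\to\sigma_{(\Gamma_1,\mathcal E_1,D_1)}$. $P^{\mathrm{trop}}_{\mu,g}=\varinjlim\sigma_{(\Gamma,\mathcal E,D)}$ over $\mathbf{PSD}_{\mu,g}$ (colimit of topological spaces). The point associated to $(X,\mathcal D)$, with $X$ of stable model $\Gamma$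 and $\mathcal D$ of combinatorial type $(\mathcal E,D)$, is the image of the vector in $\mathbb R^{E(\Gamma^{\mathcal E})}_{>0}$ whose coordinates are the lengths of the edges of $\Gamma^{\mathcal E}$ when $v_e$ is placed at $p_{\mathcal D,e}$ for each $e\in\mathcal E$. *)

(* Defs.v *)
From Stdlib Require Export Relation_Operators RelationClasses.
From mathcomp Require Export all_boot all_order all_algebra.
From mathcomp Require Export boolp classical_sets functions cardinality reals.

Set Implicit Arguments.
Unset Strict Implicit.
Unset Printing Implicit Defensive.

Import Order.TTheory GRing.Theory Num.Theory.

Local Open Scope ring_scope.

(* Quotient of [T] by [r], as the type of sets [r x]; it is the usual type of
   equivalence classes when [r] is an equivalence relation.  Plain predicates
   are used instead of [set T] so that [T] may live above the universe of
   finite types (it will contain graphs). *)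
Record quot (T : Type) (r : T -> T -> Prop) := Quot {
  quot_carrier : T -> Prop;
  quot_carrierP : exists x, quot_carrier = r x }.

Definition class (T : Type) (r : T -> T -> Prop) (x : T) : quot r :=
  Quot (ex_intro (fun y => r x = r y) x erefl).

(** Graphs *)

(* The half-edges of [e] are [(e, false)] and [(e, true)], and [root h] is the
   vertex at which the half-edge [h] is attached.  The resulting orientation of
   the edges is auxiliary: morphisms need not preserve it. *)
Record graph := Graph {
  vert : finType;
  edge : finType;
  root : edge * bool -> vert }.

Definition half (G : graph) : finType := (edge G * bool)%type.

Definition flip (G : graph) (h : half G) : half G := (h.1, ~~ h.2).

Definition adj (G : graph) (S : {set edge G}) : rel (vert G) :=
  fun x y => [exists h : half G,
    [&& h.1 \in S, root h == x & root (flip h) == y]].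

Definition connected (G : graph) : Prop :=
  (0 < #|vert G|)%N /\ forall x y : vert G, connect (adj [set: edge G]) x y.

Definition val_in (G : graph) (S : {set edge G}) (v : vert G) : nat :=
  #|[set h : half G | (h.1 \in S) && (root h == v)]|.

Definition valence (G : graph) (v : vert G) : nat := val_in [set: edge G] v.

Definition cut (G : graph) (V : {set vert G}) : {set edge G} :=
  [set e | (root (e, false) \in V) != (root (e, true) \in V)].

Definition delta (G : graph) (V : {set vert G}) : nat := #|cut V|.

Definition del_edges (G : graph) (S : {set edge G}) : graph :=
  @Graph (vert G) {e : edge G | e \notin S} (fun h => root (val h.1, h.2)).

(* The edge [e \in S] is replaced by the two edges [inr (e, false)] and
   [inr (e, true)]; [inr (e, c)] joins the root of the half-edge [(e, c)] to the
   exceptional vertex [inr e]. *)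
Definition subdiv (G : graph) (S : {set edge G}) : graph :=
  @Graph (vert G + {e : edge G | e \in S})%type
         ({e : edge G | e \notin S} + {e : edge G | e \in S} * bool)%type
         (fun h => match h with
          | (inl e, b) => inl (root (val e, b))
          | (inr (e, c), false) => inl (root (val e, c))
          | (inr (e, c), true) => inr e
          end).

Definition over (G : graph) (S : {set edge G}) (e : edge (subdiv S)) : edge G :=
  match e with inl e => val e | inr (e, _) => val e end.

(* Genus of the weighted subgraph with vertex set [U] and edge set [S] (the
   edges of [S] having both ends in [U]); its first Betti number is
   [#|S| + number of components - #|U|]. *)
Definition sub_genus (G : graph) (w : vert G -> nat)
    (S : {set edge G}) (U : {set vert G}) : nat :=
  (#|S| + n_comp (adj S) U - #|U| + \sum_(v in U) w v)%N.

Definition genus (G : graph) (w : vert G -> nat) : nat :=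
  sub_genus w [set: edge G] [set: vert G].

Record stable_graph (g : nat) := StableGraph {
  sg_graph :> graph;
  weight : vert sg_graph -> nat;
  sg_connected : connected sg_graph;
  sg_genus : genus weight = g;
  sg_stable : forall v, (3 <= valence v + 2 * weight v)%N }.

(** Specializations *)

(* Identification of [G'] with the contraction of [G] along the edges that are
   not in the image of [sp_half]: the fibres of [sp_vert] are the connected
   components of the graph of contracted edges. *)
Record specialization (G G' : graph) := Specialization {
  sp_vert : vert G -> vert G';
  sp_half : half G' -> half G;
  sp_half_inj : injective sp_half;
  sp_half_flip : forall h, sp_half (flip h) = flip (sp_half h);
  sp_root : forall h, sp_vert (root (sp_half h)) = root h;
  sp_surj : forall v', exists v, sp_vert v = v';
  sp_fibre : forall v1 v2, sp_vert v1 = sp_vert v2 <->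
    connect (adj [set e | (e, false) \notin codom sp_half]) v1 v2 }.

Section Specialization.
Variables (G G' : graph) (i : specialization G G').

Definition sp_edge (e : edge G') : edge G := (sp_half i (e, false)).1.

Definition fibre (v' : vert G') : {set vert G} := [set v | sp_vert i v == v'].

Definition fibre_edges (v' : vert G') : {set edge G} :=
  [set e | (e \notin codom sp_edge) && (root (e, false) \in fibre v')].

Definition weight_compatible (w : vert G -> nat) (w' : vert G' -> nat) : Prop :=
  forall v', w' v' = sub_genus w (fibre_edges v') (fibre v').

Definition push (A : nmodType) (f : vert G -> A) (v' : vert G') : A :=
  \sum_(v in fibre v') f v.

End Specialization.

Definition wspecialization (g : nat) (G G' : stable_graph g)
    (i : specialization G G') : Prop :=
  weight_compatible i (@weight g G) (@weight g G').

(** Pseudo-divisors and polystability *)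

Record pseudo_divisor (G : graph) := PseudoDivisor {
  pd_edges : {set edge G};
  pd_div : vert (subdiv pd_edges) -> int;
  pd_exc : forall e, pd_div (inr e) = -1 }.
Arguments pd_div {G} P v : rename.

Definition pd_degree (G : graph) (P : pseudo_divisor G) : int :=
  \sum_(v : vert (subdiv (pd_edges P))) pd_div P v.

Record universal_polarization (R : realType) (g : nat) (d : int) :=
  UniversalPolarization {
    upol :> forall G : stable_graph g, vert G -> R;
    upol_degree : forall G : stable_graph g,
      \sum_(v : vert G) upol v = d%:~R;
    upol_compat : forall (G G' : stable_graph g) (i : specialization G G'),
      wspecialization i -> forall v' : vert G', upol v' = push i (@upol G) v' }.

Definition beta (R : realType) (G : graph) (mu : vert G -> R)
    (P : pseudo_divisor G) (V : {set vert G}) : R :=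
  \sum_(v in V) (pd_div P (inl v))%:~R
  - \sum_(v in V) (mu v + 2^-1 * (val_in (pd_edges P) v)%:R)
  + 2^-1 * (@delta (del_edges (pd_edges P)) V)%:R.

Definition polystable (R : realType) (d : int) (G : graph) (mu : vert G -> R)
    (P : pseudo_divisor G) : Prop :=
  pd_degree P = d /\
  forall V : {set vert G},
    0 <= beta mu P V /\ (~~ (cut V \subset pd_edges P) -> 0 < beta mu P V).

(** The category of polystable triples *)

Section PSD.
Variables (R : realType) (g : nat) (d : int).
Variable mu : universal_polarization R g d.

Record psd := Psd {
  psd_graph :> stable_graph g;
  psd_pd : pseudo_divisor psd_graph;
  psd_polystable : polystable d (@upol _ _ _ mu psd_graph) psd_pd }.

Definition psd_subdiv (T : psd) : graph := subdiv (pd_edges (psd_pd T)).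

(* Compatibility means commutation with the inclusions
   [vert G -> vert (subdiv S)] and with the projections
   [edge (subdiv S) -> edge G]. *)
Record psd_hom (T1 T2 : psd) := PsdHom {
  ph_sp : specialization T1 T2;
  ph_weight : wspecialization ph_sp;
  ph_sub : forall e, e \in pd_edges (psd_pd T2) ->
                     sp_edge ph_sp e \in pd_edges (psd_pd T1);
  ph_subdiv : specialization (psd_subdiv T1) (psd_subdiv T2);
  ph_vertP : forall v, sp_vert ph_subdiv (inl v) = inl (sp_vert ph_sp v);
  ph_overP : forall e, over (sp_edge ph_subdiv e) = sp_edge ph_sp (over e);
  ph_push : forall v, pd_div (psd_pd T2) v = push ph_subdiv (pd_div (psd_pd T1)) v }.

(** The cones and their colimit *)

Definition edge_space (T : psd) := {ffun edge (psd_subdiv T) -> R^o}.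

Definition incident (T : psd) (e : edge (psd_subdiv T)) (V : {set vert T}) : bool :=
  [exists b, exists v in V, root (e, b) == inl v].

Definition cut_vec (T : psd) (V : {set vert T}) : edge_space T :=
  [ffun e => if over e \in cut V then
               if incident e V then 1 else
               if incident e (~: V) then -1 else 0
             else 0].

Definition cut_space (T : psd) : {vspace edge_space T} :=
  <<[seq cut_vec V | V : {set vert T} in
       [pred V : {set vert T} | cut V \subset pd_edges (psd_pd T)]]>>%VS.

Definition quotient_space (T : psd) : Type :=
  quot (fun x y : edge_space T => y - x \in cut_space T).

Definition proj (T : psd) (x : edge_space T) : quotient_space T := class _ x.

Definition orthant (T : psd) (x : edge_space T) : Prop := forall e, 0 <= (x e : R).

Definition in_cone (T : psd) (a : quotient_space T) : Prop :=
  exists2 x, orthant x & a = proj x.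

(* The linear inclusion sending [u_e] to [u_(sp_edge e)]. *)
Definition extend (T1 T2 : psd) (f : psd_hom T1 T2) (x : edge_space T2) :
    edge_space T1 :=
  [ffun e1 => \sum_(e2 | sp_edge (ph_subdiv f) e2 == e1) x e2].

(* The graph of the face morphism induced by [extend f]. *)
Definition face_morphism (T1 T2 : psd) (f : psd_hom T1 T2)
    (a2 : quotient_space T2) (a1 : quotient_space T1) : Prop :=
  exists x, [/\ orthant x, a2 = proj x & a1 = proj (extend f x)].

Record cone_point := ConePoint {
  cp_psd : psd;
  cp_point : quotient_space cp_psd;
  cp_in_cone : in_cone cp_point }.

Definition face_rel (p2 p1 : cone_point) : Prop :=
  exists f : psd_hom (cp_psd p1) (cp_psd p2),
    face_morphism f (cp_point p2) (cp_point p1).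

(* The points of the colimit of the cones. *)
Definition Ptrop : Type := quot (clos_refl_sym_trans cone_point face_rel).

End PSD.

(** Stable tropical curves *)

Record tropical_curve (R : realType) (g : nat) := TropicalCurve {
  tc_graph :> stable_graph g;
  len : edge tc_graph -> R;
  len_gt0 : forall e, 0 < len e }.

(* The set obtained by gluing the segments [0, len e]: a point is either a
   vertex or lies in the interior of an edge [e], at distance [t] from the root
   of [(e, false)]. *)
Definition point (R : realType) (g : nat) (X : tropical_curve R g) : Type :=
  (vert X + {p : edge X * R | 0 < p.2 < len p.1})%type.

Section TropicalCurve.
Variables (R : realType) (g : nat) (X : tropical_curve R g).

(* The gluing map on the segment [0, len e]; it is only meaningful for
   [0 <= t <= len e]. *)
Definition seg (e : edge X) (t : R) : point X :=
  match insub (e, t) with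
  | Some p => inr p
  | None => inl (root (e, t > 0))
  end.

(* The same map, starting from the root of the half-edge [h]. *)
Definition hseg (h : half X) (t : R) : point X :=
  seg h.1 (if h.2 then len h.1 - t else t).

Inductive chain_length : point X -> point X -> R -> Prop :=
| chain_nil x : chain_length x x 0
| chain_cons e s t y L : 0 <= s <= len e -> 0 <= t <= len e ->
    chain_length (seg e t) y L -> chain_length (seg e s) y (`|s - t| + L).

(* The gluing (path) metric. *)
Definition dist (x y : point X) : R := inf (chain_length x y).

Definition pweight (x : point X) : nat :=
  match x with inl v => weight v | inr _ => 0%N end.

(* [phi] is affine with integer slope on the closed intervals of a finite
   subdivision of [0, l]; in particular it is continuous there. *)
Definition pl_integral (l : R) (phi : R -> R) : Prop :=
  exists ts : seq R, [/\ path <%R 0 ts, last 0 ts = l &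
    forall i, (i < size ts)%N -> exists (k : int) (c : R),
      forall t, (0 :: ts)`_i <= t <= ts`_i -> phi t = k%:~R * t + c].

(* A function out of the gluing is continuous if and only if it is so on each
   closed segment, so continuity is part of this definition. *)
Definition pl_function (f : point X -> R) : Prop :=
  forall e, pl_integral (len e) (fun t => f (seg e t)).

(* The slope of [f] at [hseg h t], [0 <= t < len h.1], for the motion towards
   this point along [h] from the points [hseg h (t + u)], [u > 0]. *)
Definition incoming_slope (f : point X -> R) (h : half X) (t : R) : int :=
  xget 0 [set m : int | exists2 eps : R, 0 < eps &
    forall u, 0 <= u <= eps ->
      f (hseg h t) = f (hseg h (t + u)) + m%:~R * u]%classic.

Definition ord (f : point X -> R) (x : point X) : int :=
  match x with
  | inl v => \sum_(h : half X | root h == v) incoming_slope f h 0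
  | inr p => let: (e, t) := val p in
      incoming_slope f (e, false) t + incoming_slope f (e, true) (len e - t)
  end.

Definition finitely_supported (D : point X -> int) : Prop :=
  finite_set [set x | D x != 0]%classic.

Definition linearly_equivalent (D1 D2 : point X -> int) : Prop :=
  exists2 f, pl_function f & forall x, D1 x - D2 x = ord f x.

(** Polystable divisors *)

Definition in_interior (e : edge X) (t : R) : Prop := 0 < t < len e.

Definition exc_position (D : point X -> int) (e : edge X) : set R :=
  [set t | in_interior e t /\ D (seg e t) != 0]%classic.

Definition exc_edges (D : point X -> int) : {set edge X} :=
  [set e | `[< exists t, exc_position D e t >]].

Definition comb_type (D : point X -> int) : pseudo_divisor X :=
  @PseudoDivisor X (exc_edges D)
    (fun v => match v with inl v => D (inl v) | inr _ => -1 end)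
    (fun _ => erefl).

Definition trop_polystable (d : int) (mu : universal_polarization R g d)
    (D : point X -> int) : Prop :=
  [/\ forall e s t, exc_position D e s -> exc_position D e t -> s = t,
      forall e t, exc_position D e t -> D (seg e t) = -1
    & polystable d (@upol _ _ _ mu X) (comb_type D)].

(* The lengths of the edges of the subdivided graph when each exceptional
   vertex is placed at the exceptional point of [D]. *)
Definition edge_length (D : point X -> int)
    (e : edge (subdiv (exc_edges D))) : R :=
  match e with
  | inl e => len (val e)
  | inr (e, c) => let t := xget 0 (exc_position D (val e)) in
                  if c then len (val e) - t else t
  end.

End TropicalCurve.

(* [k] is the inverse of [i]. *)
Definition is_iso (R : realType) (g : nat) (X1 X2 : tropical_curve R g)
    (i : point X1 -> point X2) (k : point X2 -> point X1) : Prop :=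
  [/\ cancel i k, cancel k i,
      forall x y, dist (i x) (i y) = dist x y
    & forall x, pweight (i x) = pweight x].

Section Pairs.
Variables (R : realType) (g : nat) (d : int).
Variable mu : universal_polarization R g d.

Record trop_pair := TropPair {
  tp_curve :> tropical_curve R g;
  tp_div : point tp_curve -> int;
  tp_finite : finitely_supported tp_div;
  tp_polystable : trop_polystable mu tp_div }.

Definition pair_equiv (P1 P2 : trop_pair) : Prop :=
  exists i k, @is_iso R g P1 P2 i k /\
    linearly_equivalent (fun y => tp_div (k y)) (@tp_div P2).

Lemma pair_comb_polystable (P : trop_pair) :
  polystable d (@upol _ _ _ mu P) (comb_type (@tp_div P)).
Proof. by case: (tp_polystable P). Qed.

Definition pair_psd (P : trop_pair) : psd mu :=
  Psd (pair_comb_polystable P).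

Definition pair_vec (P : trop_pair) : edge_space (pair_psd P) :=
  [ffun e => edge_length (D := @tp_div P) e].

Lemma pair_vec_in_cone (P : trop_pair) : in_cone (proj (pair_vec P)).
Proof.
exists (pair_vec P) => // e; rewrite ffunE.
case: e => [e|[e c]] /=; first exact: ltW (len_gt0 _).
have := valP e; rewrite inE => /asboolP[t0 Ht0].
have [/andP[/ltW t_ge0 /ltW t_le] _] := xgetPex 0 (ex_intro _ t0 Ht0).
by case: c; rewrite ?subr_ge0.
Qed.

Definition associated_point (P : trop_pair) : Ptrop mu :=
  class _ (ConePoint (pair_vec_in_cone P)).

End Pairs.

(* Main.v *)
Require Import Defs.
From HB Require Import structures.
From mathcomp Require Import fintype finset zify ring lra.

(* An isometry of stable tropical curves sends vertices to vertices (they are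
   the points of positive weight or of valence at least 3, and the valence of
   [v] is the number of points at a small distance from [v]) and each edge
   affinely onto an edge.  So equivalence of pairs is an isomorphism of metric
   graphs followed by a linear equivalence.

   A vector [x] of the orthant of a triple [T] determines a curve with a
   divisor, by contracting the edges of length 0 and pushing the divisor of [T]
   forward.  Changing [x] by an element of the cut space, that is by the gradient
   of a function constant on the components of [del_edges], changes the divisor
   by the divisor of a piecewise linear function, and a face morphism does not
   change the curve and divisor at all.  Hence every point of the colimit has a
   well-defined class of (not necessarily polystable) divisors on curves, which
   recovers the class of a pair from its associated point: this is injectivity.

   For surjectivity, represent a point of a cone by a vector with the least
   number of zeros: the divisor it determines is then polystable, since
   otherwise some cut could be moved to make more coordinates positive.

   Finally, let [D1 - D2 = Div f] with [D1] and [D2] polystable on the same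
   curve.  For a superlevel set [V] of [f] on the vertices, [beta D2 V] and
   [beta D1 (~: V)] are nonnegative but their sum is at most 0.  So both vanish,
   all edges leaving [V] are exceptional for both divisors, and [f] has slope 0
   at every vertex: the combinatorial types agree, and the edge lengths differ
   by the gradient of [f]. *)

Set Implicit Arguments.
Unset Strict Implicit.
Unset Printing Implicit Defensive.

Import Order.TTheory GRing.Theory Num.Theory.

Local Open Scope ring_scope.

(** * Points and distances on a tropical curve *)

(** The colimit relation is generated by zigzags of face morphisms through cone points with
    vanishing coordinates, so an invariant of a class must make sense at every cone point, where its
    value need not be polystable. Hence [realizes] relates vectors to arbitrary divisors, and
    [dequiv] compares arbitrary divisors. Composing such equivalences requires that isometries carry
    piecewise linear functions to piecewise linear functions. A bijection that preserves distances
    says nothing directly about slopes, which is why isometries are first made combinatorial. Loops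
    are the obstacle: their metric is that of a circle, and both isometries and morphisms of triples
    may reverse them, so everything is phrased on half-edges. The final inequality rests on
    integrality. At the higher end of an edge, the slope of [f] towards this end exceeds -1 if the
    edge is exceptional for [D2], and 0 otherwise; being an integer, it is at least 0, respectively
    1, which is what that edge adds to the sum of the two [beta]. *)

Ltac cases_lra := repeat match goal with
  | |- context [Num.norm ?x] => case: (ger0P x)
  | |- context [Order.min ?x ?y] => case: (leP x y)
  | |- context [Order.max ?x ?y] => case: (leP x y)
  end; move=> *; lra.

Ltac tlra := lazymatch goal with |- is_true _ => try lra | _ => idtac end.

Lemma class_eq (T : Type) (r : T -> T -> Prop) :
  Equivalence r -> forall x y, class r x = class r y <-> r x y.
Proof.
move=> [rR rS rT] x y; split=> [[/(congr1 (fun f => f y)) ->]|rxy]; first exact: rR.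
have E : r x = r y.
  apply: funext => z; apply: propext; split; last exact: rT.
  exact: rT (rS _ _ rxy).
rewrite /class; move: (ex_intro _ x _) (ex_intro _ y _); rewrite E => p q.
by congr Quot; apply: Prop_irrelevance.
Qed.

Lemma quot_ex (T : Type) (r : T -> T -> Prop) (q : quot r) : exists x, q = class r x.
Proof.
case: q => c [x E]; exists x; rewrite /class; move: (ex_intro _ x _) (ex_intro _ x _).
by rewrite E => p q; congr Quot; apply: Prop_irrelevance.
Qed.

Section Points.
Variables (R : realType) (g : nat) (X : tropical_curve R g).

Lemma flipK (G : graph) : involutive (@flip G).
Proof. by case=> e b; rewrite /flip /= negbK. Qed.

Lemma seg_interior (e : edge X) (t : R) (H : 0 < t < len e) :
  seg e t = inr (exist _ (e, t) H).
Proof.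
rewrite /seg; case: insubP => [p _ Ep|]; last by rewrite H.
by congr inr; apply: val_inj.
Qed.

Lemma seg_vertex (e : edge X) (t : R) : ~~ (0 < t < len e) ->
  seg e t = inl (root (e, t > 0)).
Proof. by move=> H; rewrite /seg insubN. Qed.

Lemma seg0 (e : edge X) : seg e 0 = inl (root (e, false)).
Proof. by rewrite seg_vertex ltxx. Qed.

Lemma seg_len (e : edge X) : seg e (len e) = inl (root (e, true)).
Proof. by rewrite seg_vertex ?ltxx ?andbF // len_gt0. Qed.

Lemma hseg0 (h : half X) : hseg h 0 = inl (root h).
Proof. by case: h => e [] /=; rewrite /hseg /= ?subr0 ?seg_len ?seg0. Qed.

Lemma hseg_flip (h : half X) (t : R) : hseg (flip h) t = hseg h (len h.1 - t).
Proof. by case: h => e [] /=; rewrite /hseg /= ?opprB ?subrKC ?addrCA ?subrr ?addr0. Qed.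

Lemma hseg_len (h : half X) : hseg h (len h.1) = inl (root (flip h)).
Proof. by rewrite -hseg0 hseg_flip subr0. Qed.

Variant point_spec : point X -> Type :=
| PointVertex v : point_spec (inl v)
| PointInterior e t : 0 < t < len e -> point_spec (seg e t).

Lemma pointP (p : point X) : point_spec p.
Proof.
case: p => [v|[[e t] H]]; first exact: PointVertex.
by rewrite -(seg_interior H); apply: PointInterior.
Qed.

Lemma seg_inj (e e' : edge X) (t t' : R) : 0 < t < len e ->
  seg e t = seg e' t' -> e = e' /\ t = t'.
Proof.
move=> H; rewrite (seg_interior H).
have [H'|H'] := boolP (0 < t' < len e'); last by rewrite (seg_vertex H').
by rewrite (seg_interior H') => -[-> ->].
Qed.

Lemma seg_interior_neq (e : edge X) (t : R) v : 0 < t < len e -> seg e t <> inl v.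
Proof. by move=> H; rewrite (seg_interior H). Qed.

Lemma hseg_interior_neq (h : half X) (t : R) v : 0 < t < len h.1 -> hseg h t <> inl v.
Proof. by move=> H; apply: seg_interior_neq; case: h.2; lra. Qed.

Lemma hseg_inj (h h' : half X) (t t' : R) : 0 < t < len h.1 -> hseg h t = hseg h' t' ->
  (h = h' /\ t = t') \/ (h' = flip h /\ t' = len h.1 - t).
Proof.
case: h h' => e b [e' b'] /= H; rewrite /hseg /= => /seg_inj.
case; first by case: b; lra.
move=> <-; case: b b' => [] [] E; [left|right|right|left]; split=> //; lra.
Qed.

Lemma chain_ge0 (x y : point X) L : chain_length x y L -> 0 <= L.
Proof. by elim=> // e s t y' L' _ _ _ L0; rewrite addr_ge0. Qed.

Lemma chain_trans (x y z : point X) L M :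
  chain_length x y L -> chain_length y z M -> chain_length x z (L + M).
Proof.
elim=> [x'|e s t y' L' Hs Ht _ IH] C; first by rewrite add0r.
by rewrite -addrA; apply: chain_cons => //; apply: IH.
Qed.

Lemma chain_seg (e : edge X) (s t : R) : 0 <= s <= len e -> 0 <= t <= len e ->
  chain_length (seg e s) (seg e t) `|s - t|.
Proof.
by move=> Hs Ht; rewrite -[X in chain_length _ _ X]addr0; apply: chain_cons => //;
  apply: chain_nil.
Qed.

Lemma chain_vertex (u v : vert X) : exists L, chain_length (inl u) (inl v) L.
Proof.
have [_ /(_ u v)/connectP[p]] := sg_connected X.
elim: p u => [|w p IH] u /= => [_ ->|]; first by exists 0; apply: chain_nil.
case/andP=> /existsP[[e b] /and3P[_ /eqP Eu /eqP Ew]] Hp Hv.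
have [L C] := IH w Hp Hv.
have l0 := ltW (len_gt0 e).
exists (len e + L); apply: chain_trans C; rewrite -Eu -Ew /flip /=.
rewrite -(ger0_norm l0); case: {Eu Ew} b => /=; rewrite -seg0 -seg_len.
  by rewrite -[X in `|X|]subr0; apply: chain_seg; rewrite ?l0 ?lexx.
by rewrite -normrN -[X in `|X|]sub0r; apply: chain_seg; rewrite ?l0 ?lexx.
Qed.

Lemma chain_ex (x y : point X) : exists L, chain_length x y L.
Proof.
have toV (z : point X) : exists v, (exists L, chain_length z (inl v) L) /\
    (exists L, chain_length (inl v) z L).
  case: (pointP z) => [v|e t Ht]; first by exists v; split; exists 0; apply: chain_nil.
  exists (root (e, false)); rewrite -seg0; have l0 := len_gt0 e.
  by split; eexists; apply: chain_seg; rewrite ?lexx; lra.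
have [u [[L CL] _]] := toV x; have [v [_ [M CM]]] := toV y.
have [K CK] := chain_vertex u v.
by exists (L + (K + M)); exact: chain_trans CL (chain_trans CK CM).
Qed.

Lemma dist_le (x y : point X) L : chain_length x y L -> dist x y <= L.
Proof. by move=> C; apply: ge_inf => //; exists 0 => M; apply: chain_ge0. Qed.

Lemma dist_seg_le (e : edge X) (s t : R) : 0 <= s <= len e -> 0 <= t <= len e ->
  dist (seg e s) (seg e t) <= `|s - t|.
Proof. by move=> Hs Ht; apply: dist_le; apply: chain_seg. Qed.

(** The source of all lower bounds on [dist]: each step of a chain changes [F] by at most its
    length, so it suffices to exhibit a function that is 1-Lipschitz along every segment. *)
Lemma lipschitz_dist (F : point X -> R) :
  (forall e s t, 0 <= s <= len e -> 0 <= t <= len e ->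
     F (seg e s) - F (seg e t) <= `|s - t|) ->
  forall x y, F x - F y <= dist x y.
Proof.
move=> FL x y; apply: lb_le_inf; first by have [L] := chain_ex x y; exists L.
move=> L; elim=> [z|e s t z M Hs Ht _ IH]; first by rewrite subrr.
by have := FL e s t Hs Ht; lra.
Qed.

(* On [e] this is the distance to [s] on the circle of length [len e]; it is
   1-Lipschitz whether or not the ends of [e] coincide. *)
Definition circle_fun (e : edge X) (s : R) (p : point X) : R :=
  let m := Num.min s (len e - s) in
  match p with
  | inl _ => m
  | inr q => let: (e', t) := val q in
      if e' == e then Num.min `|t - s| (len e - `|t - s|) else m
  end.

Lemma circle_funE (e : edge X) (s : R) e' t : 0 <= s <= len e -> 0 <= t <= len e' ->
  circle_fun e s (seg e' t) =
  if e' == e then Num.min `|t - s| (len e - `|t - s|) else Num.min s (len e - s).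
Proof.
move=> Hs Ht; have [H|H] := boolP (0 < t < len e'); first by rewrite (seg_interior H).
rewrite (seg_vertex H) /=; case: eqP Ht H => // -> Ht /nandP[] H.
  have -> : t = 0 by lra.
  by rewrite sub0r normrN ger0_norm //; lra.
have -> : t = len e by lra.
rewrite ger0_norm; last by lra.
by rewrite minC; congr Num.min; lra.
Qed.

Lemma circle_fun_lip (e : edge X) (s : R) : 0 <= s <= len e ->
  forall e' t u, 0 <= t <= len e' -> 0 <= u <= len e' ->
  `|circle_fun e s (seg e' t) - circle_fun e s (seg e' u)| <= `|t - u|.
Proof.
move=> Hs e' t u Ht Hu; rewrite !circle_funE //; case: eqP => [E|_]; last by rewrite subrr normr0.
rewrite {e'}E in Ht Hu; cases_lra.
Qed.

Lemma circle_dist (e : edge X) (s : R) x y : 0 <= s <= len e ->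
  `|circle_fun e s x - circle_fun e s y| <= dist x y.
Proof.
move=> Hs; rewrite ler_norml; apply/andP; split.
  have := @lipschitz_dist (fun p => - circle_fun e s p) _ x y; rewrite lerNl.
  rewrite opprK addrC opprB; apply => e' t u Ht Hu.
  by have := circle_fun_lip Hs Ht Hu; rewrite ler_norml; lra.
apply: lipschitz_dist => e' t u Ht Hu.
by apply: le_trans (circle_fun_lip Hs Ht Hu); rewrite ler_norm.
Qed.

Lemma circle_fun_self (e : edge X) (s : R) : 0 <= s <= len e ->
  circle_fun e s (seg e s) = 0.
Proof.
by move=> H; rewrite circle_funE // eqxx subrr normr0 subr0 min_l //; lra.
Qed.

Lemma dist_sym_seg_ge (e : edge X) (s : R) y : 0 <= s <= len e ->
  circle_fun e s y <= dist (seg e s) y /\ circle_fun e s y <= dist y (seg e s).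
Proof.
move=> Hs; split.
  have := circle_dist (seg e s) y Hs; rewrite circle_fun_self // sub0r normrN.
  by apply: le_trans; rewrite ler_norm.
have := circle_dist y (seg e s) Hs; rewrite circle_fun_self // subr0.
by apply: le_trans; rewrite ler_norm.
Qed.

(** Going around the circle from [s] to a point of [e] costs at least [min(s, len e - s)], and so
    does reaching a vertex or another edge. Inside the ball only [|t - s|] remains as a lower bound,
    and the segment itself gives the upper bound. *)
Lemma dist_ball (e : edge X) (s : R) y : 0 < s < len e ->
  dist (seg e s) y < Num.min s (len e - s) ->
  exists t, [/\ y = seg e t, 0 < t < len e & `|t - s| = dist (seg e s) y].
Proof.
move=> Hs; have Hs' : 0 <= s <= len e by lra.
have := proj1 (dist_sym_seg_ge y Hs').
case: (pointP y) => [v /le_lt_trans H /H|e' t Ht]; first by rewrite ltxx.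
have Ht' : 0 <= t <= len e' by lra.
rewrite circle_funE //; case: eqP => [E|_ /le_lt_trans H /H]; last by rewrite ltxx.
rewrite {e'}E in Ht Ht' * => H1 H2; exists t; split=> //.
move: H1 H2 (dist_seg_le Hs' Ht').
cases_lra.
Qed.

Lemma min_len : exists2 m : R, 0 < m & forall e : edge X, m <= len e.
Proof.
exists (\big[Num.min/1]_(e : edge X) len e); last by move=> e; apply: bigmin_le_cond.
by elim/big_ind: _ => // [x y x0 y0|e _]; rewrite ?lt_min ?x0 ?len_gt0.
Qed.

(* The distance to [v], truncated at a lower bound [m] of the edge lengths. *)
Definition vertex_fun (m : R) (v : vert X) (p : point X) : R :=
  let d u := if u == v then 0 else m in
  match p with
  | inl u => d u
  | inr q => let: (e, t) := val q in
      Num.min (d (root (e, false)) + t) (d (root (e, true)) + (len e - t))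
  end.

Lemma vertex_dist (m : R) v x y : 0 < m -> (forall e : edge X, m <= len e) ->
  vertex_fun m v x - vertex_fun m v y <= dist x y.
Proof.
move=> m0 mlen; apply: lipschitz_dist => e.
set d := fun u : vert X => if u == v then 0 else m.
have vE t : 0 <= t <= len e -> vertex_fun m v (seg e t) =
    Num.min (d (root (e, false)) + t) (d (root (e, true)) + (len e - t)).
  move=> Ht; have [H|H] := boolP (0 < t < len e); first by rewrite (seg_interior H).
  rewrite (seg_vertex H) /= -/(d _); case/nandP: H Ht => H Ht.
    have -> : t = 0 by lra.
    rewrite ltxx addr0 subr0 min_l // /d; have := mlen e.
    by case: eqP => _; case: eqP => _; lra.
  have -> : t = len e by lra.
  rewrite len_gt0 subrr addr0 min_r // /d; have := mlen e.
  by case: eqP => _; case: eqP => _; lra.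
move=> s t Hs Ht; rewrite !vE //; move: (d _) (d _) => a b; cases_lra.
Qed.

Lemma near_vertex (v : vert X) (h : half X) : exists2 c : R, 0 < c & forall s, 0 < s < c ->
  dist (hseg h s) (inl v) <= s -> v = root h.
Proof.
(* If [v] is not [root h] it may still be the other end of the edge, at distance at least [m - s]
   from the point; [s < m / 2] makes this larger than [s]. *)
have [m m0 mlen] := min_len; exists (m / 2); first by lra.
move=> s Hs H; apply/esym/eqP; apply: contraT => N.
have := vertex_dist v (hseg h s) (inl v) m0 mlen => /le_trans/(_ H).
rewrite {2}/vertex_fun eqxx subr0.
have := mlen h.1; case: h N {H} => e b N /= lm.
have I : 0 < (if b then len e - s else s) < len e by case: b {N}; lra.
rewrite /hseg /= (seg_interior I) /=.
case: b N {I} => /negbTE -> ; case: eqP => _; cases_lra.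
Qed.

End Points.

(** * Isometries are combinatorial *)

Section CurveIso.
Variables (R : realType) (g : nat).
Implicit Types X Y Z : tropical_curve R g.

(** The combinatorial form of an isometry. The map on half-edges records in which direction a loop
    is traversed, which the map on vertices does not see. *)
Record curve_iso X Y := CurveIso {
  ci_v : vert X -> vert Y;
  ci_v' : vert Y -> vert X;
  ci_h : half X -> half Y;
  ci_h' : half Y -> half X;
  ci_vK : cancel ci_v ci_v';
  ci_v'K : cancel ci_v' ci_v;
  ci_hK : cancel ci_h ci_h';
  ci_h'K : cancel ci_h' ci_h;
  ci_flip : forall h, ci_h (flip h) = flip (ci_h h);
  ci_root : forall h, root (ci_h h) = ci_v (root h);
  ci_len : forall h, len (ci_h h).1 = len h.1;
  ci_weight : forall v, weight (ci_v v) = weight v }.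

Definition ci_inv X Y (c : curve_iso X Y) : curve_iso Y X.
Proof.
refine (@CurveIso Y X (ci_v' c) (ci_v c) (ci_h' c) (ci_h c)
  (ci_v'K c) (ci_vK c) (ci_h'K c) (ci_hK c) _ _ _ _).
- by move=> h; apply: (can_inj (ci_hK c)); rewrite ci_flip !ci_h'K.
- by move=> h; apply: (can_inj (ci_vK c)); rewrite -ci_root ci_h'K ci_v'K.
- by move=> h; rewrite -(ci_len c) ci_h'K.
- by move=> v; rewrite -(ci_weight c) ci_v'K.
Defined.

Definition ci_pt X Y (c : curve_iso X Y) (p : point X) : point Y :=
  match p with
  | inl v => inl (ci_v c v)
  | inr q => hseg (ci_h c ((val q).1, false)) (val q).2
  end.

Lemma ci_pt_hseg X Y (c : curve_iso X Y) (h : half X) t : 0 <= t <= len h.1 ->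
  ci_pt c (hseg h t) = hseg (ci_h c h) t.
Proof.
have seg_case e s : 0 <= s <= len e -> ci_pt c (seg e s) = hseg (ci_h c (e, false)) s.
  move=> Hs; have [H|/negP H] := boolP (0 < s < len e); first by rewrite (seg_interior H).
  have [->|->] : s = 0 \/ s = len e by lra.
    by rewrite seg0 hseg0 ci_root.
  by rewrite seg_len -(ci_len c (e, false)) hseg_len -ci_flip ci_root.
case: h => e [] /= Ht; rewrite {1}/hseg /=; last exact: seg_case.
rewrite seg_case; last lra.
by rewrite -[(e, false)]/(flip (e, true)) ci_flip hseg_flip ci_len subKr.
Qed.

Lemma ci_ptK X Y (c : curve_iso X Y) : cancel (ci_pt c) (ci_pt (ci_inv c)).
Proof.
move=> p; case: (pointP p) => [v|e t Ht]; first by rewrite /= ci_vK.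
rewrite -[seg e t]/(hseg (e, false) t) !ci_pt_hseg ?ci_len /=; tlra.
by rewrite ci_hK.
Qed.

Lemma ci_pt_chain X Y (c : curve_iso X Y) x y L :
  chain_length x y L -> chain_length (ci_pt c x) (ci_pt c y) L.
Proof.
elim=> [z|e s t z M Hs Ht _ IH]; first exact: chain_nil.
apply: chain_trans IH; rewrite -![seg _ _]/(hseg (e, false) _) !ci_pt_hseg //.
have := ci_len c (e, false); case: (ci_h c _) => e' [] /= El; rewrite /hseg /=.
  have -> : `|s - t| = `|(len e' - s) - (len e' - t)| by rewrite distrC; congr `|_|; lra.
  by apply: chain_seg; lra.
by apply: chain_seg; rewrite El.
Qed.

Lemma ci_is_iso X Y (c : curve_iso X Y) : is_iso (ci_pt c) (ci_pt (ci_inv c)).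
Proof.
split; [exact: ci_ptK|exact: (ci_ptK (ci_inv c))| |].
- move=> x y; rewrite /dist; congr inf; apply/seteqP; split=> L /=.
    by move/(ci_pt_chain (ci_inv c)); rewrite !ci_ptK.
  exact: ci_pt_chain.
- case=> [v|q] /=; first exact: ci_weight.
  have H := ci_len c ((val q).1, false).
  case E : (hseg _ _) => [v|//]; case: (@hseg_interior_neq _ _ Y _ _ v _ E).
  by rewrite H; case: q {H E} => -[].
Qed.

Lemma is_iso_sym X Y i k : @is_iso R g X Y i k -> is_iso k i.
Proof.
move=> [ik ki iD iW]; split=> // [x y|x]; first by rewrite -iD !ki.
by rewrite -iW ki.
Qed.

(** A vertex sent to an interior point has weight 0, hence at least three half-edges. Their points
    at a small distance [r] would go to distinct points at distance [r] from an interior point, and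
    there are only two of those. *)
Lemma iso_vertex X Y i k : @is_iso R g X Y i k -> forall v, exists v', i (inl v) = inl v'.
Proof.
move=> [ik ki iD iW] v; move Ey: (i (inl v)) (iW (inl v)) => y.
case: (pointP y) Ey; first by eauto.
move=> e t Ht Ei Ew; exfalso.
have w0 : weight v = 0%N by rewrite -[weight v]Ew (seg_interior Ht).
have := sg_stable v; rewrite w0 muln0 addn0; rewrite /valence /val_in.
have [m m0 mlen] := min_len X.
(* At most a third of every edge length keeps the points [hseg h r] distinct, even for the two
   halves of a loop, and at distance exactly [r] from [v]; less than [min(t, len e - t)] keeps their
   images inside [e]. *)
pose r := Num.min (Num.min t (len e - t)) m / 3.
have r0 : 0 < r by rewrite divr_gt0 // !lt_min m0; lra.
have rt : r < Num.min t (len e - t) by rewrite /r; cases_lra.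
have rl (e' : edge X) : 0 <= r <= len e' /\ 3 * r <= len e' by have := mlen e'; rewrite /r; cases_lra.
set H := [set _ | _].
have vr h : h \in H -> i (hseg h r) = seg e (t - r) \/ i (hseg h r) = seg e (t + r).
  rewrite inE => /andP[_ /eqP Eh].
  have Ed : dist (seg e t) (i (hseg h r)) = r.
    rewrite -Ei iD -Eh -hseg0; apply/eqP; rewrite eq_le.
    have [Hr Hr'] := rl h.1.
    case: h {Eh} Hr Hr' => e' b /= Hr Hr'; rewrite /hseg /=; apply/andP; split.
      apply: le_trans (dist_seg_le _ _) _; try (case: b; lra).
      by case: b; cases_lra.
    have I : 0 <= (if b then len e' - r else r) <= len e' by case: b; lra.
    have := proj2 (dist_sym_seg_ge (seg e' (if b then len e' - 0 else 0)) I).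
    apply: le_trans; rewrite circle_funE ?eqxx //; last by case: b {I}; lra.
    by case: b {I}; cases_lra.
  have [|s [Ey1 Hs Es]] := @dist_ball _ _ Y e t (i (hseg h r)) Ht; first by rewrite Ed.
  rewrite {}Ed in Es; rewrite {}Ey1; move: Es; case: ger0P => _ Es; [right|left]; congr seg; lra.
(* The side of [t] on which the image lies embeds the half-edges at [v] into [bool]. *)
have inj : {in H &, injective (fun h => i (hseg h r) == seg e (t - r))}.
  move=> h1 h2 H1 H2 /= E.
  have : i (hseg h1 r) = i (hseg h2 r).
    move: E; case: eqP => [->|N1]; first by move/esym/eqP.
    case: eqP => // N2 _.
    by case: (vr _ H1) => // ->; case: (vr _ H2) => // ->.
  move/(can_inj ik); have [[? ?] [? ?]] := (rl h1.1, rl h2.1).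
  by case/hseg_inj => [|[]|[_ ?]] //; [lra|exfalso; lra].
have := card_in_imset inj => <-; rewrite ltnNge.
by apply/negP/negPn; rewrite (leq_trans (max_card _)) // card_bool.
Qed.

Lemma iso_vertex_dist X Y i k : @is_iso R g X Y i k -> forall e t, 0 < t < len e ->
  exists e' t', [/\ i (seg e t) = seg e' t', 0 < t' < len e'
    & Num.min t' (len e' - t') = Num.min t (len e - t)].
Proof.
(* The distance to the set of vertices is preserved. *)
move=> H.
have half_case X' Y' i' k' : @is_iso R g X' Y' i' k' -> forall e t, 0 < t < len e ->
    exists e' t', [/\ i' (seg e t) = seg e' t', 0 < t' < len e'
      & Num.min t' (len e' - t') <= Num.min t (len e - t)].
  move=> H' e t Ht; have [ik ki iD iW] := H'.
  move E: (i' (seg e t)) => y; case: (pointP y) E => [v|e' t' Ht'] E.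
    have [v' Ev] := iso_vertex (is_iso_sym H') v.
    by case: (@seg_interior_neq _ _ X' e t v' Ht); rewrite -Ev -E ik.
  exists e', t'; split => //.
  have Ht'' : 0 <= t' <= len e' by lra.
  have vd v : Num.min t' (len e' - t') <= dist (seg e t) (inl v).
    have [w Ew] := iso_vertex H' v.
    by rewrite -iD E Ew; apply: (proj1 (dist_sym_seg_ge (inl w) Ht'')).
  rewrite le_min; apply/andP; split.
    apply: le_trans (vd (root (e, false))) _; rewrite -seg0.
    apply: le_trans (dist_seg_le _ _) _; tlra.
    by rewrite subr0 ger0_norm //; lra.
  apply: le_trans (vd (root (e, true))) _; rewrite -seg_len.
  apply: le_trans (dist_seg_le _ _) _; rewrite ?lexx; tlra.
  by rewrite ler0_norm ?opprB //; lra.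
move=> e t Ht; have [e' [t' [E Ht' le1]]] := half_case _ _ _ _ H e t Ht.
exists e', t'; split=> //; apply/eqP; rewrite eq_le le1 /=.
have [e1 [t1 [E1 Ht1 le2]]] := half_case _ _ _ _ (is_iso_sym H) e' t' Ht'.
have [ik _ _ _] := H; rewrite -E ik in E1.
by have [-> ->] := seg_inj Ht E1.
Qed.

(** Seen from its midpoint, the open edge is a ball without vertices, so [dist_ball] puts its image
    inside one edge [e']. Preservation of the distance to the vertices makes the image of the
    midpoint the midpoint of [e'] and the lengths equal; a quarter point then fixes the
    direction. *)
Lemma iso_edge X Y i k : @is_iso R g X Y i k -> forall e, exists h : half Y,
  len h.1 = len e /\ forall t, 0 <= t <= len e -> i (seg e t) = hseg h t.
Proof.
move=> H e; have [ik ki iD iW] := H; have l0 := len_gt0 e.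
have [|e' [t' [Em Ht' dm]]] := iso_vertex_dist H (e := e) (t := len e / 2); first lra.
have dm' : Num.min t' (len e' - t') = len e / 2 by rewrite dm; cases_lra.
have ball s : 0 < s < len e -> exists t, [/\ i (seg e s) = seg e' t, 0 < t < len e',
    t = t' + (s - len e / 2) \/ t = t' - (s - len e / 2)
    & Num.min t (len e' - t) = Num.min s (len e - s)].
  move=> Hs; have [e1 [t1 [E1 Ht1 d1]]] := iso_vertex_dist H Hs.
  have d2 : dist (seg e' t') (i (seg e s)) = `|len e / 2 - s|.
    rewrite -Em iD; apply/eqP; rewrite eq_le dist_seg_le; tlra.
    have Hm : 0 <= len e / 2 <= len e by lra.
    have := proj1 (dist_sym_seg_ge (seg e s) Hm); rewrite circle_funE ?eqxx //; last lra.
    by apply: le_trans; cases_lra.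
  have [|t [Et Ht Ed]] := @dist_ball _ _ Y e' t' (i (seg e s)) Ht'.
    by rewrite d2 dm'; cases_lra.
  exists t; split=> //; first by move: Ed; rewrite d2; case: ger0P => ?; case: ger0P => ? ?; [right|left|left|right]; lra.
  rewrite Et in E1; have [Ee E2] := seg_inj Ht E1.
  by rewrite Ee E2.
(* The quarter points go to [t' - len e / 4] and [t' + len e / 4], both at distance [len e / 4] from
   the vertices. As [t'] and [len e' - t'] are at least [len e / 2], the first point forces
   [t' = len e / 2] and the second [len e' - t' = len e / 2]. *)
have Dt : t' = len e / 2 /\ len e' = len e.
  have [|t [E1 _ Et dt]] := ball (len e / 4); first lra.
  have [|u [E2 _ Eu du]] := ball (3 / 4 * len e); first lra.
  have Ntu : t != u.
    apply/eqP => E; rewrite E -E2 in E1; move/(can_inj ik): E1.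
    by case/seg_inj; first lra; move=> _; lra.
  have {}dt : Num.min t (len e' - t) = len e / 4 by rewrite dt; cases_lra.
  have {}du : Num.min u (len e' - u) = len e / 4 by rewrite du; cases_lra.
  have Stu : t + u = 2 * t'.
    by case: Et Eu => Et [] Eu; first [lra | exfalso; move/eqP: Ntu; apply; lra].
  have Eu' : u = 2 * t' - t by lra.
  rewrite Eu' in du.
  have minE (a b c : R) : Num.min a b = c -> [/\ c <= a, c <= b & a = c \/ b = c].
    by move=> <-; case: (leP a b) => [ab|/ltW ba]; split; rewrite ?lexx //; [left|right].
  have [m1 m2 _] := minE _ _ _ dm'; have [_ _ o1] := minE _ _ _ dt; have [_ _ o2] := minE _ _ _ du.
  clear - l0 m1 m2 o1 o2 Et.
  by case: Et o1 o2 => -> [] o1 [] o2; split; lra.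
case: Dt => Et' El; subst t'.
have ball2 s : 0 < s < len e -> i (seg e s) = seg e' s \/ i (seg e s) = seg e' (len e' - s).
  move=> Hs; have [t [-> _ [->|->] _]] := ball s Hs; [left|right]; congr seg; lra.
(* The midpoint is symmetric; the quarter point tells which end of [e'] corresponds to the start of
   [e]. *)
have [h [Eh1 Eh]] : exists h : half Y, h.1 = e' /\ i (seg e (len e / 4)) = hseg h (len e / 4).
  case: (ball2 (len e / 4)) => [|E|E]; first lra.
    by exists (e', false); split.
  by exists (e', true); split.
have Hlen : len h.1 = len e by rewrite Eh1.
have ball3 s : 0 < s < len e -> i (seg e s) = hseg h s \/ i (seg e s) = hseg h (len e - s).
  move=> /ball2; case: h Eh1 {Eh Hlen} => e1 b /= ->; rewrite /hseg /= El.
  by case: b => [] []->; rewrite ?subKr; auto.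
(* On the wrong side, [seg e s] would land at circle distance more than [|s - len e / 4|] from the
   image of the quarter point. *)
have low s : 0 < s <= len e / 2 -> i (seg e s) = hseg h s.
  move=> Hs; case: (ball3 s) => //; first lra.
  have [->|Ns] := eqVneq s (len e / 2); first by move=> ->; congr hseg; lra.
  move=> E; exfalso.
  have := @dist_seg_le _ _ X e s (len e / 4); rewrite -iD Eh E => /(_ _ _).
  have : s < len e / 2 by rewrite lt_neqAle Ns; lra.
  move=> {Ns} Hs2 D.
  have {D} := D ltac:(lra) ltac:(lra).
  move Ey : (hseg h (len e / 4)) => y.
  have [s1 [Es1 Is1 Ds1]] : exists s1, [/\ hseg h (len e - s) = seg h.1 s1, 0 <= s1 <= len h.1 &
      circle_fun h.1 s1 y = Num.min (3 / 4 * len e - s) (len e - (3 / 4 * len e - s))].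
    exists (if h.2 then len h.1 - (len e - s) else len e - s); split=> //.
      by rewrite Hlen; case: h.2; lra.
    rewrite -Ey /hseg circle_funE ?eqxx ?Hlen //; try (case: h.2; lra).
    clear - Hs l0; by case: h.2; congr Num.min; cases_lra.
  rewrite Es1; have := proj1 (dist_sym_seg_ge y Is1); rewrite {}Ds1.
  by clear - Hs Hs2 l0; cases_lra.
have int s : 0 < s < len e -> i (seg e s) = hseg h s.
  move=> Hs; case: (ball3 s Hs) => // E.
  have [H2|H2] := leP s (len e / 2); first by apply: low; lra.
  rewrite -low in E; last lra.
  by move/(can_inj ik): E => /(seg_inj Hs) [_ ?]; exfalso; lra.
(* The end of [e] is only known to go to some vertex; a nearby point of [e] goes to a point of [h]
   close to both this vertex and the expected root, and [near_vertex] identifies them. *)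
have ends (b : bool) : i (inl (root (e, b))) = inl (root (if b then flip h else h)).
  have [v Ev] := iso_vertex H (root (e, b)); rewrite Ev; congr inl.
  have [c c0 Hc] := near_vertex v (if b then flip h else h).
  have [s [s0 sc sl]] : exists s, [/\ 0 < s, s < c & s < len e].
    by exists (Num.min c (len e) / 2); clear - c0 l0; split; cases_lra.
  apply: (Hc s); first lra.
  have -> : hseg (if b then flip h else h) s = i (seg e (if b then len e - s else s)).
    rewrite int; last by case: b {Ev Hc}; lra.
    by case: b {Ev Hc}; rewrite ?hseg_flip ?Hlen.
  rewrite -Ev iD; case: b {Ev Hc}; rewrite -?seg_len -?seg0.
    by apply: le_trans (dist_seg_le _ _) _; rewrite ?lexx; cases_lra.
  by apply: le_trans (dist_seg_le _ _) _; rewrite ?lexx; cases_lra.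
exists h; split=> // t Ht.
have [I|/negP I] := boolP (0 < t < len e); first exact: int.
have [->|->] : t = 0 \/ t = len e by lra.
  by rewrite seg0 hseg0 (ends false).
by rewrite seg_len -Hlen hseg_len (ends true).
Qed.

Lemma is_iso_curve_iso X Y i k : @is_iso R g X Y i k ->
  exists c : curve_iso X Y, i = ci_pt c /\ k = ci_pt (ci_inv c).
Proof.
suff maps X' Y' i' k' : @is_iso R g X' Y' i' k' -> exists fv : vert X' -> vert Y',
    exists fh : half X' -> half Y', [/\ forall v, i' (inl v) = inl (fv v),
      forall h, fh (flip h) = flip (fh h), forall h, len (fh h).1 = len h.1
      & forall h t, 0 <= t <= len h.1 -> i' (hseg h t) = hseg (fh h) t].
  move=> H; have [ik ki iD iW] := H.
  have [fv [fh [Ev Ef El Es]]] := maps _ _ _ _ H.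
  have [fv' [fh' [Ev' Ef' El' Es']]] := maps _ _ _ _ (is_iso_sym H).
  have hK X' Y' (a : half X' -> half Y') (b : half Y' -> half X') i' k' :
      cancel i' k' -> (forall h, len (a h).1 = len h.1) ->
      (forall h t, 0 <= t <= len h.1 -> i' (hseg h t) = hseg (a h) t) ->
      (forall h t, 0 <= t <= len h.1 -> k' (hseg h t) = hseg (b h) t) -> cancel a b.
    move=> ik' la ia kb h; have l0 := len_gt0 h.1.
    (* Unlike the midpoint, a quarter point distinguishes [h] from [flip h]. *)
    have := ik' (hseg h (len h.1 / 4)); rewrite ia ?kb ?la; tlra.
    by move/esym/hseg_inj => [|[]|[_ ?]] //; [rewrite ?ia ?kb ?la; lra|exfalso; lra].
  have vK : cancel fv fv' by move=> v; have := ik (inl v); rewrite Ev Ev' => -[].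
  have v'K : cancel fv' fv by move=> v; have := ki (inl v); rewrite Ev' Ev => -[].
  have rt h : root (fh h) = fv (root h).
    have l0 := len_gt0 h.1.
    have /Es : 0 <= (0 : R) <= len h.1 by rewrite lexx ltW.
    by rewrite !hseg0 Ev => -[].
  have wt v : weight (fv v) = weight v by have := iW (inl v); rewrite Ev.
  exists (CurveIso vK v'K (hK _ _ _ _ _ _ ik El Es Es') (hK _ _ _ _ _ _ ki El' Es' Es) Ef rt El wt).
  have pt X' Y' (c : curve_iso X' Y') i' : (forall v, i' (inl v) = inl (ci_v c v)) ->
      (forall h t, 0 <= t <= len h.1 -> i' (hseg h t) = hseg (ci_h c h) t) -> i' = ci_pt c.
    move=> iv ih; apply: funext => p; case: (pointP p) => [v|e t Ht]; first exact: iv.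
    by rewrite -[seg e t]/(hseg (e, false) t) ih ?ci_pt_hseg //=; lra.
  by split; apply: pt.
move=> H.
have [fv Ev] := choice (iso_vertex H).
have [f Ef] := choice (iso_edge H).
exists fv, (fun h => if h.2 then flip (f h.1) else f h.1); split=> //.
- by case=> e [] /=; rewrite ?flipK.
- by case=> e b /=; have [<- _] := Ef e; case: b.
case=> e b t /= Ht; have [El Es] := Ef e; case: b; rewrite {1}/hseg /=.
  by rewrite Es ?hseg_flip ?El //; lra.
exact: Es.
Qed.

End CurveIso.

(** * Piecewise linear functions *)

Section PiecewiseLinear.
Variable R : realType.
Implicit Types (phi psi : R -> R) (a b c : R).

(** With concatenation as a constructor and empty intervals allowed, sums are treated by induction,
    and no common refinement of two subdivisions has to be built. *)
Inductive PL phi : R -> R -> Prop :=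
| PL_affine a b (k : int) c : a <= b ->
    (forall t, a <= t <= b -> phi t = k%:~R * t + c) -> PL phi a b
| PL_cat a b c : PL phi a b -> PL phi b c -> PL phi a c.

Lemma PL_le phi a b : PL phi a b -> a <= b.
Proof. by elim=> // ? ? ? _ + _; apply: le_trans. Qed.

Lemma PL_point phi a : PL phi a a.
Proof.
by apply: (@PL_affine _ _ _ 0 (phi a)) => // t Ht; rewrite mul0r add0r; congr phi; lra.
Qed.

Fixpoint pieces phi a (ts : seq R) : Prop :=
  if ts is t :: ts' then
    (exists (k : int) (c : R), forall u, a <= u <= t -> phi u = k%:~R * u + c) /\
    pieces phi t ts'
  else True.

Lemma pieces_nth phi a ts : pieces phi a ts <->
  forall i, (i < size ts)%N -> exists (k : int) (c : R),
      forall t, (a :: ts)`_i <= t <= ts`_i -> phi t = k%:~R * t + c.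
Proof.
elim: ts a => [|t ts IH] a //=; rewrite IH; split=> [[H1 H2] [|i]|H] //.
  by move=> Hi; apply: H2.
by split=> [|i Hi]; [apply: (H 0%N)|apply: (H i.+1)].
Qed.

Lemma pieces_cat phi a ts1 ts2 :
  pieces phi a ts1 -> pieces phi (last a ts1) ts2 -> pieces phi a (ts1 ++ ts2).
Proof. by elim: ts1 a => //= t ts1 IH a [H1 H2] /(IH _ H2). Qed.

Lemma pl_integralP l phi : pl_integral l phi <-> PL phi 0 l.
Proof.
split=> [[ts [p <- /pieces_nth]]|H].
  elim: ts 0 p => [|t ts IH] a /=; first by move=> _ _; apply: PL_point.
  move=> /andP[/ltW lt_at p] [[k [c H]] Hp]; apply: PL_cat (IH _ p Hp).
  exact: PL_affine H.
suff [ts [p El /pieces_nth Hp]] : exists ts,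
    [/\ path <%R 0 ts, last 0 ts = l & pieces phi 0 ts] by exists ts.
elim: H => [a b k c|a b c _ [ts1 [p1 <- H1]] _ [ts2 [p2 <- H2]]].
  (* Subdivisions in [pl_integral] are strictly increasing, so an empty interval contributes no
     point. *)
  rewrite le_eqVlt => /predU1P[->|lt_ab] H; first by exists [::].
  by exists [:: b] => /=; rewrite lt_ab; split=> //; split=> //; exists k, c.
exists (ts1 ++ ts2); split; [by rewrite cat_path p1|by rewrite last_cat|exact: pieces_cat].
Qed.

Lemma PL_ext phi psi a b : PL phi a b ->
  (forall t, a <= t <= b -> phi t = psi t) -> PL psi a b.
Proof.
elim=> [a' b' k c le H|a' b' c' H1 IH1 H2 IH2] E.
  by apply: (@PL_affine _ _ _ k c) => // t Ht; rewrite -E ?H.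
have := PL_le H1; have := PL_le H2 => le1 le2.
by apply: (@PL_cat _ _ b'); [apply: IH1|apply: IH2] => t Ht; apply: E; lra.
Qed.

Lemma PL_restrict phi a b a' b' : PL phi a b -> a <= a' -> a' <= b' -> b' <= b ->
  PL phi a' b'.
Proof.
move=> H; elim: H a' b' => [c d k m le H|c d e H1 IH1 H2 IH2] a' b' ha hab hb.
  by apply: (@PL_affine _ _ _ k m) => // t Ht; apply: H; lra.
have [h|h] := leP b' d; first exact: IH1.
have [h'|h'] := leP d a'; first exact: IH2.
by apply: (@PL_cat _ _ d); [apply: IH1|apply: IH2]; rewrite ?lexx // ltW.
Qed.

Lemma PL_opp phi a b : PL phi a b -> PL (fun t => - phi t) a b.
Proof.
elim=> [c d k m le H|c d e H1 IH1 H2 IH2]; last exact: PL_cat IH1 IH2.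
by apply: (@PL_affine _ _ _ (- k) (- m)) => // t /H ->; rewrite intrN; lra.
Qed.

Lemma PL_add phi psi a b : PL phi a b -> PL psi a b -> PL (fun t => phi t + psi t) a b.
Proof.
elim=> [c d k m le H|c d e H1 IH1 H2 IH2] G.
  elim: G le H => [c' d' k' m' le' H' _ H|c' d' e' G1 IH1 G2 IH2 le H].
    apply: (@PL_affine _ _ _ (k + k') (m + m')) => // t Ht.
    by rewrite H // H' // intrD; lra.
  have le1 := PL_le G1; have le2 := PL_le G2.
  by apply: (@PL_cat _ _ d'); [apply: IH1|apply: IH2] => // t Ht; apply: H; lra.
have le1 := PL_le H1; have le2 := PL_le H2.
by apply: (@PL_cat _ _ d); [apply: IH1|apply: IH2]; apply: (PL_restrict G).
Qed.

Lemma PL_rev phi a b c : PL phi a b -> PL (fun t => phi (c - t)) (c - b) (c - a).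
Proof.
elim=> [a' b' k m le H|a' b' c' H1 IH1 H2 IH2]; last exact: PL_cat IH2 IH1.
apply: (@PL_affine _ _ _ (- k) (k%:~R * c + m)); first by lra.
move=> t Ht; rewrite H ?intrN; [ring|lra].
Qed.

Lemma PL_min a b c : a <= b -> PL (fun t => Num.min t c) a b.
Proof.
move=> le; have low a' b' : a' <= b' -> b' <= c -> PL (fun t => Num.min t c) a' b'.
  by move=> l1 l2; apply: (@PL_affine _ _ _ 1 0) => // t Ht; rewrite min_l; lra.
have high a' b' : a' <= b' -> c <= a' -> PL (fun t => Num.min t c) a' b'.
  by move=> l1 l2; apply: (@PL_affine _ _ _ 0 c) => // t Ht; rewrite min_r; lra.
have [h|h] := leP b c; first exact: low.
have [h'|h'] := leP c a; first exact: high.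
by apply: (@PL_cat _ _ c); [apply: low|apply: high]; rewrite // ltW.
Qed.

Lemma PL_germ phi a b s : PL phi a b -> a <= s < b ->
  exists (m : int) (eps : R), 0 < eps /\
    forall u, 0 <= u <= eps -> phi s = phi (s + u) + m%:~R * u.
Proof.
elim=> [c d k m le H|c d e H1 IH1 H2 IH2] Hs; last first.
  by have [h|h] := ltP s d; [apply: IH1|apply: IH2]; lra.
exists (- k), (d - s); split=> [|u Hu]; first lra.
by rewrite !H ?intrN; [ring|lra|lra].
Qed.

(** At a breakpoint, the pieces on both sides have the slope [m] of the two-sided germ, so they
    continue each other; empty pieces, where a slope means nothing, are discarded first. *)
Lemma PL_smooth phi a b : PL phi a b ->
  (forall s, a < s < b -> exists (m : R) (eps : R), 0 < eps /\
     forall u, `|u| <= eps -> phi (s + u) = phi s + m * u) ->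
  exists (k : int) (c : R), forall t, a <= t <= b -> phi t = k%:~R * t + c.
Proof.
elim=> [c d k m le H|c d e H1 IH1 H2 IH2] S; first by exists k, m.
have := PL_le H1; rewrite le_eqVlt => /predU1P[Ecd|lcd]; first by subst d; apply: IH2.
have := PL_le H2; rewrite le_eqVlt => /predU1P[Ede|lde]; first by subst d; apply: IH1.
have [|k1 [c1 E1]] := IH1; first by move=> s Hs; apply: S; lra.
have [|k2 [c2 E2]] := IH2; first by move=> s Hs; apply: S; lra.
have [|m [eps [eps0 Em]]] := S d; first lra.
pose r := Num.min eps (Num.min (d - c) (e - d)) / 2.
have r0 : 0 < r by rewrite divr_gt0 // !lt_min; lra.
have [r1 r2 r3] : [/\ r <= eps, r <= d - c & r <= e - d] by rewrite /r; split; cases_lra.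
have := Em r; have := Em (- r); rewrite normrN (ger0_norm (ltW r0)) => /(_ r1) F1 /(_ r1) F2.
rewrite !E1 in F1; tlra.
rewrite !E2 in F2; tlra.
have F3 := E1 d; rewrite E2 in F3; last by lra.
have {}F3 := F3 ltac:(lra).
have km1 : (k1%:~R - m) * r = 0 by lra.
have km2 : (k2%:~R - m) * r = 0 by lra.
move: km1 km2 => /eqP; rewrite mulf_eq0 (gt_eqF r0) orbF => /eqP G1.
move=> /eqP; rewrite mulf_eq0 (gt_eqF r0) orbF => /eqP G2.
exists k1, c1 => t Ht; have [h|h] := leP t d; first by apply: E1; lra.
have k12 : k1%:~R = k2%:~R :> R by lra.
rewrite E2; last lra.
by rewrite k12 in F3 *; lra.
Qed.

End PiecewiseLinear.

Section Slopes.
Variables (R : realType) (g : nat).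
Implicit Types X Y : tropical_curve R g.

Lemma pl_functionP X (f : point X -> R) : pl_function f <->
  forall h : half X, PL (fun t => f (hseg h t)) 0 (len h.1).
Proof.
split=> [H [e b]|H e]; last by apply/pl_integralP; apply: (H (e, false)).
have {}H := proj1 (pl_integralP _ _) (H e); case: b => //=.
by have := PL_rev (len e) H; rewrite subrr subr0.
Qed.

(** Two integers that both describe the germ agree on the shorter of the two intervals, so the
    choice made by [xget] is forced. *)
Lemma incoming_slopeE X (f : point X -> R) h t (m : int) (eps : R) : 0 < eps ->
  (forall u, 0 <= u <= eps -> f (hseg h t) = f (hseg h (t + u)) + m%:~R * u) ->
  incoming_slope f h t = m.
Proof.
move=> eps0 H; rewrite /incoming_slope; case: xgetP => [m' _ [d d0 H']|/(_ m)]; last first.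
  by case; exists eps.
pose r := Num.min d eps.
have r0 : 0 < r by rewrite lt_min d0.
have [r1 r2] : r <= d /\ r <= eps by rewrite /r; split; cases_lra.
have E : (m'%:~R - m%:~R) * r = 0.
  have := H r; have := H' r; rewrite r1 r2 (ltW r0) => /(_ isT) -> /(_ isT).
  lra.
move/eqP: E; rewrite mulf_eq0 (gt_eqF r0) orbF subr_eq0 eqr_int.
by move/eqP.
Qed.

Lemma incoming_germ X (f : point X -> R) h t : pl_function f -> 0 <= t < len h.1 ->
  exists2 eps : R, 0 < eps &
    forall u, 0 <= u <= eps ->
      f (hseg h t) = f (hseg h (t + u)) + (incoming_slope f h t)%:~R * u.
Proof.
move=> /pl_functionP/(_ h)/PL_germ F /F[m [eps [eps0 H]]].
by exists eps => // u Hu; rewrite (incoming_slopeE eps0 H); apply: H.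
Qed.

Lemma pl_add X (f1 f2 : point X -> R) : pl_function f1 -> pl_function f2 ->
  pl_function (fun p => f1 p + f2 p).
Proof. by move=> H1 H2 e; apply/pl_integralP; apply: PL_add; apply/pl_integralP. Qed.

Lemma pl_opp X (f : point X -> R) : pl_function f -> pl_function (fun p => - f p).
Proof. by move=> H e; apply/pl_integralP; apply: PL_opp; apply/pl_integralP. Qed.

Lemma incoming_add X (f1 f2 : point X -> R) h t : pl_function f1 -> pl_function f2 ->
  0 <= t < len h.1 -> incoming_slope (fun p => f1 p + f2 p) h t =
  incoming_slope f1 h t + incoming_slope f2 h t.
Proof.
move=> H1 H2 Ht; have [d1 d10 E1] := incoming_germ H1 Ht; have [d2 d20 E2] := incoming_germ H2 Ht.
apply: (@incoming_slopeE _ _ _ _ _ (Num.min d1 d2)); first by rewrite lt_min d10.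
move=> u; rewrite le_min => /andP[u0 /andP[u1 u2]].
rewrite (E1 u) ?u0 // (E2 u) ?u0 // intrD; lra.
Qed.

Lemma incoming_opp X (f : point X -> R) h t : pl_function f ->
  0 <= t < len h.1 -> incoming_slope (fun p => - f p) h t = - incoming_slope f h t.
Proof.
move=> H Ht; have [d d0 E] := incoming_germ H Ht.
by apply: (incoming_slopeE d0) => u Hu; rewrite (E u) // intrN; lra.
Qed.

Lemma ord_hseg X (f : point X -> R) h t : 0 < t < len h.1 ->
  ord f (hseg h t) = incoming_slope f h t + incoming_slope f (flip h) (len h.1 - t).
Proof.
case: h => e [] /= Ht; rewrite {1}/hseg /=.
  have H : 0 < len e - t < len e by lra.
  by rewrite (seg_interior H) /= subKr addrC.
by rewrite (seg_interior Ht).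
Qed.

Lemma ord_add X (f1 f2 : point X -> R) : pl_function f1 -> pl_function f2 ->
  forall p, ord (fun p => f1 p + f2 p) p = ord f1 p + ord f2 p.
Proof.
move=> H1 H2 p; case: (pointP p) => [v|e t Ht].
  rewrite /ord -big_split; apply: eq_bigr => h _; apply: incoming_add => //.
  by rewrite lexx len_gt0.
rewrite -[seg e t]/(hseg (e, false) t) !ord_hseg // !incoming_add //=; tlra.
by rewrite addrACA.
Qed.

Lemma ord_opp X (f : point X -> R) : pl_function f ->
  forall p, ord (fun p => - f p) p = - ord f p.
Proof.
move=> H p; case: (pointP p) => [v|e t Ht].
  rewrite /ord -sumrN; apply: eq_bigr => h _; apply: incoming_opp => //.
  by rewrite lexx len_gt0.
rewrite -[seg e t]/(hseg (e, false) t) !ord_hseg // !incoming_opp //=; tlra.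
by rewrite opprD.
Qed.

Lemma pl_cst X (c : R) : pl_function (fun _ : point X => c).
Proof.
by move=> e; apply/pl_integralP; apply: (@PL_affine _ _ _ _ 0 c) => [|t _]; rewrite ?ltW ?len_gt0 // mul0r add0r.
Qed.

Lemma ord_cst X (c : R) (p : point X) : ord (fun _ => c) p = 0.
Proof.
have E h t : incoming_slope (fun _ : point X => c) h t = 0.
  by apply: (@incoming_slopeE _ _ _ _ _ 1) => // u _; rewrite mul0r addr0.
by case: p => [v|[[e t] H]] /=; rewrite ?E ?addr0 // big1.
Qed.

Lemma pl_ci_pt X Y (c : curve_iso X Y) (f : point Y -> R) :
  pl_function f -> pl_function (f \o ci_pt c).
Proof.
move=> /pl_functionP H; apply/pl_functionP => h.
by apply: PL_ext; [rewrite -(ci_len c); apply: H|move=> t Ht; rewrite /= ci_pt_hseg].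
Qed.

Lemma incoming_ci_pt X Y (c : curve_iso X Y) (f : point Y -> R) h t :
  pl_function f -> 0 <= t < len h.1 ->
  incoming_slope (f \o ci_pt c) h t = incoming_slope f (ci_h c h) t.
Proof.
move=> H Ht; have [|d d0 E] := @incoming_germ _ f (ci_h c h) t H; first by rewrite ci_len.
apply: (@incoming_slopeE _ _ _ _ _ (Num.min d (len h.1 - t))).
  by rewrite lt_min d0; lra.
move=> u; rewrite le_min => /andP[u0 /andP[u1 u2]] /=.
by rewrite !ci_pt_hseg ?(E u) ?u0 //; lra.
Qed.

Lemma ord_ci_pt X Y (c : curve_iso X Y) (f : point Y -> R) : pl_function f ->
  forall p, ord (f \o ci_pt c) p = ord f (ci_pt c p).
Proof.
move=> H p; case: (pointP p) => [v|e t Ht].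
  rewrite /ord /= (reindex (ci_h c)) /=; last first.
    by exists (ci_h' c) => h _; rewrite ?ci_hK ?ci_h'K.
  apply: eq_big => h; first by rewrite ci_root (can_eq (ci_vK c)).
  by move=> _; apply: incoming_ci_pt; rewrite // lexx len_gt0.
rewrite -[seg e t]/(hseg (e, false) t) ci_pt_hseg; last by rewrite /=; lra.
rewrite !ord_hseg ?ci_len // !incoming_ci_pt //=; tlra.
by rewrite -ci_flip ?ci_len.
Qed.

End Slopes.

(** * Linear equivalence *)

(** Decidable equality of points lets divisors be written as sums of indicators. *)
HB.instance Definition _ (R : realType) (g : nat) (X : tropical_curve R g) :=
  Equality.copy (point X) (vert X + {p : edge X * R | 0 < p.2 < len p.1})%type.

Section DivisorEquivalence.
Variables (R : realType) (g : nat).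
Implicit Types X Y Z : tropical_curve R g.

(** This is [pair_equiv] freed from polystability, so that it also applies to the divisors met along
    a zigzag of face morphisms. *)
Definition dequiv X Y (D : point X -> int) (D' : point Y -> int) : Prop :=
  exists i k, @is_iso R g X Y i k /\ linearly_equivalent (fun y => D (k y)) D'.

Lemma dequiv_refl X (D : point X -> int) : dequiv D D.
Proof.
exists id, id; split; first by split.
by exists (fun _ => 0); [apply: pl_cst|move=> x; rewrite ord_cst subrr].
Qed.

(** The function has to be transported to the other curve; it stays piecewise linear because the
    isometry is a [curve_iso]. *)
Lemma dequiv_sym X Y (D : point X -> int) (D' : point Y -> int) :
  dequiv D D' -> dequiv D' D.
Proof.
move=> [i [k [H [f fpl Ef]]]]; exists k, i; split; first exact: is_iso_sym.
have [c [Ei Ek]] := is_iso_curve_iso H; have [ik _ _ _] := H.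
exists (fun p => - (f \o ci_pt c) p); first by apply: pl_opp; apply: pl_ci_pt.
move=> x; rewrite ord_opp; last exact: pl_ci_pt.
by rewrite ord_ci_pt // -Ei -Ef ik opprB.
Qed.

Lemma dequiv_trans X Y Z (D : point X -> int) (D' : point Y -> int) (D'' : point Z -> int) :
  dequiv D D' -> dequiv D' D'' -> dequiv D D''.
Proof.
move=> [i [k [H [f fpl Ef]]]] [i' [k' [H' [f' fpl' Ef']]]].
exists (i' \o i), (k \o k'); split.
  have [ik ki iD iW] := H; have [ik' ki' iD' iW'] := H'; split; rewrite /comp.
  - by move=> x; rewrite ik' ik.
  - by move=> x; rewrite ki ki'.
  - by move=> x y; rewrite iD' iD.
  - by move=> x; rewrite iW' iW.
have [c [_ Ek]] := is_iso_curve_iso H'.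
exists (fun p => (f \o k') p + f' p); rewrite Ek.
  by apply: pl_add => //; apply: pl_ci_pt.
move=> x; rewrite ord_add //; last exact: pl_ci_pt.
by rewrite ord_ci_pt // -Ef -Ef' /= Ek addrA subrK.
Qed.

Lemma sum_half_root (G : graph) (v : vert G) (F : half G -> int) :
  \sum_(h : half G | root h == v) F h =
  \sum_(e : edge G) ((root (e, false) == v)%:R * F (e, false) +
                     (root (e, true) == v)%:R * F (e, true)).
Proof.
rewrite big_mkcond (eq_bigr (fun h => \sum_(b | b == h.2) (root (h.1, b) == v)%:R * F (h.1, b))).
  rewrite -(pair_bigA _ (fun e b => \sum_(b' | b' == b) (root (e, b') == v)%:R * F (e, b'))) /=.
  by apply: eq_bigr => e _; rewrite big_bool !big_pred1_eq addrC.
by case=> e b _; rewrite big_pred1_eq; case: eqP => _; rewrite ?mul1r ?mul0r.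
Qed.

(** A chip-firing function: on [e] it is constant except between [t e] and [t' e], where it has
    slope 1 or -1. The total change along [e] is [t' e - t e], so the condition on [phi] is the
    matching at the far end. Positions at the ends of an edge are allowed and stand for vertices. *)
Lemma pl_move X (phi : vert X -> R) (t t' : edge X -> R) :
  (forall e, 0 <= t e <= len e) -> (forall e, 0 <= t' e <= len e) ->
  (forall e, t' e - t e = phi (root (e, true)) - phi (root (e, false))) ->
  exists2 f : point X -> R, pl_function f &
    forall x, ord f x = \sum_e ((x == seg e (t' e))%:R - (x == seg e (t e))%:R).
Proof.
move=> Ht Ht' E.
pose f (p : point X) := match p with
  | inl v => phi v
  | inr q => let: (e, s) := val q in
      phi (root (e, false)) + (Num.min s (t' e) - Num.min s (t e))
  end.
have fE e s : 0 <= s <= len e ->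
    f (seg e s) = phi (root (e, false)) + (Num.min s (t' e) - Num.min s (t e)).
  move=> Hs; have [H|H] := boolP (0 < s < len e); first by rewrite (seg_interior H).
  have {Ht Ht' E} := (Ht e, Ht' e, E e) => -[[Ht Ht'] E].
  rewrite (seg_vertex H) /=; case/nandP: H => H.
    have -> : s = 0 by lra.
    by rewrite ltxx !min_l; lra.
  have -> : s = len e by lra.
  by rewrite len_gt0 !min_r; lra.
have fpl : pl_function f.
  move=> e; apply/pl_integralP; have l0 := ltW (len_gt0 e).
  apply: (@PL_ext _ (fun s => phi (root (e, false)) +
            (Num.min s (t' e) + - Num.min s (t e)))) => [|s Hs]; last by rewrite fE.
  apply: PL_add; last by apply: PL_add; [|apply: PL_opp]; apply: PL_min.
  by apply: (@PL_affine _ _ _ _ 0 (phi (root (e, false)))) => // s _; rewrite mul0r add0r.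
have slopeL e s : 0 <= s < len e ->
    incoming_slope f (e, false) s = (s < t e)%R%:R - (s < t' e)%R%:R.
  (* [d x] is a radius on which [min(_, x)] is affine to the right of [s]; 1 stands for the case
     without breakpoint ahead. *)
  move=> Hs; pose d x := if s < x then x - s else 1.
  have d0 x : 0 < d x by rewrite /d; case: ifP => // ?; lra.
  pose r := Num.min (len e - s) (Num.min (d (t e)) (d (t' e))).
  apply: (@incoming_slopeE _ _ _ _ _ _ _ r); first by rewrite !lt_min !d0; lra.
  move=> u; rewrite !le_min => /andP[u0 /andP[ul /andP[u1 u2]]].
  rewrite /hseg /= !fE; try lra.
  have mE x : u <= d x -> Num.min (s + u) x = Num.min s x + (s < x)%R%:R * u.
    rewrite /d; case: ltP => Hx /= Hu; first by rewrite !min_l; lra.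
    by rewrite !min_r; lra.
  by rewrite !mE // rmorphB /= !natz; lra.
have slopeR e s : 0 < s <= len e ->
    incoming_slope f (e, true) (len e - s) = (s <= t' e)%R%:R - (s <= t e)%R%:R.
  move=> Hs; pose d x := if x < s then s - x else 1.
  have d0 x : 0 < d x by rewrite /d; case: ifP => // ?; lra.
  pose r := Num.min s (Num.min (d (t e)) (d (t' e))).
  apply: (@incoming_slopeE _ _ _ _ _ _ _ r); first by rewrite !lt_min !d0; lra.
  move=> u; rewrite !le_min => /andP[u0 /andP[ul /andP[u1 u2]]].
  rewrite /hseg /= subKr.
  have -> : len e - (len e - s + u) = s - u by lra.
  rewrite !fE; try lra.
  have mE x : u <= d x -> Num.min (s - u) x = Num.min s x - (s <= x)%R%:R * u.
    rewrite /d; case: ltP => Hx /= Hu; first by rewrite !min_r; lra.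
    by rewrite !min_l; lra.
  by rewrite !mE // rmorphB /= !natz; lra.
exists f => // x; case: (pointP x) => [v|e s Hs].
  rewrite /ord sum_half_root; apply: eq_bigr => e _.
  have := slopeR e (len e); rewrite subrr => ->; last by rewrite len_gt0 lexx.
  rewrite slopeL; last by rewrite lexx len_gt0.
  have vE s : 0 <= s <= len e -> (inl v == seg e s :> point X)%:R =
      (root (e, false) == v)%:R * (1 - (0 < s)%R%:R) + (root (e, true) == v)%:R * (len e <= s)%R%:R :> int.
    move=> Hs; have l0 := len_gt0 e.
    have [H|H] := boolP (0 < s < len e).
      have [-> H2] := andP H; rewrite leNgt H2 subrr !mulr0 addr0.
      by case: eqP => // F; case: (seg_interior_neq H (esym F)).
    rewrite (seg_vertex H) (inj_eq inl_inj) eq_sym; case/nandP: H => H.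
      have -> : s = 0 by lra.
      by rewrite ltxx leNgt l0 subr0 mulr1 mulr0 addr0.
    have -> : s = len e by lra.
    by rewrite l0 lexx subrr mulr0 mulr1 add0r.
  by rewrite !vE //; ring.
rewrite -[seg e s]/(hseg (e, false) s) ord_hseg // /flip /= slopeL; last by lra.
rewrite slopeR; last by lra.
rewrite (bigD1 e) //= big1 => [|e' Ne].
  have sE t0 : (seg e s == seg e t0) = (s <= t0) && ~~ (s < t0).
    rewrite -leNgt -eq_le; apply/eqP/eqP => [|->//].
    by case/(seg_inj Hs).
  rewrite /hseg /= !sE addr0.
  by case: (ltgtP s (t e)) => _; case: (ltgtP s (t' e)) => _.
have N t0 : (seg e s == seg e' t0) = false.
  by apply/eqP => /(seg_inj Hs) [E']; rewrite E' eqxx in Ne.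
by rewrite /hseg /= !N.
Qed.

(** Adding the one-kink functions [min(s, t1)] and [- min(s, t2)], each if present, cancels the
    prescribed kinks of [f]. What remains is affine with an integer slope [k], and the slopes and
    end values of [f] are read off. *)
Lemma edge_shape X (f : point X -> R) e (b1 b2 : bool) t1 t2 : pl_function f ->
  0 < t1 < len e -> 0 < t2 < len e ->
  (forall s, 0 < s < len e ->
     ord f (seg e s) = (b2 && (s == t2))%:R - (b1 && (s == t1))%:R) ->
  exists k : int, [/\ incoming_slope f (e, true) 0 = k,
    incoming_slope f (e, false) 0 = b1%:R - b2%:R - k &
    f (inl (root (e, true))) - f (inl (root (e, false))) =
      k%:~R * len e - b1%:R * t1 + b2%:R * t2].
Proof.
move=> fpl H1 H2 fo; have l0 := len_gt0 e.
pose psi s := f (seg e s) + (b1%:R * Num.min s t1 - b2%:R * Num.min s t2).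
have psiPL : PL psi 0 (len e).
  have sc (b : bool) c : PL (fun s => b%:R * Num.min s c) 0 (len e).
    case: b; first by apply: (PL_ext (PL_min c (ltW l0))) => s _; rewrite mul1r.
    by apply: (@PL_affine _ _ _ _ 0 0) => [|s _]; rewrite ?ltW // !mul0r addr0.
  apply: PL_add; first by apply/pl_integralP.
  by apply: (PL_add (sc _ _)); apply: PL_opp.
have [|k [c psiE]] := PL_smooth psiPL.
  move=> s Hs; pose mR := incoming_slope f (e, false) s.
  pose mL := incoming_slope f (e, true) (len e - s).
  have mLR : mR%:~R + mL%:~R = (b2 && (s == t2))%:R - (b1 && (s == t1))%:R :> R.
    have := fo s Hs; rewrite -[seg e s]/(hseg (e, false) s) ord_hseg //.
    by move/(congr1 (fun z : int => z%:~R : R)); rewrite rmorphB rmorphD /= !mulrz_nat.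
  have [|dR dR0 ER] := @incoming_germ _ _ X f (e, false) s fpl; first by rewrite /=; lra.
  have [|dL dL0 EL] := @incoming_germ _ _ X f (e, true) (len e - s) fpl; first by rewrite /=; lra.
  pose d x := if s < x then x - s else if x < s then s - x else 1.
  have d0 x : 0 < d x by rewrite /d; do 2?case: ifP => // ?; lra.
  pose r := Num.min (Num.min dR dL) (Num.min (d t1) (d t2)).
  exists (- mR%:~R + b1%:R * (s < t1)%R%:R - b2%:R * (s < t2)%R%:R), r.
  split=> [|u]; first by rewrite !lt_min !d0 dR0 dL0.
  rewrite !le_min => /andP[/andP[uR uL] /andP[u1 u2]].
  have mEp x : 0 <= u -> u <= d x -> Num.min (s + u) x = Num.min s x + (s < x)%R%:R * u.
    rewrite /d; case: ltP => Hx /= u0 Hu; first by rewrite !min_l; lra.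
    by rewrite !min_r; lra.
  have mEn x : u < 0 -> - u <= d x -> Num.min (s + u) x = Num.min s x + (s <= x)%R%:R * u.
    rewrite /d => u0; case: ltgtP => Hx /= Hu.
    - by rewrite !min_l; lra.
    - by rewrite !min_r; lra.
    - by rewrite !min_l; lra.
  have := ER u; have := EL (- u); rewrite /psi /hseg /= subKr.
  have -> : len e - (len e - s - u) = s + u by lra.
  move: uR uL u1 u2; case: (ger0P u) => u0 uR uL u1 u2 EL' ER'.
    rewrite !mEp // ER' ?uR ?u0 // -/mR; lra.
  rewrite !mEn // EL'; last lra.
  rewrite -/mL !le_eqVlt.
  move/(congr1 (fun z => z * u)): mLR => /=; rewrite mulrDl.
  by case: (b1); case: (b2); case: (ltgtP s t1) => _; case: (ltgtP s t2) => _ /=; lra.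
have fE s : 0 <= s <= len e ->
    f (seg e s) = k%:~R * s + c - b1%:R * Num.min s t1 + b2%:R * Num.min s t2.
  by move=> Hs; have := psiE s Hs; rewrite /psi; lra.
exists k; split.
- apply: (@incoming_slopeE _ _ _ _ _ _ _ (Num.min (len e - t1) (len e - t2))).
    by rewrite lt_min; lra.
  move=> u; rewrite le_min => /andP[u0 /andP[u1 u2]].
  rewrite /hseg /= add0r subr0 !fE; try lra.
  by rewrite !min_r; lra.
- apply: (@incoming_slopeE _ _ _ _ _ _ _ (Num.min t1 t2)); first by rewrite lt_min; lra.
  move=> u; rewrite le_min => /andP[u0 /andP[u1 u2]].
  rewrite /hseg /= add0r !fE; try lra.
  rewrite !rmorphB /= !mulrz_nat !min_l; lra.
- rewrite -seg0 -seg_len !fE; try lra.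
  rewrite (min_r (x := len e)) ?(min_r (x := len e)); try lra.
  by rewrite !min_l; lra.
Qed.

End DivisorEquivalence.

Section PairEquivalence.
Variables (R : realType) (g : nat) (d : int) (mu : universal_polarization R g d).

Lemma pair_equiv_equivalence : Equivalence (@pair_equiv R g d mu).
Proof.
split=> [P|P Q|P Q S]; [exact: dequiv_refl|exact: dequiv_sym|exact: dequiv_trans].
Qed.

End PairEquivalence.

(** * Specializations and genus *)

Section Graphs.
Implicit Types G : graph.

Lemma adj_flip G (S : {set edge G}) h : h.1 \in S -> adj S (root h) (root (flip h)).
Proof. by move=> hS; apply/existsP; exists h; rewrite hS !eqxx. Qed.

Lemma adjP G (S : {set edge G}) x y : adj S x y ->
  exists h : half G, [/\ h.1 \in S, root h = x & root (flip h) = y].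
Proof. by case/existsP=> h /and3P[? /eqP ? /eqP ?]; exists h. Qed.

Lemma adj_sym G (S : {set edge G}) : symmetric (adj S).
Proof.
move=> x y; apply/idP/idP => /adjP[h [hS <- <-]].
  by rewrite -{2}[h]flipK; apply: adj_flip.
by rewrite -{2}[h]flipK; apply: adj_flip.
Qed.

Lemma adj_connect_sym G (S : {set edge G}) : connect_sym (adj S).
Proof. by apply/sym_connect_sym/adj_sym. Qed.

Lemma adj_closed G (S : {set edge G}) (U : {set vert G}) :
  (forall h : half G, h.1 \in S -> root h \in U -> root (flip h) \in U) -> closed (adj S) U.
Proof.
move=> H; apply: intro_closed; first exact: adj_connect_sym.
by move=> x y /adjP[h [hS <- <-]]; apply: H.
Qed.

Lemma adj_connect_restrict G (A S : {set edge G}) (U : {set vert G}) x y :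
  (forall h : half G, h.1 \in A -> root h \in U -> root (flip h) \in U /\ h.1 \in S) ->
  x \in U -> connect (adj A) x y -> connect (adj S) x y.
Proof.
move=> H xU /connectP[p + ->] {y}; elim: p x xU => [|z p IH] x xU //= /andP[/adjP[h [hA Ex Ez]] Hp].
rewrite -Ex in xU *; have [zU hS] := H h hA xU; rewrite -Ez in Hp *.
by apply: connect_trans (connect1 (adj_flip hS)) (IH _ zU Hp).
Qed.

Definition spans G (S : {set edge G}) (U : {set vert G}) :=
  [/\ exists x, x \in U, forall h : half G, h.1 \in S -> root h \in U
    & forall x y, x \in U -> y \in U -> connect (adj S) x y].

Lemma spans_n_comp G (S : {set edge G}) U : spans S U -> n_comp (adj S) U = 1%N.
Proof.
move=> [[x xU] HS HU]; rewrite -(n_comp_connect (@adj_connect_sym _ S) x).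
apply: eq_n_comp_r => y; apply/idP/idP => [yU|]; first exact: HU.
move/(closed_connect (a := U)) => <- //.
by apply: adj_closed => h hS _; apply: HS.
Qed.

(* Grow a connected vertex set one vertex at a time: each new vertex brings a
   new edge. *)
Lemma spans_leq_card G (S : {set edge G}) U : spans S U -> (#|U| <= #|S|.+1)%N.
Proof.
move=> [[x xU] HS HU].
pose ins (W : {set vert G}) := [set e in S | (root (e, false) \in W) && (root (e, true) \in W)].
suff [W [_ [<- /leq_trans]]] : exists W : {set vert G}, [/\ x \in W & W \subset U] /\
    (#|W| = #|U| /\ #|W| <= #|ins W|.+1)%N.
  apply; rewrite ltnS; apply: subset_leq_card.
  by apply/subsetP => e; rewrite inE => /andP[].
have U0 : (0 < #|U|)%N by apply/card_gt0P; exists x.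
suff grow n : (n < #|U|)%N -> exists W : {set vert G}, [/\ x \in W & W \subset U] /\
    (#|W| = n.+1 /\ #|W| <= #|ins W|.+1)%N.
  by have := grow #|U|.-1; rewrite prednK // => /(_ (leqnn _)).
elim: n => [_|n IH ltn].
  by exists [set x]; rewrite sub1set set11 cards1.
have [W [[xW WU] [cW leW]]] := IH (ltnW ltn).
have [h hS [hW fhW]] : exists2 h : half G, h.1 \in S & root h \in W /\ root (flip h) \notin W.
  apply: contrapT => N.
  have cl : closed (adj S) W.
    apply: adj_closed => h hS hW; apply/negPn/negP => fhW.
    by apply: N; exists h.
  suff : (#|U| <= #|W|)%N by rewrite cW leqNgt ltn.
  apply: subset_leq_card; apply/subsetP => y yU.
  by rewrite -(closed_connect cl (HU _ _ xU yU)).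
exists (root (flip h) |: W); split; first split.
- by rewrite inE xW orbT.
- by rewrite subUset WU andbT sub1set HS.
rewrite cardsU1 fhW cW; split=> //; rewrite ltnS.
have /subset_leq_card : h.1 |: ins W \subset ins (root (flip h) |: W).
  apply/subsetP => e; rewrite !inE => /orP[/eqP->|/andP[-> /andP[-> ->]]]; last by rewrite !orbT.
  rewrite hS; case: h hW {hS fhW} => e' [] /= hW; rewrite /flip /= !eqxx hW ?orbT //.
apply: leq_trans; rewrite cardsU1 inE hS /=.
have -> : (root (h.1, false) \in W) && (root (h.1, true) \in W) = false.
  by apply: negbTE; case: h fhW {hW hS} => e' [] /=; rewrite /flip /= => /negbTE->; rewrite ?andbF.
by rewrite add1n; move: leW; rewrite cW.
Qed.

(** An additive form of the genus formula: the subtraction in [sub_genus] is truncated, and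
    [spans_leq_card] shows that nothing is lost for a connected subgraph. *)
Lemma spans_genus G (w : vert G -> nat) (S : {set edge G}) U : spans S U ->
  (sub_genus w S U + #|U| = #|S| + 1 + \sum_(v in U) w v)%N.
Proof.
move=> H; rewrite /sub_genus spans_n_comp //.
have := spans_leq_card H; lia.
Qed.

Section Spec.
Variables (G G' : graph) (i : specialization G G').

Definition contracted : {set edge G} := [set e | (e, false) \notin codom (sp_half i)].

Lemma sp_half_edge h : (sp_half i h).1 = sp_edge i h.1.
Proof.
case: h => e [] //; rewrite /sp_edge -[(e, false)]/(flip (e, true)).
by rewrite sp_half_flip.
Qed.

Lemma sp_half_fst h : sp_half i h = (sp_edge i h.1, (sp_half i h).2).
Proof. by rewrite -sp_half_edge -surjective_pairing. Qed.

Lemma sp_edge_inj : injective (sp_edge i).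
Proof.
move=> e e' E; have F := sp_half_fst (e, false); have F' := sp_half_fst (e', false).
rewrite /= E in F.
have [Eb|Nb] := eqVneq (sp_half i (e, false)).2 (sp_half i (e', false)).2.
  by rewrite Eb -F' in F; have [] := sp_half_inj F.
have : sp_half i (e, false) = flip (sp_half i (e', false)).
  rewrite F F' /flip /=; congr pair.
  by move: Nb; do 2!case: (_.2).
by rewrite -sp_half_flip => /sp_half_inj [].
Qed.

Lemma contractedP h : reflect (forall h', sp_half i h' <> h) (h.1 \in contracted).
Proof.
rewrite inE; apply: (iffP idP) => [N h' E|H].
  case/negP: N; rewrite -E sp_half_edge.
  case: (boolP (sp_half i h').2) => b.
    by apply/codomP; exists (flip h'); rewrite sp_half_flip sp_half_fst b.
  by apply/codomP; exists h'; rewrite sp_half_fst (negbTE b).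
apply/negP => /codomP[h' E].
case: h H E => e [] /= H E; last by case: (H h').
by case: (H (flip h')); rewrite sp_half_flip -E.
Qed.

Lemma codom_sp_edge e : (e \in codom (sp_edge i)) = (e \notin contracted).
Proof.
apply/codomP/idP => [[e' ->]|].
  by apply/negP => /(contractedP (sp_half i (e', false))) /(_ (e', false)).
rewrite inE negbK => /codomP[h E]; exists h.1.
by rewrite -sp_half_edge -E.
Qed.

Lemma sp_edge_ncontracted e : sp_edge i e \notin contracted.
Proof. by rewrite -codom_sp_edge codom_f. Qed.

Lemma contracted_half h : h.1 \notin contracted -> exists h', sp_half i h' = h.
Proof.
rewrite -codom_sp_edge => /codomP[e E].
have [Eh|Nh] := eqVneq (sp_half i (e, false)).2 h.2.
  by exists (e, false); rewrite sp_half_fst Eh -E -surjective_pairing.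
exists (flip (e, false)); rewrite sp_half_flip sp_half_fst -E /flip /=.
by move: Nh; case: h {E} => ? [] /=; case: (_.2).
Qed.

Lemma sp_contracted h : h.1 \in contracted -> sp_vert i (root h) = sp_vert i (root (flip h)).
Proof. by move=> hC; apply/sp_fibre/connect1/adj_flip. Qed.

Lemma adj_sp (S : {set edge G}) (S' : {set edge G'}) x y :
  (forall e, sp_edge i e \in S -> e \in S') ->
  connect (adj S) x y -> connect (adj S') (sp_vert i x) (sp_vert i y).
Proof.
move=> H /connectP[p + ->]; elim: p x => [|z p IH] x //= /andP[/adjP[h [hS <- <-]] Hp].
apply: connect_trans (IH _ Hp).
have [C|/contracted_half[h' E]] := boolP (h.1 \in contracted); first by rewrite sp_contracted.
rewrite -E -sp_half_flip !sp_root; apply/connect1/adj_flip/H.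
by rewrite -sp_half_edge E.
Qed.

Lemma adj_lift (S' : {set edge G'}) (S : {set edge G}) x y :
  contracted \subset S -> (forall e, e \in S' -> sp_edge i e \in S) ->
  connect (adj S') (sp_vert i x) (sp_vert i y) -> connect (adj S) x y.
Proof.
move=> CS HS /connectP[p]; move Ea : (sp_vert i x) => a.
have conn u v : sp_vert i u = sp_vert i v -> connect (adj S) u v.
  move/sp_fibre; apply: connect_sub => s t /adjP[h [hC <- <-]].
  by apply/connect1/adj_flip/(subsetP CS).
elim: p x a Ea => [|z p IH] x a Ea /=; first by move=> _ E; apply: conn; rewrite Ea.
case/andP=> /adjP[h [hS Ex Ez]] Hp Hy.
have E2 : sp_vert i (root (flip (sp_half i h))) = z by rewrite -sp_half_flip sp_root.
apply: connect_trans (IH _ _ E2 Hp Hy).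
apply: (@connect_trans _ _ (root (sp_half i h))); first by apply: conn; rewrite Ea sp_root.
by apply/connect1/adj_flip; rewrite sp_half_edge; apply: HS.
Qed.

Lemma fibre_spans v' : spans (fibre_edges i v') (fibre i v').
Proof.
have memE h : (h.1 \in fibre_edges i v') = (h.1 \in contracted) && (root h \in fibre i v').
  rewrite inE codom_sp_edge negbK; case hC : (h.1 \in contracted) => //=.
  by case: h hC => e [] //= hC; rewrite !inE (@sp_contracted (e, false)).
split.
- by have [v E] := sp_surj i v'; exists v; rewrite inE E.
- by move=> h; rewrite memE => /andP[].
move=> x y xU; rewrite inE => /eqP yU.
have /sp_fibre : sp_vert i x = sp_vert i y by move: xU; rewrite inE yU => /eqP.
apply: (adj_connect_restrict (U := fibre i v')) => // h hC hU.
by rewrite memE hC hU /=; move: hU; rewrite !inE -sp_contracted.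
Qed.

Lemma fibre_edgesE h v' :
  (h.1 \in fibre_edges i v') = (h.1 \in contracted) && (sp_vert i (root h) == v').
Proof.
rewrite inE codom_sp_edge negbK; case hC : (h.1 \in contracted) => //=.
by case: h hC => e [] //= hC; rewrite !inE // (@sp_contracted (e, false)).
Qed.

Section Genus.
Variables (w : vert G -> nat) (w' : vert G' -> nat).
Hypothesis ww' : weight_compatible i w w'.
Variables (S' : {set edge G'}) (U' : {set vert G'}).
Hypothesis SU' : spans S' U'.

Let U := [set v | sp_vert i v \in U'].
Let C := [set e in contracted | root (e, false) \in U].
Let S := C :|: (sp_edge i @: S').

Lemma preim_edges_half h : (h.1 \in C) = (h.1 \in contracted) && (root h \in U).
Proof.
rewrite inE; case hC : (h.1 \in contracted) => //=.
by case: h hC => e [] //= hC; rewrite !inE (@sp_contracted (e, false)).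
Qed.

Lemma preim_spans : spans S U.
Proof.
have [[x' x'U] HS HU] := SU'.
have inS h : h.1 \in S -> root h \in U.
  rewrite inE preim_edges_half => /orP[/andP[]//|/imsetP[e eS E]].
  have [h' E'] : exists h', sp_half i h' = h.
    by apply: contracted_half; rewrite E sp_edge_ncontracted.
  rewrite inE -E' sp_root HS //.
  by move: E; rewrite -E' sp_half_edge => /sp_edge_inj ->.
split=> //; first by have [x E] := sp_surj i x'; exists x; rewrite inE E.
move=> x y; rewrite !inE => xU yU.
have := @adj_lift S' (contracted :|: sp_edge i @: S') x y (subsetUl _ _) _ (HU _ _ xU yU).
have H : forall e, e \in S' -> sp_edge i e \in contracted :|: sp_edge i @: S'.
  by move=> e eS; rewrite inE imset_f ?orbT.
move/(_ H); apply: (adj_connect_restrict (U := U)); last by rewrite inE.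
move=> h; rewrite inE => /orP[hC hU|hS _].
  have hS : h.1 \in S by rewrite inE preim_edges_half hC hU.
  by split=> //; apply: inS.
have {}hS : h.1 \in S by rewrite inE hS orbT.
by split=> //; apply: inS.
Qed.

(** The weight of each [v'] is the genus of its fibre. Summing the additive formula over [U'], the
    vertices and weights of the fibres add up to those of [U], and their edges to the contracted
    part [C] of [S]. *)
Lemma sub_genus_spec : sub_genus w' S' U' = sub_genus w S U.
Proof.
have E := spans_genus w preim_spans; have E' := spans_genus w' SU'.
have cS : #|S| = (#|C| + #|S'|)%N.
  rewrite /S cardsU (card_imset _ sp_edge_inj).
  suff -> : C :&: (sp_edge i @: S') = set0 by rewrite cards0 subn0.
  apply/setP => e; rewrite !inE; apply/negP => /andP[/andP[eC _] /imsetP[e' _ Ee]].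
  by case/negP: (sp_edge_ncontracted e'); rewrite -Ee inE.
have sumF (F : vert G -> nat) :
    (\sum_(v' in U') \sum_(v in fibre i v') F v = \sum_(v in U) F v)%N.
  rewrite [RHS](partition_big (sp_vert i) (mem U')) /=; last by move=> v; rewrite inE.
  apply: eq_bigr => v' v'U; apply: eq_bigl => v; rewrite !inE.
  by case: eqP => [->|]; rewrite ?v'U ?andbF.
have cU : (\sum_(v' in U') #|fibre i v'| = #|U|)%N.
  rewrite -sum1_card -sumF; apply: eq_bigr => v' _; exact/esym/sum1_card.
have cC : (\sum_(v' in U') #|fibre_edges i v'| = #|C|)%N.
  rewrite -[RHS]sum1_card.
  rewrite (partition_big (fun e => sp_vert i (root (e, false))) (mem U')) /=; last first.
    by move=> e; rewrite !inE => /andP[].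
  apply: eq_bigr => v' v'U; rewrite -sum1_card; apply: eq_bigl => e.
  rewrite (fibre_edgesE (e, false)) !inE /=.
  by case: eqP => [->|]; rewrite ?v'U ?andbF ?andbT.
have sw : (\sum_(v' in U') (w' v' + #|fibre i v'|) =
    \sum_(v' in U') (#|fibre_edges i v'| + 1 + \sum_(v in fibre i v') w v))%N.
  by apply: eq_bigr => v' _; rewrite ww' spans_genus //; apply: fibre_spans.
move: sw; rewrite !big_split /= sumF cU cC sum1_card.
lia.
Qed.

End Genus.
End Spec.
End Graphs.

(** * Contraction of stable graphs and composition of specializations *)

Section Contraction.
Variables (G : graph) (Z : {set edge G}).

Definition contr_root (v : vert G) : {v : vert G | roots (adj Z) v} :=
  exist _ (fingraph.root (adj Z) v) (roots_root (@adj_connect_sym _ Z) v).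

Definition contraction : graph :=
  @Graph {v : vert G | roots (adj Z) v} {e : edge G | e \notin Z}
         (fun h => contr_root (root (val h.1, h.2))).

Definition contr_half (h : half contraction) : half G := (val h.1, h.2).

Lemma contr_half_codom e : ((e, false) \notin codom contr_half) = (e \in Z).
Proof.
apply/idP/idP => [|eZ]; last first.
  by apply/negP => /codomP[[[e' He'] b]] [E _]; rewrite -E eZ in He'.
apply: contraR => eZ; apply/codomP.
by exists (exist (fun e => e \notin Z) e eZ, false).
Qed.

Definition contraction_spec : specialization G contraction.
Proof.
refine (@Specialization G contraction contr_root contr_half _ _ _ _ _).
- by move=> [e b] [e' b'] [/val_inj -> ->].
- by [].
- by [].
- by move=> [v Hv]; exists v; apply: val_inj => /=; apply/eqP.
- move=> v1 v2; have -> : [set e | (e, false) \notin codom contr_half] = Z.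
    by apply/setP => e; rewrite inE contr_half_codom.
  split=> [[/eqP]|]; first by rewrite root_connect //; apply: adj_connect_sym.
  by rewrite -root_connect; [move/eqP => E; apply: val_inj|apply: adj_connect_sym].
Defined.

Lemma contraction_contracted : contracted contraction_spec = Z.
Proof. by apply/setP => e; rewrite inE contr_half_codom. Qed.

End Contraction.

Section StableContraction.

Lemma connected_spans (G : graph) : connected G -> spans [set: edge G] [set: vert G].
Proof.
by case=> /card_gt0P[x _] H; split=> [|h _|x' y _ _]; [exists x; rewrite inE|rewrite inE|apply: H].
Qed.

Lemma sum_val_in (G : graph) (S : {set edge G}) (U : {set vert G}) :
  (\sum_(u in U) val_in S u = #|[set h : half G | (h.1 \in S) && (root h \in U)]|)%N.
Proof.
rewrite -sum1_card (partition_big (@root G) (mem U)) /=; last first.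
  by move=> h; rewrite inE => /andP[].
apply: eq_bigr => u uU; rewrite /val_in -sum1_card; apply: eq_bigl => h; rewrite !inE.
by case: eqP => [->|]; rewrite ?uU ?andbF // !andbT.
Qed.

Variables (g : nat) (G : stable_graph g) (Z : {set edge G}).

(** Stability survives: over [v'], with [n] vertices in the fibre, the quantities
    [valence u + 2 * weight u] sum to [valence v' + 2 * w' v' + 2 * n - 2]. This sum is at least
    [3 * n], and [n] is at least 1. The genus is [sub_genus_spec] applied to the whole graph. *)
Lemma stable_contraction : exists (G' : stable_graph g) (i : specialization G G'),
  wspecialization i /\ contracted i = Z.
Proof.
have [G' [i iC]] : exists G' (i : specialization G G'), contracted i = Z.
  by exists (contraction Z), (contraction_spec Z); apply: contraction_contracted.
pose w' v' := sub_genus (@weight _ G) (fibre_edges i v') (fibre i v').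
have Gc := sg_connected G.
have Gc' : connected G'.
  split.
    by have [/card_gt0P[x _] _] := Gc; apply/card_gt0P; exists (sp_vert i x).
  move=> x y; have [u <-] := sp_surj i x; have [v <-] := sp_surj i y.
  by apply: (@adj_sp _ _ i [set: edge G] [set: edge G']) => [e _|]; [rewrite inE|apply: (proj2 Gc)].
have Gg : genus w' = g.
  transitivity (genus (@weight _ G)); last exact: sg_genus.
  rewrite /genus (sub_genus_spec (w := @weight _ G) (i := i)) //; last first.
    exact: connected_spans.
  congr sub_genus; last by apply/setP => v; rewrite !inE.
  apply/setP => e; rewrite !inE andbT.
  have [eC|//] := boolP ((e, false) \in codom (sp_half i)).
  have : e \in codom (sp_edge i) by rewrite codom_sp_edge inE eC.
  by case/codomP=> e' ->; rewrite imset_f ?inE.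
have Gs v' : (3 <= valence v' + 2 * w' v')%N.
  have F := fibre_spans i v'; have := spans_genus (@weight _ G) F; rewrite -/(w' v').
  have [[x xF] _ _] := F.
  have F0 : (0 < #|fibre i v'|)%N by apply/card_gt0P; exists x.
  have sv : (\sum_(u in fibre i v') (valence u + 2 * weight u) >= 3 * #|fibre i v'|)%N.
    by rewrite mulnC -sum_nat_const; apply: leq_sum => u _; apply: sg_stable.
  rewrite big_split /= -big_distrr /= in sv.
  suff ve : (\sum_(u in fibre i v') valence u = valence v' + 2 * #|fibre_edges i v'|)%N.
    rewrite ve in sv; lia.
  rewrite sum_val_in.
  rewrite -(cardsID [set h : half G | h.1 \in contracted i]) addnC; congr addn.
    rewrite /valence /val_in -(card_imset _ (@sp_half_inj _ _ i)); apply: eq_card => h.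
    rewrite !inE /=; apply/andP/imsetP => [[hC /eqP Eh]|[h' + ->]].
      have [|h' Eh'] := @contracted_half _ _ i h; first by rewrite inE.
      by exists h' => //; rewrite inE in_setT /= -(sp_root i) Eh' Eh.
    rewrite inE in_setT /= => /eqP <-; rewrite sp_root eqxx; split=> //.
    by apply/negPn; have := sp_edge_ncontracted i h'.1; rewrite inE sp_half_edge negbK.
  transitivity #|setX (fibre_edges i v') [set: bool]|; last by rewrite cardsX cardsT card_bool mulnC.
  apply: eq_card => -[e b]; rewrite in_setX in_setT andbT (fibre_edgesE i (e, b)) !inE /=.
  by rewrite andbC.
by exists (StableGraph Gc' Gg Gs), i.
Qed.

End StableContraction.

Section Composition.
Variables (G G' G'' : graph) (i : specialization G G') (j : specialization G' G'').

Let sh h := sp_half i (sp_half j h).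
Let C := contracted i :|: (sp_edge i @: contracted j).

Lemma comp_contracted : [set e | (e, false) \notin codom sh] = C.
Proof.
apply/setP => e; rewrite inE [in RHS]inE; apply/idP/orP => [N|[eC|/imsetP[e' e'C E]]].
- have [|eC] := boolP (e \in contracted i); [by left|right].
  have [h' E] := @contracted_half _ _ i (e, false) eC.
  apply/imsetP; exists h'.1; last by rewrite -sp_half_edge E.
  apply/contractedP => h'' E''; case/negP: N; apply/codomP; exists h''.
  by rewrite /sh E''.
- apply/negP => /codomP[h E]; have := contractedP i (e, false) eC.
  by move/(_ (sp_half j h)); apply; exact: esym E.
apply/negP => /codomP[h F]; have := contractedP j (e', false) e'C.
have Eh : (sp_half j h).1 = e'.
  by apply: (@sp_edge_inj _ _ i); rewrite -sp_half_edge -[sp_half i _]F E.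
move=> H; case: (boolP (sp_half j h).2) => b; last first.
  by apply: (H h); rewrite -Eh -(negbTE b) -surjective_pairing.
apply: (H (flip h)); rewrite sp_half_flip -Eh /flip.
by rewrite b.
Qed.

Definition spec_comp : specialization G G''.
Proof.
refine (@Specialization G G'' (sp_vert j \o sp_vert i) sh _ _ _ _ _).
- by move=> h h' /sp_half_inj /sp_half_inj.
- by move=> h; rewrite /sh !sp_half_flip.
- by move=> h; rewrite /sh /= !sp_root.
- by move=> v; have [x <-] := sp_surj j v; have [y <-] := sp_surj i x; exists y.
- move=> v1 v2; rewrite comp_contracted; split=> /=.
    move/sp_fibre; apply: adj_lift; first exact: subsetUl.
    by move=> e eC; rewrite inE imset_f ?orbT.
  move=> H; apply/sp_fibre; move: H; apply: adj_sp => e /setUP[eC|].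
    by case/negP: (sp_edge_ncontracted i e).
  by case/imsetP=> e' e'C /sp_edge_inj ->.
Defined.

Lemma spec_comp_weight (w : vert G -> nat) (w' : vert G' -> nat) (w'' : vert G'' -> nat) :
  weight_compatible i w w' -> weight_compatible j w' w'' ->
  weight_compatible spec_comp w w''.
Proof.
move=> H H' v''; rewrite H' (sub_genus_spec H); last exact: fibre_spans.
have FE : [set v | sp_vert i v \in fibre j v''] = fibre spec_comp v''.
  by apply/setP => v; rewrite !inE.
congr sub_genus => //; apply/setP => e.
rewrite FE (fibre_edgesE spec_comp (e, false)).
have -> : contracted spec_comp = C := comp_contracted.
rewrite inE [in RHS]inE.
have [eC|eC] := boolP (e \in contracted i).
  rewrite !inE in eC *; rewrite eC /=.
  apply/orP/idP => [[//|/imsetP[e' _ E]]|->]; last by left.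
  by move: (sp_edge_ncontracted i e'); rewrite -E inE negbK (negbTE eC).
have [h Eh] := @contracted_half _ _ i (e, false) eC.
have Ee : e = sp_edge i h.1 by rewrite -sp_half_edge Eh.
rewrite inE (negbTE eC) /= {1 2}Ee !(mem_imset _ _ (@sp_edge_inj _ _ i)).
by rewrite fibre_edgesE -Eh sp_root.
Qed.

End Composition.

(** * Tropical curves realizing a point of a cone *)

Section IsoSpec.
Variables (R : realType) (g : nat).
Implicit Types X Y : tropical_curve R g.

Lemma ci_h'_codom X Y (c : curve_iso X Y) : [set e | (e, false) \notin codom (ci_h' c)] = set0.
Proof.
apply/setP => e; rewrite !inE; apply/negbTE; rewrite negbK.
by apply/codomP; exists (ci_h c (e, false)); rewrite ci_hK.
Qed.

Definition ci_spec X Y (c : curve_iso X Y) : specialization X Y.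
Proof.
refine (@Specialization X Y (ci_v c) (ci_h' c) (can_inj (ci_h'K c)) _ _ _ _).
- exact: (ci_flip (ci_inv c)).
- by move=> h; rewrite -(ci_root c) ci_h'K.
- by move=> v; exists (ci_v' c v); rewrite ci_v'K.
move=> v1 v2; rewrite ci_h'_codom; split=> [/(can_inj (ci_vK c)) ->|]; first exact: connect0.
case/connectP=> -[_ -> //|z p /= /andP[/adjP[h []]]]; by rewrite inE.
Defined.

Lemma ci_spec_contracted X Y (c : curve_iso X Y) e : e \notin contracted (ci_spec c).
Proof.
rewrite inE; apply/negPn/codomP; exists (ci_h c (e, false)).
by rewrite /= ci_hK.
Qed.

Lemma ci_spec_weight X Y (c : curve_iso X Y) : wspecialization (ci_spec c).
Proof.
move=> v'; have := spans_genus (@weight _ X) (fibre_spans (ci_spec c) v').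
have -> : fibre (ci_spec c) v' = [set ci_v' c v'].
  by apply/setP => v; rewrite !inE (can2_eq (ci_vK c) (ci_v'K c)).
have -> : fibre_edges (ci_spec c) v' = set0.
  apply/setP => e; rewrite (fibre_edgesE (ci_spec c) (e, false)) [RHS]inE.
  by rewrite (negbTE (ci_spec_contracted c e)).
rewrite cards1 cards0 big_set1 -(ci_weight (ci_inv c)) /= => /eqP.
by rewrite add0n (addnC 1) eqn_add2r => /eqP.
Qed.

Definition ci_id X : curve_iso X X.
Proof. by apply: (@CurveIso _ _ X X id id id id). Defined.

End IsoSpec.

Section Realization.
Variables (R : realType) (g : nat) (d : int) (mu : universal_polarization R g d).
Implicit Types (T : psd mu) (Y : tropical_curve R g).

Definition tot T (x : edge_space T) (e : edge T) : R :=
  \sum_(e' | over e' == e) (x e' : R).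

Lemma tot_inl T (x : edge_space T) (e : {e | e \notin pd_edges (psd_pd T)}) :
  tot x (val e) = x (inl e).
Proof.
rewrite /tot (big_pred1 (inl e)) // => -[e'|[e' c]] /=.
  by rewrite val_eqE.
by apply/negbTE/eqP => E; case: e e' E => e He [e' He'] /= E; rewrite E in He'; rewrite He' in He.
Qed.

Lemma tot_inr T (x : edge_space T) (e : {e | e \in pd_edges (psd_pd T)}) :
  tot x (val e) = (x (inr (e, false)) : R) + x (inr (e, true)).
Proof.
rewrite /tot (bigD1 (inr (e, false))) //= (big_pred1 (inr (e, true))) //.
case=> [e'|[e' c]] /=.
  by apply/negbTE/nandP; left; case: e e' => e He [e' He'] /=; apply: contraNneq He' => ->.
rewrite val_eqE (inj_eq inr_inj) (inj_eq inr_inj) !xpair_eqE.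
by case: eqP => //= _; case: c.
Qed.

Lemma tot_ge0 T (x : edge_space T) e : orthant x -> 0 <= tot x e.
Proof. by move=> H; apply: sumr_ge0 => e' _; apply: H. Qed.

Lemma over_le_tot T (x : edge_space T) e' : orthant x -> (x e' : R) <= tot x (over e').
Proof.
move=> H; rewrite /tot (bigD1 e') //= lerDl; apply: sumr_ge0 => e'' _; exact: H.
Qed.

(** The two pieces of an exceptional edge change by opposite amounts, so adding a gradient slides
    the exceptional points and keeps all edge lengths. The value 0 elsewhere fits functions that are
    constant along the other edges. *)
Definition grad T (phi : vert T -> R) : edge_space T :=
  [ffun e' => match e' with
    | inl _ => 0
    | inr (e, c) => phi (root (val e, c)) - phi (root (val e, ~~ c))
    end].

Lemma cut_vecE T (V : {set vert T}) : cut V \subset pd_edges (psd_pd T) ->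
  cut_vec V = grad (fun v => (v \in V)%:R).
Proof.
move=> cE; apply/ffunP => e'; rewrite !ffunE.
case: e' => [e|[e c]] /=.
  by rewrite ifN //; apply/negP => /(subsetP cE) H; have := valP e; rewrite H.
have incE U : incident (inr (e, c) : edge (psd_subdiv T)) U = (root (val e, c) \in U).
  apply/existsP/idP => [[[] /existsP[v /andP[vU /eqP]]] // [->]//|H].
  by exists false; apply/existsP; exists (root (val e, c)); rewrite H eqxx.
rewrite !incE !inE.
by case: c {incE}; case: (_ \in V); case: (_ \in V); rewrite /= ?subrr ?subr0 ?sub0r.
Qed.

(** [cut_vec V] is the gradient of the indicator of [V]. Conversely, a function constant along the
    non-exceptional edges is a combination of indicators of its level sets, whose cuts consist of
    exceptional edges. *)
Lemma cut_spaceP T (y : edge_space T) : y \in cut_space T <->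
  exists2 phi : vert T -> R,
    forall e, e \notin pd_edges (psd_pd T) -> phi (root (e, false)) = phi (root (e, true))
    & y = grad phi.
Proof.
set A := [pred V : {set vert T} | cut V \subset pd_edges (psd_pd T)].
split=> [yS|[phi phiE ->]].
  pose s := in_tuple [seq cut_vec V | V : {set vert T} in A].
  have -> : y = \sum_i coord s i y *: s`_i by apply: coord_span.
  elim/big_ind: _ => [|_ _ [f fE ->] [f' f'E ->]|i _].
  - exists (fun _ => 0) => //; apply/ffunP => -[e|[e c]]; rewrite !ffunE //=.
    by rewrite subrr.
  - exists (fun v => f v + f' v); first by move=> e He; rewrite fE ?f'E.
    by apply/ffunP => -[e|[e c]]; rewrite !ffunE /= ?addr0 // addrACA opprD.
  have /imageP[V VA ->] : s`_i \in [seq cut_vec V | V : {set vert T} in A] by apply: mem_nth.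
  exists (fun v => coord s i y * (v \in V)%:R) => [e He|].
    have : e \notin cut V by apply: contra He; apply/subsetP.
    by rewrite inE negbK => /eqP ->.
  rewrite cut_vecE //; apply/ffunP => -[e|[e c]]; rewrite !ffunE /= ?mulr0 //.
    by rewrite scaler0.
  by rewrite -mulrBr.
pose lev a := [set v | phi v == a].
have levE a : cut (lev a) \subset pd_edges (psd_pd T).
  apply/subsetP => e; apply: contraLR => He.
  by rewrite inE negbK !inE phiE.
have -> : grad phi = \sum_(a <- undup (codom phi)) (a : R^o) *: cut_vec (lev a).
  apply/ffunP => -[e|[e c]]; rewrite sum_ffunE ffunE /=.
    rewrite big1 // => a _; rewrite ffunE cut_vecE // ffunE /=; exact: mulr0.
  have phiS v : phi v = \sum_(a <- undup (codom phi)) a * (v \in lev a)%:R.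
    rewrite (bigD1_seq (phi v)) ?undup_uniq ?mem_undup ?codom_f //=.
    rewrite inE eqxx mulr1 big1 ?addr0 // => a /negbTE; rewrite inE eq_sym => ->.
    by rewrite mulr0.
  rewrite (phiS (root (_, c))) (phiS (root (_, ~~ c))) -sumrB; apply: eq_bigr => a _.
  by rewrite ffunE cut_vecE // ffunE /= -mulrBr.
apply: memv_suml => a _; apply: memvZ; apply: memv_span; apply/imageP.
by exists (lev a) => //; apply: levE.
Qed.

(** The place on the curve of a vertex of the subdivided graph. An exceptional vertex of a surviving
    edge is placed at the distance given by its coordinate, and falls on an end when one of its two
    coordinates vanishes; on a contracted edge it follows the ends. *)
Definition loc T Y (i : specialization T Y) (x : edge_space T)
    (u : vert (psd_subdiv T)) : point Y :=
  match u with
  | inl v => inl (sp_vert i v)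
  | inr e => if [pick h | sp_half i h == (val e, false)] is Some h
             then hseg h (x (inr (e, false)))
             else inl (sp_vert i (root (val e, false)))
  end.

#[global] Arguments loc : simpl never.

(* [(Y, D)] is obtained from the metric graph with edge lengths [x] and the
   divisor of [T] by contracting the edges of length 0. *)
Record realizes T (x : edge_space T) Y (D : point Y -> int) := Realizes {
  rz_sp : specialization T Y;
  rz_weight : wspecialization rz_sp;
  rz_len : forall e, len e = tot x (sp_edge rz_sp e);
  rz_zero : forall e, e \in contracted rz_sp -> tot x e = 0;
  rz_div : forall p, D p = \sum_(u | loc rz_sp x u == p) pd_div (psd_pd T) u }.

Section Loc.
Variables (T : psd mu) (x : edge_space T) (Y : tropical_curve R g).
Variable i : specialization T Y.
Hypothesis i_len : forall e, len e = tot x (sp_edge i e).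

Lemma loc_hseg (h : half Y) (e : {e | e \in pd_edges (psd_pd T)}) c :
  sp_half i h = (val e, c) -> loc i x (inr e) = hseg h (x (inr (e, c))).
Proof.
move=> E; rewrite /loc; case: pickP => [h' /eqP E'|N]; last first.
  have [E1|E1] := altP (c =P false); first by have := N h; rewrite E E1 eqxx.
  by have := N (flip h); rewrite sp_half_flip E /flip /=; move: E1; case: (c) => //; rewrite eqxx.
case: c E => E; last by rewrite -E in E'; rewrite (sp_half_inj E').
have -> : h' = flip h by apply: (@sp_half_inj _ _ i); rewrite sp_half_flip E.
rewrite hseg_flip; congr hseg.
by rewrite i_len -sp_half_edge E tot_inr; lra.
Qed.

Lemma loc_contracted (e : {e | e \in pd_edges (psd_pd T)}) c :
  val e \in contracted i -> loc i x (inr e) = inl (sp_vert i (root (val e, c))).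
Proof.
move=> eC; rewrite /loc; case: pickP => [h' /eqP E'|_].
  by have := contractedP i (val e, false) eC h'.
by case: c => //; rewrite (@sp_contracted _ _ i (val e, false)).
Qed.

End Loc.

Lemma realization_ex T (x : edge_space T) : orthant x ->
  exists Y (D : point Y -> int), inhabited (realizes x D).
Proof.
move=> x0; have [G' [i [iw iC]]] := stable_contraction [set e : edge T | tot x e == 0].
have l0 e : 0 < tot x (sp_edge i e).
  rewrite lt_neqAle tot_ge0 // andbT eq_sym.
  by have := sp_edge_ncontracted i e; rewrite iC inE.
pose Y := TropicalCurve l0.
exists Y, (fun p => \sum_(u | loc (i : specialization T Y) x u == p) pd_div (psd_pd T) u).
constructor; apply: (@Realizes T x Y _ i iw) => // e.
by rewrite iC inE => /eqP.
Qed.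

Lemma over_coord_le T (x : edge_space T) (e : {e | e \in pd_edges (psd_pd T)}) c :
  orthant x -> 0 <= (x (inr (e, c)) : R) <= tot x (val e).
Proof. by move=> x0; rewrite x0 /=; apply: (over_le_tot (inr (e, c)) x0). Qed.

Lemma loc_range T (x : edge_space T) Y (i : specialization T Y) h
    (e : {e | e \in pd_edges (psd_pd T)}) c :
  orthant x -> (forall e, len e = tot x (sp_edge i e)) -> sp_half i h = (val e, c) ->
  0 <= (x (inr (e, c)) : R) <= len h.1.
Proof. by move=> x0 il E; rewrite il -sp_half_edge E; apply: over_coord_le. Qed.

Lemma realizes_iso T (x : edge_space T) Y Z (D : point Y -> int) (c : curve_iso Y Z) :
  orthant x -> realizes x D -> realizes x (fun p => D (ci_pt (ci_inv c) p)).
Proof.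
move=> x0 [i iw il iz iD].
pose j := spec_comp i (ci_spec c).
have jE h : sp_half j h = sp_half i (ci_h' c h) by [].
have jl e : len e = tot x (sp_edge j e).
  by rewrite /sp_edge jE sp_half_edge -il -[LHS](ci_len (ci_inv c) (e, false)).
apply: (@Realizes _ _ _ _ j) => //.
- exact: spec_comp_weight iw (ci_spec_weight c).
- move=> e eC; apply: iz; apply/(contractedP i (e, false)) => h.
  have := contractedP j (e, false) eC (ci_h c h).
  by rewrite jE ci_hK.
have locE u : loc j x u = ci_pt c (loc i x u).
  case: u => [v|e] //.
  have [eC|eC] := boolP (val e \in contracted i).
    rewrite (loc_contracted x false eC) (@loc_contracted _ _ _ j _ false) //.
    by apply/(contractedP j (val e, false)) => h; rewrite jE; apply: (contractedP i (val e, false) eC).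
  have [h Eh] := @contracted_half _ _ i (val e, false) eC.
  rewrite (loc_hseg il Eh) (@loc_hseg _ _ _ j jl (ci_h c h) e false); last by rewrite jE ci_hK.
  by rewrite ci_pt_hseg //; apply: loc_range Eh.
move=> p; rewrite iD; apply: eq_bigl => u; rewrite locE.
by rewrite (can2_eq (ci_ptK c) (ci_ptK (ci_inv c))).
Qed.

(** In both realizations the contracted edges are exactly those of total length 0, so the two curves
    are contractions of one graph along the same edges. The induced isomorphism matches [loc], and
    the divisors correspond on the nose. *)
Lemma realizes_uniq T (x : edge_space T) Y Z (D : point Y -> int) (D' : point Z -> int) :
  orthant x -> realizes x D -> realizes x D' -> dequiv D D'.
Proof.
move=> x0 [i iw il iz iD] [j jw jl jz jD].
have sub (A B : tropical_curve R g) (a : specialization T A) (b : specialization T B) :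
    (forall e : edge A, len e = tot x (sp_edge a e)) ->
    (forall e, e \in contracted b -> tot x e = 0) -> contracted b \subset contracted a.
  move=> al bz; apply/subsetP => e eC; rewrite -[_ \in _]negbK -codom_sp_edge.
  apply/negP => /codomP[e' E]; have := len_gt0 e'.
  by rewrite al -E bz // ltxx.
have ij : contracted i = contracted j by apply/eqP; rewrite eqEsubset !sub.
have vmap (A B : tropical_curve R g) (a : specialization T A) (b : specialization T B) : exists f : vert A -> vert B,
    contracted a = contracted b -> forall v, f (sp_vert a v) = sp_vert b v.
  have [s Es] := choice (sp_surj a); exists (fun v => sp_vert b (s v)) => E v.
  by apply/sp_fibre; move/sp_fibre: (Es (sp_vert a v)); rewrite -/(contracted b) -E.
have hmap (A B : tropical_curve R g) (a : specialization T A) (b : specialization T B) : contracted a = contracted b ->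
    exists f : half A -> half B, forall h, sp_half b (f h) = sp_half a h.
  move=> E; have ex (h : half A) : exists h' : half B, sp_half b h' = sp_half a h.
    by apply: contracted_half; rewrite -E sp_half_edge sp_edge_ncontracted.
  by have [f Ef] := choice ex; exists f.
have [f /(_ ij) Ef] := vmap _ _ i j; have [f' /(_ (esym ij)) Ef'] := vmap _ _ j i.
have [h Eh] := hmap _ _ _ _ ij; have [h' Eh'] := hmap _ _ _ _ (esym ij).
have fK : cancel f f' by move=> v; have [u <-] := sp_surj i v; rewrite Ef Ef'.
have f'K : cancel f' f by move=> v; have [u <-] := sp_surj j v; rewrite Ef' Ef.
have hK : cancel h h' by move=> a; apply: (@sp_half_inj _ _ i); rewrite Eh' Eh.
have h'K : cancel h' h by move=> a; apply: (@sp_half_inj _ _ j); rewrite Eh Eh'.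
have hf a : h (flip a) = flip (h a).
  by apply: (@sp_half_inj _ _ j); rewrite sp_half_flip !Eh sp_half_flip.
have hr a : root (h a) = f (root a) by rewrite -(sp_root j) Eh -(sp_root i) Ef.
have hl a : len (h a).1 = len a.1 by rewrite jl il -!sp_half_edge Eh.
have fw v : weight (f v) = weight v.
  rewrite jw iw.
  have FE : fibre j (f v) = fibre i v.
    apply/setP => u; rewrite !inE -Ef; apply/eqP/eqP => [/(can_inj fK)//|->//].
  congr sub_genus => //; apply/setP => e.
  rewrite (fibre_edgesE j (e, false)) (fibre_edgesE i (e, false)) ij; congr (_ && _).
  by have /setP/(_ (root (e, false))) := FE; rewrite !inE.
pose c := CurveIso fK f'K hK h'K hf hr hl fw.
exists (ci_pt c), (ci_pt (ci_inv c)); split; first exact: ci_is_iso.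
exists (fun _ => 0); first exact: pl_cst.
move=> p; rewrite ord_cst iD jD; apply/eqP; rewrite subr_eq0; apply/eqP.
apply: eq_bigl => u; rewrite -(can2_eq (ci_ptK c) (ci_ptK (ci_inv c))); congr (_ == _).
case: u => [v|e]; first by rewrite /loc /= Ef.
have [eC|eC] := boolP (val e \in contracted i).
  by rewrite (loc_contracted x false eC) (@loc_contracted _ _ _ j _ false) -?ij //= Ef.
have [k Ek] := @contracted_half _ _ i (val e, false) eC.
rewrite (loc_hseg il Ek) (@loc_hseg _ _ _ j jl (h k) e false) ?Eh //.
by rewrite ci_pt_hseg //; apply: loc_range Ek.
Qed.

Lemma reindex_sp_edge T Y (i : specialization T Y) (F : edge Y -> int)
    (G : {e | e \in pd_edges (psd_pd T)} -> int) :
  (forall e e1, sp_edge i e = val e1 -> F e = G e1) ->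
  \sum_(e | sp_edge i e \in pd_edges (psd_pd T)) F e =
  \sum_(e1 | val e1 \notin contracted i) G e1.
Proof.
move=> FG; transitivity (\sum_(e | sp_edge i e \in pd_edges (psd_pd T))
    \sum_(e1 : {e | e \in pd_edges (psd_pd T)} | val e1 == sp_edge i e) G e1).
  apply: eq_bigr => e eE; rewrite (big_pred1 (exist (fun e => e \in pd_edges (psd_pd T)) _ eE)).
    exact: FG.
  by move=> e1; rewrite /= -val_eqE.
rewrite (exchange_big_dep (fun e1 => val e1 \notin contracted i)) /=; last first.
  by move=> e e1 _ /eqP ->; apply: sp_edge_ncontracted.
apply: eq_bigr => e1; rewrite -codom_sp_edge => /codomP[e E].
rewrite (big_pred1 e) // => e'; rewrite E (inj_eq (@sp_edge_inj _ _ i)) eq_sym.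
by apply: andb_idl => /eqP ->; rewrite -E (valP e1).
Qed.

(** The edge lengths agree, so the curve stays the same. On a contracted edge all pieces are 0 in
    both vectors, hence [phi] takes the same value at its ends and descends to [Y]. The sign in
    [- psi] appears because positions are measured from the root of [(e, false)]. *)
Lemma realizes_cut_space T (x x' : edge_space T) Y (D : point Y -> int) :
  orthant x -> orthant x' -> x' - x \in cut_space T -> realizes x D ->
  exists D' : point Y -> int, inhabited (realizes x' D') /\ linearly_equivalent D D'.
Proof.
move=> x0 x0' /cut_spaceP[phi phiE Ex] [i iw il iz iD].
have {}Ex e' : (x' e' : R) = x e' + grad phi e' by rewrite -Ex !ffunE addrCA subrr addr0.
have totE e : tot x' e = tot x e.
  have [eE|eE] := boolP (e \in pd_edges (psd_pd T)).
    rewrite -[e]/(val (exist (fun e => e \in _) e eE)) !tot_inr !Ex !ffunE /=; lra.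
  by rewrite -[e]/(val (exist (fun e => e \notin _) e eE)) !tot_inl Ex !ffunE addr0.
have il' e : len e = tot x' (sp_edge i e) by rewrite totE.
pose D' p := \sum_(u | loc i x' u == p) pd_div (psd_pd T) u.
exists D'; split; first by constructor; apply: (@Realizes _ _ _ _ i) => // e /iz; rewrite totE.
have phiC h : h.1 \in contracted i -> phi (root h) = phi (root (flip h)).
  suff H e : e \in contracted i -> phi (root (e, false)) = phi (root (e, true)).
    by case: h => e [] /= /H; rewrite /flip.
  move=> eC; have [eE|] := boolP (e \in pd_edges (psd_pd T)); last exact: phiE.
  pose e1 := exist (fun e => e \in pd_edges (psd_pd T)) e eE.
  have := Ex (inr (e1, false)); rewrite ffunE /=.
  have := over_coord_le e1 false x0; have := over_coord_le e1 false x0'.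
  rewrite totE /= iz //; lra.
have [psi psiE] : exists psi : vert Y -> R, forall v, psi (sp_vert i v) = phi v.
  have conn a b : connect (adj (contracted i)) a b -> phi a = phi b.
    case/connectP=> p + ->; elim: p a => [|c p IH] a //= /andP[/adjP[h [hC <- <-]] /IH <-].
    exact: phiC.
  have [s Es] := choice (sp_surj i); exists (fun v => phi (s v)) => v.
  by apply/conn/sp_fibre.
(* The position of the exceptional point on [e]; edges without one get 0 for both vectors, so that
   their terms cancel. *)
pose pos (z : edge_space T) (e : edge Y) : R :=
  if insub (sp_edge i e) is Some e1 then z (inr (e1, (sp_half i (e, false)).2)) else 0.
have posE z e (e1 : {e | e \in pd_edges (psd_pd T)}) c : sp_half i (e, false) = (val e1, c) ->
    pos z e = z (inr (e1, c)).
  move=> E; rewrite /pos -(sp_half_edge i (e, false)) E /=; case: insubP => [e2 _ E2|].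
    by congr (z (inr (_, _))); apply: val_inj.
  by rewrite (valP e1).
have posN z e : sp_edge i e \notin pd_edges (psd_pd T) -> pos z e = 0.
  by move=> N; rewrite /pos insubN.
have posR z : orthant z -> (forall e, len e = tot z (sp_edge i e)) ->
    forall e, 0 <= pos z e <= len e.
  move=> z0 zl e; have [eE|eE] := boolP (sp_edge i e \in pd_edges (psd_pd T)).
    pose e1 := exist (fun e => e \in pd_edges (psd_pd T)) (sp_edge i e) eE.
    have Eh : sp_half i (e, false) = (val e1, (sp_half i (e, false)).2) := sp_half_fst i (e, false).
    by rewrite (posE z e e1 _ Eh); apply: loc_range Eh.
  by rewrite posN // lexx ltW // len_gt0.
have [e|f fpl fE] := @pl_move _ _ Y (fun v => - psi v) (pos x) (pos x') (posR x x0 il) (posR x' x0' il').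
  have Er : psi (root (e, true)) = phi (root (flip (sp_half i (e, false)))).
    by rewrite -(sp_root i (e, true)) psiE -[(e, true)]/(flip (e, false)) sp_half_flip.
  have Er' : psi (root (e, false)) = phi (root (sp_half i (e, false))).
    by rewrite -(sp_root i (e, false)) psiE.
  rewrite Er Er'; have [eE|eE] := boolP (sp_edge i e \in pd_edges (psd_pd T)).
    pose e1 := exist (fun e => e \in pd_edges (psd_pd T)) (sp_edge i e) eE.
    have Eh : sp_half i (e, false) = (val e1, (sp_half i (e, false)).2) := sp_half_fst i (e, false).
    by rewrite !(posE _ e e1 _ Eh) Eh Ex ffunE /flip /=; lra.
  rewrite !posN // sp_half_fst /flip /=; have := phiE _ eE.
  by case: (sp_half i (e, false)).2 => /= ->; lra.
exists f => // p; rewrite fE iD /D' (big_mkcond (fun u => loc i x u == p)).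
rewrite (big_mkcond (fun u => loc i x' u == p)) /= -sumrB big_sumType /= [X in X + _]big1 ?add0r; last first.
  by move=> v _; rewrite subrr.
have posL (z : edge_space T) (e : edge Y) (e1 : {e | e \in pd_edges (psd_pd T)}) : 
    (forall e, len e = tot z (sp_edge i e)) ->
    sp_edge i e = val e1 -> loc i z (inr e1) = seg e (pos z e).
  move=> zl E; have Eh := sp_half_fst i (e, false); rewrite E in Eh.
  by rewrite (loc_hseg zl Eh) (posE _ _ _ _ Eh).
rewrite (bigID (fun e1 => val e1 \in contracted i)) /= [X in X + _]big1 ?add0r; last first.
  by move=> e1 eC; rewrite !(loc_contracted _ false eC) subrr.
rewrite [RHS](bigID (fun e => sp_edge i e \in pd_edges (psd_pd T))) /=.
rewrite [X in _ = _ + X]big1 ?addr0; last by move=> e eE; rewrite !posN // subrr.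
apply/esym/reindex_sp_edge => e e1 E.
rewrite (posL x _ _ il E) (posL x' _ _ il' E) !pd_exc !(eq_sym p).
by do 2?case: eqP.
Qed.

End Realization.

(** * Invariance of realizations under face morphisms *)

Section Reorient.
Variables (G G' : graph) (i : specialization G G') (sh : half G' -> half G).
Hypothesis sh_edge : forall h, (sh h).1 = sp_edge i h.1.
Hypothesis sh_flip : forall h, sh (flip h) = flip (sh h).
Hypothesis sh_root : forall h, sp_vert i (root (sh h)) = root h.

Lemma reorient_or h : sh h = sp_half i h \/ sh h = flip (sp_half i h).
Proof.
rewrite (surjective_pairing (sh h)) sh_edge sp_half_fst /flip /=.
by case: (sh h).2; case: (sp_half i h).2; [left|right|right|left].
Qed.

(** Both lifts of a half-edge must have the correct root, so the new lift can differ from [sp_half]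
    only on loops of [G']. *)
Definition reorient : specialization G G'.
Proof.
refine (@Specialization G G' (sp_vert i) sh _ sh_flip sh_root (sp_surj i) _).
- move=> h h' E; have : h.1 = h'.1 by apply: (@sp_edge_inj _ _ i); rewrite -!sh_edge E.
  case: h h' E => e b [e' b'] E /= Ee; subst e'; congr pair.
  case: (eqVneq b b') => // Nb; have E2 : (e, b') = flip (e, b).
    by rewrite /flip /=; case: (b) (b') Nb => -[].
  move: E; rewrite E2 sh_flip => /(congr1 snd) /=.
  by case: (_.2).
move=> v1 v2; rewrite sp_fibre.
suff -> : [set e | (e, false) \notin codom (sp_half i)] = [set e | (e, false) \notin codom sh] by [].
apply/setP => e; rewrite !inE; congr negb; apply/codomP/codomP => -[h ->].
  by have [<-|E] := reorient_or h; [exists h|exists (flip h); rewrite sh_flip E flipK].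
by have [->|->] := reorient_or h; [exists h|exists (flip h); rewrite sp_half_flip].
Defined.

Lemma reorient_sp_edge e : sp_edge reorient e = sp_edge i e.
Proof. exact: sh_edge. Qed.

Lemma reorient_contracted : contracted reorient = contracted i.
Proof.
apply/setP => e; apply: negb_inj; rewrite -!codom_sp_edge.
by apply/codomP/codomP => -[e' ->]; exists e'; rewrite reorient_sp_edge.
Qed.

Lemma reorient_weight (w : vert G -> nat) (w' : vert G' -> nat) :
  weight_compatible i w w' -> weight_compatible reorient w w'.
Proof.
move=> H v; rewrite H; congr sub_genus; apply/setP => e.
by rewrite (fibre_edgesE i (e, false)) (fibre_edgesE reorient (e, false)) reorient_contracted.
Qed.

End Reorient.

Section Extend.
Variables (R : realType) (g : nat) (d : int) (mu : universal_polarization R g d).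
Variables (T1 T2 : psd mu) (f : psd_hom T1 T2).
Notation E1 := (pd_edges (psd_pd T1)).
Notation E2 := (pd_edges (psd_pd T2)).
Notation i := (ph_sp f).
Notation s := (ph_subdiv f).

Lemma extend_sp_edge (x : edge_space T2) e : (extend f x (sp_edge s e) : R) = x e.
Proof.
rewrite ffunE (big_pred1 e) // => e'; exact: inj_eq (@sp_edge_inj _ _ s) _ _.
Qed.

Lemma extend_contracted (x : edge_space T2) e : e \in contracted s -> (extend f x e : R) = 0.
Proof.
move=> eC; rewrite ffunE big1 // => e' /eqP E.
by case/negP: (sp_edge_ncontracted s e'); rewrite E.
Qed.

Lemma tot_extend (x : edge_space T2) e :
  tot (extend f x) e = \sum_(e' | sp_edge i (over e') == e) (x e' : R).
Proof.
rewrite /tot (partition_big (sp_edge s) (fun e1 => over e1 == e)) /=; last first.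
  by move=> e'; rewrite (ph_overP f).
apply: eq_bigr => e1 /eqP Ee; rewrite ffunE; apply: eq_bigl => e'.
by case: eqP => [E|]; rewrite ?andbF // andbT -(ph_overP f) E Ee eqxx.
Qed.

Lemma tot_extend_sp_edge (x : edge_space T2) e : tot (extend f x) (sp_edge i e) = tot x e.
Proof.
by rewrite tot_extend; apply: eq_bigl => e'; apply: inj_eq (@sp_edge_inj _ _ i) _ _.
Qed.

Lemma tot_extend_contracted (x : edge_space T2) e : e \in contracted i ->
  tot (extend f x) e = 0.
Proof.
move=> eC; rewrite tot_extend big1 // => e' /eqP E.
by case/negP: (sp_edge_ncontracted i (over e')); rewrite E.
Qed.

(* The half of [sp_edge i e] over which [s] places the half [inr (e, c)] of [e]. *)
Definition exc_side (e : {e | e \in E2}) (c : bool) : bool :=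
  if sp_edge s (inr (e, c)) is inr (_, c') then c' else false.

Lemma over_inr (T : psd mu) (e' : edge (psd_subdiv T)) (e : {e | e \in pd_edges (psd_pd T)}) :
  over e' = val e -> exists c, e' = inr (e, c).
Proof.
case: e' => [a|[a c]] /= E; last by exists c; congr (inr (_, _)); apply: val_inj.
by have := valP a; rewrite /= E (valP e).
Qed.

Lemma sp_half_exc e (e1 : {e | e \in E1}) c b : val e1 = sp_edge i (val e) ->
  sp_half s (inr (e, c), b) = (inr (e1, exc_side e c), b).
Proof.
move=> Ee; have [c' Ec] : exists c', sp_edge s (inr (e, c)) = inr (e1, c').
  by apply: over_inr; rewrite ph_overP.
have -> : exc_side e c = c' by rewrite /exc_side Ec.
suff H : sp_half s (inr (e, c), true) = (inr (e1, c'), true).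
  case: b => //; rewrite -[(_, false)]/(flip (inr (e, c) : edge (psd_subdiv T2), true)).
  by rewrite sp_half_flip H.
have := sp_root s (inr (e, c), true); rewrite sp_half_fst /= Ec.
by case: (_.2) => //=; rewrite ph_vertP.
Qed.

Lemma sp_vert_exc e (e1 : {e | e \in E1}) : val e1 = sp_edge i (val e) ->
  sp_vert s (inr e1) = inr e.
Proof.
move=> Ee; have := sp_root s (inr (e, false), true).
by rewrite (sp_half_exc false true Ee).
Qed.

Lemma exc_side_root e c : sp_vert i (root (sp_edge i (val e), exc_side e c)) = root (val e, c).
Proof.
pose e1 : {e | e \in E1} := exist (fun e => e \in E1) _ (ph_sub f (valP e)).
have := sp_root s (inr (e, c), false); rewrite (@sp_half_exc e e1) //=.
by rewrite ph_vertP => -[].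
Qed.

Lemma exc_sideN e c : exc_side e (~~ c) = ~~ exc_side e c.
Proof.
pose e1 : {e | e \in E1} := exist (fun e => e \in E1) _ (ph_sub f (valP e)).
have := @sp_half_exc e e1 c false erefl; have := @sp_half_exc e e1 (~~ c) false erefl.
have [->|] := eqVneq (exc_side e (~~ c)) (exc_side e c).
  by move=> <- /sp_half_inj [] /esym; case: (c).
by case: (exc_side _ _); case: (exc_side _ _).
Qed.

(* A morphism of triples only matches [ph_sp] and [ph_subdiv] on edges, so the
   two may flip a loop differently; [ph_subdiv] decides on the edges of [E2]. *)
Definition reorient_half (h : half T2) : half T1 :=
  if insub h.1 is Some e then (sp_edge i h.1, exc_side e h.2) else sp_half i h.

Lemma reorient_half_exc (e : {e | e \in E2}) c :
  reorient_half (val e, c) = (sp_edge i (val e), exc_side e c).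
Proof. by rewrite /reorient_half /= valK. Qed.

Lemma reorient_half_nexc h : h.1 \notin E2 -> reorient_half h = sp_half i h.
Proof. by move=> H; rewrite /reorient_half insubN. Qed.

Lemma reorient_half_spec : exists i' : specialization T1 T2,
  [/\ sp_vert i' = sp_vert i, contracted i' = contracted i, sp_half i' = reorient_half,
      wspecialization i' & sp_edge i' =1 sp_edge i].
Proof.
have cas (P : half T2 -> Prop) : (forall (e : {e | e \in E2}) c, P (val e, c)) ->
    (forall h : half T2, h.1 \notin E2 -> P h) -> forall h, P h.
  move=> H1 H2 h; have [hE|] := boolP (h.1 \in E2); last exact: H2.
  by have := H1 (exist (fun e => e \in E2) _ hE) h.2; rewrite /= -surjective_pairing.
have s1 h : (reorient_half h).1 = sp_edge i h.1.
  by elim/cas: h => [e c|h H]; rewrite ?reorient_half_exc // reorient_half_nexc // sp_half_edge.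
have s2 h : reorient_half (flip h) = flip (reorient_half h).
  elim/cas: h => [e c|h H].
    by rewrite -[flip _]/(val e, ~~ c) !reorient_half_exc exc_sideN.
  by rewrite !reorient_half_nexc // sp_half_flip.
have s3 h : sp_vert i (root (reorient_half h)) = root h.
  elim/cas: h => [e c|h H]; first by rewrite reorient_half_exc exc_side_root.
  by rewrite reorient_half_nexc // sp_root.
exists (reorient s1 s2 s3); split=> //.
- exact: reorient_contracted.
- exact: reorient_weight (ph_weight f).
- exact: reorient_sp_edge.
Qed.

(** The realization of the larger triple is the composite specialization. All depends on [locE]: a
    vertex of the larger subdivision sits where its image under [ph_subdiv] sits, since the pieces
    contracted in between have length 0. The divisor is then the push-forward. *)
Lemma realizes_extend (x : edge_space T2) (Y : tropical_curve R g) (D : point Y -> int) :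
  orthant x -> realizes x D -> realizes (extend f x) D.
Proof.
move=> x0 [i2 w2 l2 z2 D2].
have /cid[i' [Ev Ec Eh Ew Ee]] := reorient_half_spec.
pose j := spec_comp i' i2.
have jE h : sp_half j h = reorient_half (sp_half i2 h) by rewrite /= Eh.
have jC : contracted j = contracted i :|: (sp_edge i @: contracted i2).
  rewrite -Ec -(eq_imset _ Ee); exact: comp_contracted.
have jedge e : sp_edge j e = sp_edge i (sp_edge i2 e).
  by rewrite -Ee -[sp_edge i2 e]/((sp_half i2 (e, false)).1) -(sp_half_edge i').
have jl e : len e = tot (extend f x) (sp_edge j e) by rewrite jedge tot_extend_sp_edge.
apply: (@Realizes _ _ _ _ _ _ _ _ j) => //.
- exact: spec_comp_weight Ew w2.
- move=> e; rewrite jC => /setUP[|/imsetP[e' e'C ->]]; first exact: tot_extend_contracted.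
  by rewrite tot_extend_sp_edge z2.
suff locE u : loc j (extend f x) u = loc i2 x (sp_vert s u).
  move=> p; rewrite D2 [RHS](partition_big (sp_vert s) (fun u => loc i2 x u == p)) /=; last first.
    by move=> u; rewrite locE.
  apply: eq_bigr => u /eqP Eu; rewrite (ph_push f) /push; apply: eq_bigl => u1.
  by rewrite inE locE; case: eqP => [->|]; rewrite ?andbF // Eu eqxx.
case: u => [v|e1]; first by rewrite ph_vertP /loc /= Ev.
have vertN c : (inr (e1, c) : edge (psd_subdiv T1)) \in contracted s ->
    sp_vert s (inr e1) = inl (sp_vert i (root (val e1, c))).
  move=> C; have := @sp_contracted _ _ s (inr (e1, c), false) C.
  by rewrite /= ph_vertP => <-.
have [eC|eC] := boolP (val e1 \in contracted i).
  have e1C : (inr (e1, false) : edge (psd_subdiv T1)) \in contracted s.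
    rewrite -[_ \in _]negbK -codom_sp_edge; apply/negP => /codomP[e' E].
    have := ph_overP f e'; rewrite -E /= => Eo.
    by case/negP: (sp_edge_ncontracted i (over e')); rewrite -Eo.
  rewrite (vertN _ e1C) (@loc_contracted _ _ _ _ _ _ _ j _ false) ?jC ?in_setU ?eC //.
  by rewrite /loc /= Ev.
have := eC; rewrite -codom_sp_edge => /codomP[e2 E12].
have jC2 : (val e1 \in contracted j) = (e2 \in contracted i2).
  by rewrite jC in_setU (negbTE eC) /= E12 (mem_imset _ _ (@sp_edge_inj _ _ i)).
have [e2E|e2E] := boolP (e2 \in E2).
  pose a2 : {e | e \in E2} := exist (fun e => e \in E2) e2 e2E.
  have Ea : val e1 = sp_edge i (val a2) by [].
  rewrite (sp_vert_exc Ea); have [e2C|e2C] := boolP (e2 \in contracted i2).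
    rewrite (@loc_contracted _ _ _ _ _ _ _ i2 a2 false) //.
    rewrite (@loc_contracted _ _ _ _ _ _ _ j e1 (exc_side a2 false)) ?jC2 //.
    by rewrite -(exc_side_root a2 false) -Ea -Ev.
  have [h Hh] := @contracted_half _ _ i2 (val a2, false) e2C.
  rewrite (@loc_hseg _ _ _ _ _ _ _ _ l2 h a2 false Hh).
  rewrite (@loc_hseg _ _ _ _ _ _ _ _ jl h e1 (exc_side a2 false)); last first.
    by rewrite jE Hh reorient_half_exc E12.
  congr hseg; rewrite -extend_sp_edge; congr (extend f x _).
  by rewrite /sp_edge (@sp_half_exc a2 e1).
(* Here [val e1] is exceptional in [T1] while [e2] is not in [T2]: one of the two pieces of [val e1]
   is contracted and has coordinate 0, which puts the exceptional point at an end. *)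
pose a2 : {e | e \notin E2} := exist (fun e => e \notin E2) e2 e2E.
have [c Hc] : exists c, sp_edge s (inl a2) = inr (e1, c).
  by apply: over_inr; rewrite ph_overP E12.
have cC : (inr (e1, ~~ c) : edge (psd_subdiv T1)) \in contracted s.
  rewrite -[_ \in _]negbK -codom_sp_edge; apply/negP => /codomP[e' E].
  have := ph_overP f e'; rewrite -E /= E12 => /sp_edge_inj Eo.
  have E' : e' = inl a2.
    case: e' Eo {E} => [a|[a b]] /= Eo; first by congr inl; apply: val_inj.
    by move: (e2E); rewrite Eo (valP a).
  by move: E; rewrite E' Hc => -[]; case: (c).
rewrite (vertN _ cC); have [e2C|e2C] := boolP (e2 \in contracted i2).
  by rewrite (@loc_contracted _ _ _ _ _ _ _ j e1 (~~ c)) ?jC2 //= Ev.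
have [h Hh] : exists h, sp_half j h = (val e1, ~~ c) by apply: contracted_half; rewrite jC2.
rewrite (@loc_hseg _ _ _ _ _ _ _ _ jl h e1 (~~ c) Hh) extend_contracted // hseg0.
by rewrite /loc -(sp_root j h) Hh /= Ev.
Qed.

End Extend.

(** * Specializations of subdivided graphs *)

Section SubdivSpec.
Variables (R : realType) (g : nat) (d : int) (mu : universal_polarization R g d).
Variables (T : psd mu) (x : edge_space T) (Y : tropical_curve R g) (D : point Y -> int).
Variable i : specialization T Y.
Hypothesis x0 : orthant x.
Hypothesis i_len : forall e, len e = tot x (sp_edge i e).
Hypothesis i_zero : forall e, e \in contracted i -> tot x e = 0.
Hypothesis i_div : forall p, D p = \sum_(u | loc i x u == p) pd_div (psd_pd T) u.
Notation E := (pd_edges (psd_pd T)).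
Notation F := (exc_edges D).

Lemma loc_interior u e t : 0 < t < len e -> loc i x u = seg e t ->
  exists2 e1 : {e | e \in E}, u = inr e1 & val e1 = sp_edge i e.
Proof.
move=> Ht; case: u => [v E1|e1 E1]; first by case: (seg_interior_neq Ht (esym E1)).
exists e1 => //; have [eC|eC] := boolP (val e1 \in contracted i).
  rewrite (loc_contracted x false eC) in E1.
  by case: (seg_interior_neq Ht (esym E1)).
have [h Eh] := @contracted_half _ _ i (val e1, false) eC.
rewrite (loc_hseg i_len Eh) in E1.
by have [-> _] := seg_inj Ht (esym E1); rewrite -sp_half_edge Eh.
Qed.

Lemma interior_div e t (e1 : {e | e \in E}) : 0 < t < len e -> val e1 = sp_edge i e ->
  loc i x (inr e1) = seg e t -> D (seg e t) = -1.
Proof.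
move=> Ht E1 L; rewrite i_div (big_pred1 (inr e1)) ?pd_exc // => u.
apply/eqP/eqP => [/(loc_interior Ht)[e2 -> E2]|->//].
by congr inr; apply: val_inj; rewrite E1 -E2.
Qed.

Lemma exc_positionP e t : exc_position D e t <->
  0 < t < len e /\ exists2 e1 : {e | e \in E}, val e1 = sp_edge i e & loc i x (inr e1) = seg e t.
Proof.
split=> [[Ht H]|[Ht [e1 E1 L]]]; last first.
  by split=> //; rewrite (interior_div Ht E1 L).
split=> //; move: H; rewrite i_div.
have [/existsP[u /eqP L] _|] := boolP [exists u, loc i x u == seg e t].
  by have [e1 E1 E2] := loc_interior Ht L; exists e1 => //; rewrite -E1.
rewrite negb_exists => /forallP N.
by rewrite big_pred0 ?eqxx // => u; apply/negbTE/N.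
Qed.

Lemma exc_position_value e t : exc_position D e t -> D (seg e t) = -1.
Proof. by case/exc_positionP=> Ht [e1 E1 L]; apply: interior_div L. Qed.

Lemma exc_position_uniq e s t : exc_position D e s -> exc_position D e t -> s = t.
Proof.
case/exc_positionP=> Hs [e1 E1 L] /exc_positionP[Ht [e2 E2 L2]].
have E12 : e1 = e2 by apply: val_inj; rewrite E1 E2.
by rewrite -E12 L in L2; have [] := seg_inj Hs L2.
Qed.

Lemma exc_edgeP e : reflect (exists t, exc_position D e t) (e \in F).
Proof. by rewrite inE; apply: asboolP. Qed.

Lemma real_finitely_supported : finitely_supported D.
Proof.
apply: (@sub_finite_set _ _ [set` [seq loc i x u | u : vert (psd_subdiv T)]]%classic);
  last exact: finite_seq.
move=> p /= H; apply/imageP; apply: contrapT => N; move: H.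
rewrite i_div big_pred0 ?eqxx // => u; apply/negP => /eqP E1; apply: N.
by exists u.
Qed.

(** The last value, for interior points of non-exceptional edges, is junk: by [loc_exc] such points
    are never of the form [loc i x u]. *)
Definition to_subdiv (p : point Y) : vert (subdiv F) :=
  match p with
  | inl v => inl v
  | inr q => if insub (val q).1 is Some e then inr e else inl (root ((val q).1, false))
  end.

Definition sub_vert (u : vert (psd_subdiv T)) : vert (subdiv F) := to_subdiv (loc i x u).

Lemma to_subdiv_exc e t (eF : e \in F) : 0 < t < len e ->
  to_subdiv (seg e t) = inr (exist (fun e => e \in F) e eF).
Proof.
move=> Ht; rewrite (seg_interior Ht) /=; case: insubP => [a _ Ea|]; last by rewrite eF.
by congr inr; apply: val_inj.
Qed.

Lemma loc_exc u e t : 0 < t < len e -> loc i x u = seg e t -> e \in F.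
Proof.
move=> Ht L; have [e1 Eu E1] := loc_interior Ht L; rewrite Eu in L.
by apply/exc_edgeP; exists t; apply/exc_positionP; split=> //; exists e1.
Qed.

Lemma sub_vert_inl u v : sub_vert u = inl v <-> loc i x u = inl v.
Proof.
split=> [|L]; last by rewrite /sub_vert L.
rewrite /sub_vert; move L : (loc i x u) => p; case: (pointP p) L => [w L [<-] //|e t Ht L].
by rewrite (to_subdiv_exc (loc_exc Ht L)).
Qed.

Lemma sub_vert_inr u e : sub_vert u = inr e ->
  exists2 e1 : {e | e \in E}, u = inr e1 & val e1 = sp_edge i (val e).
Proof.
rewrite /sub_vert; move L : (loc i x u) => p; case: (pointP p) L => // a t Ht L.
rewrite (to_subdiv_exc (loc_exc Ht L)) // => -[<-]; exact: loc_interior L.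
Qed.

Lemma sub_vert_exc e (eF : e \in F) (e1 : {e | e \in E}) : val e1 = sp_edge i e ->
  sub_vert (inr e1) = inr (exist (fun e => e \in F) e eF).
Proof.
move=> E1; have /exc_edgeP[t /exc_positionP[Ht [e2 E2 L]]] := eF.
have -> : e1 = e2 by apply: val_inj; rewrite E1 E2.
by rewrite /sub_vert L to_subdiv_exc.
Qed.

Lemma exc_over e : e \in F -> exists e1 : {e | e \in E}, val e1 = sp_edge i e.
Proof. by move/exc_edgeP=> [t /exc_positionP[_ [e1 E1 _]]]; exists e1. Qed.

Lemma loc_zero e' h (e := over e') : (x e' : R) = 0 -> h.1 = e' ->
  loc i x (root h) = loc i x (root (flip h)).
Proof.
move=> xe Eh.
suff H : loc i x (root (e', false)) = loc i x (root (e', true)).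
  by case: h Eh => _ [] /= ->; rewrite /flip /= ?H.
case: e' xe @e Eh => [a|[e1 c]] xe e Eh /=.
  have aC : val a \in contracted i.
    rewrite -[_ \in _]negbK -codom_sp_edge; apply/negP => /codomP[a' Ea].
    by have := len_gt0 a'; rewrite i_len -Ea tot_inl xe ltxx.
  by rewrite /loc (@sp_contracted _ _ i (val a, false)).
have [eC|eC] := boolP (val e1 \in contracted i); first by rewrite (loc_contracted x c eC).
have [h' Eh'] := @contracted_half _ _ i (val e1, c) eC.
by rewrite (loc_hseg i_len Eh') xe hseg0 /loc -(sp_root i h') Eh'.
Qed.

(** These pieces are the ones to contract: two vertices of the subdivision are placed at the same
    vertex of [Y] exactly when they are connected through [Z]. *)
Let Z := [set e' : edge (psd_subdiv T) | (x e' : R) == 0].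

Lemma connect_zero_loc u1 u2 : connect (adj Z) u1 u2 -> loc i x u1 = loc i x u2.
Proof.
case/connectP=> p + ->; elim: p u1 => [|c p IH] u1 //= /andP[/adjP[h [hZ <- <-]] /IH <-].
by apply: (@loc_zero h.1) => //; apply/eqP; move: hZ; rewrite inE.
Qed.

Lemma adj_zero (e' : edge (psd_subdiv T)) b : (x e' : R) = 0 ->
  connect (adj Z) (root (e', b)) (root (e', ~~ b)).
Proof. by move=> H; apply/connect1/(@adj_flip _ Z (e', b)); rewrite inE H. Qed.

Lemma sp_vert_connect v1 v2 : sp_vert i v1 = sp_vert i v2 ->
  connect (adj Z) (inl v1 : vert (psd_subdiv T)) (inl v2).
Proof.
move/sp_fibre/connectP=> [p + ->]; elim: p v1 => [|c p IH] v1 //= /andP[/adjP[h [hC <- <-]] /IH].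
apply: connect_trans => {p IH v1 v2}.
have t0 := i_zero hC; case: h hC t0 => e b /= hC t0.
have [eE|eE] := boolP (e \in E); last first.
  pose a : {e | e \notin E} := exist (fun e => e \notin E) e eE.
  have := @adj_zero (inl a) b; rewrite /= /flip /=; apply.
  by rewrite -tot_inl.
pose a : {e | e \in E} := exist (fun e => e \in E) e eE.
have za c' : (x (inr (a, c')) : R) = 0.
  by apply/eqP; rewrite eq_le x0 andbT; have := over_le_tot (inr (a, c')) x0; rewrite /= t0.
have := @adj_zero (inr (a, b)) false (za b); have := @adj_zero (inr (a, ~~ b)) true (za _).
by rewrite /flip /= => H1 H2; apply: connect_trans H2 H1.
Qed.

Lemma loc_vertex_connect u v' : loc i x u = inl v' ->
  exists2 v, connect (adj Z) u (inl v) & sp_vert i v = v'.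
Proof.
case: u => [v [Ev]|e1]; first by exists v.
have [eC|eC] := boolP (val e1 \in contracted i).
  rewrite (loc_contracted x false eC) => -[Ev]; exists (root (val e1, false)) => //.
  apply: (@adj_zero (inr (e1, false)) true).
  apply/eqP; rewrite eq_le x0 andbT; have := over_le_tot (inr (e1, false)) x0.
  by rewrite /= i_zero.
have [h Eh] := @contracted_half _ _ i (val e1, false) eC.
rewrite (loc_hseg i_len Eh).
have [hr0 hr1] := andP (loc_range x0 i_len Eh).
have tE : (x (inr (e1, false)) : R) + x (inr (e1, true)) = len h.1.
  by rewrite i_len -sp_half_edge Eh tot_inr.
have [|/negP I] := boolP (0 < (x (inr (e1, false)) : R) < len h.1).
  by move=> I L; case: (hseg_interior_neq I L).
have [Z0|Z1] : (x (inr (e1, false)) : R) = 0 \/ (x (inr (e1, false)) : R) = len h.1 by lra.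
  rewrite Z0 hseg0 => -[Ev]; exists (root (val e1, false)).
    exact: (@adj_zero (inr (e1, false)) true).
  by rewrite -Ev -(sp_root i) Eh.
rewrite Z1 hseg_len => -[Ev]; exists (root (val e1, true)).
  by apply: (@adj_zero (inr (e1, true)) true); lra.
by rewrite -Ev -(sp_root i) sp_half_flip Eh.
Qed.

(** [h] is to lie over the half-edge [(e2, false)]. When a non-exceptional edge of [Y] comes from a
    subdivided edge of [T], one piece has length 0 and the other, which is taken, has the full
    length. *)
Definition sub_edge_spec (e2 : edge (subdiv F)) (h : half (psd_subdiv T)) : Prop :=
  match e2 with
  | inl a => [/\ over h.1 = sp_edge i (val a), (x h.1 : R) = len (val a),
       loc i x (root h) = inl (root (val a, false))
       & loc i x (root (flip h)) = inl (root (val a, true))]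
  | inr (a, c) => exists e1 : {e | e \in E}, exists c',
       h = (inr (e1, c'), false) /\ sp_half i (val a, c) = (val e1, c')
  end.

Lemma sub_edge_ex e2 : exists h, sub_edge_spec e2 h.
Proof.
case: e2 => [a|[a c]] /=; last first.
  have [e1 E1] := exc_over (valP a).
  exists (inr (e1, (sp_half i (val a, c)).2), false), e1, (sp_half i (val a, c)).2.
  by split=> //; have := sp_half_fst i (val a, c); rewrite -[sp_edge i _]E1.
move Eh : (sp_half i (val a, false)) => [e c].
have Ee : e = sp_edge i (val a) by rewrite /sp_edge Eh.
have Er : sp_vert i (root (e, c)) = root (val a, false) by rewrite -Eh sp_root.
have Er' : sp_vert i (root (e, ~~ c)) = root (val a, true).
  by rewrite -(sp_root i (val a, true)) -[(val a, true)]/(flip (val a, false)) sp_half_flip Eh.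
have [eE|eE] := boolP (e \in E); last first.
  exists (inl (exist (fun e => e \notin E) e eE), c); split=> //=.
  - by rewrite -tot_inl /= Ee -i_len.
  - by rewrite /loc /= Er.
  - by rewrite /loc /= Er'.
pose e1 : {e | e \in E} := exist (fun e => e \in E) e eE.
have L := @loc_hseg _ _ _ _ _ x _ i i_len (val a, false) e1 c Eh.
have [r0 r1] := andP (@loc_range _ _ _ _ _ x _ i (val a, false) e1 c x0 i_len Eh).
have tE : (x (inr (e1, c)) : R) + x (inr (e1, ~~ c)) = len (val a).
  by rewrite i_len -Ee -[e]/(val e1) tot_inr; case: (c) => //=; rewrite addrC.
have [I|/negP I] := boolP (0 < (x (inr (e1, c)) : R) < len (val a)).
  by have := valP a; rewrite /= (loc_exc I L).
have [Z0|Z1] : (x (inr (e1, c)) : R) = 0 \/ (x (inr (e1, c)) : R) = len (val a).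
  by rewrite /= in r1; lra.
  exists (inr (e1, ~~ c), true); split=> //=.
  - by rewrite -tE Z0 add0r.
  - by rewrite L Z0 hseg0.
  - by rewrite /loc /= Er'.
exists (inr (e1, c), false); split=> //=.
- by rewrite /loc /= Er.
- by rewrite L Z1 (@hseg_len _ _ Y (val a, false)).
Qed.

(** This provides the second component of a morphism of triples. Its last two clauses say that [x]
    is the vector of edge lengths of [D] extended by zero. *)
Lemma subdiv_spec : exists s : specialization (psd_subdiv T) (subdiv F),
  [/\ forall v, sp_vert s (inl v) = inl (sp_vert i v),
      forall e, over (sp_edge s e) = sp_edge i (over e),
      forall v, pd_div (comb_type D) v = push s (pd_div (psd_pd T)) v,
      forall e, (x (sp_edge s e) : R) = edge_length (D := D) e
    & forall e', e' \in contracted s -> (x e' : R) = 0].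
Proof.
have [sh0 sh0P] := choice sub_edge_ex.
have sh0_over e2 : over (sh0 e2).1 = sp_edge i (over e2).
  have := sh0P e2; case: e2 => [a []//|[a c] [e1 [c' [-> E1]]]] /=.
  by rewrite -[sp_edge i _]/(sp_edge i (sval a, c).1) -(sp_half_edge i) E1.
have sh0_len e2 : (x (sh0 e2).1 : R) = edge_length (D := D) e2.
  have := sh0P e2; case: e2 => [a []//|[a c] [e1 [c' [-> E1]]]] /=.
  have [t Ht] : exists t, exc_position D (val a) t by apply/exc_edgeP; apply: valP.
  have -> : xget 0 (exc_position D (val a)) = t.
    exact: exc_position_uniq (xgetPex 0 (ex_intro _ t Ht)) Ht.
  have /exc_positionP[It [e2 E2 L]] := Ht.
  have e12 : e2 = e1.
    by apply: val_inj; rewrite E2 -[sp_edge i _]/(sp_edge i (val a, c).1) -(sp_half_edge i) E1.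
  rewrite e12 (loc_hseg i_len E1) in L.
  have := esym L; rewrite /hseg /= => /(seg_inj It)[_].
  by case: (c) => ->; rewrite ?subKr.
have edge_length_gt0 e2 : 0 < edge_length (D := D) e2.
  case: e2 => [a|[a c]] /=; first exact: len_gt0.
  have [t Ht] : exists t, exc_position D (val a) t by apply/exc_edgeP; apply: valP.
  have [] := xgetPex 0 (ex_intro _ t Ht); rewrite /in_interior => I _.
  by case: c; lra.
have sh0_root e2 : sub_vert (root (sh0 e2)) = root (e2, false) /\
    sub_vert (root (flip (sh0 e2))) = root (e2, true).
  have := sh0P e2; case: e2 => [a [_ _ L1 L2]|[a c] [e1 [c' [-> E1]]]] /=.
    by rewrite /sub_vert L1 L2.
  split; first by rewrite /sub_vert /loc /= -(sp_root i) E1.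
  case: a E1 => a aF /= E1; apply: sub_vert_exc.
  by rewrite -[sp_edge i _]/(sp_edge i (a, c).1) -(sp_half_edge i) E1.
have sh0_inj e2 e3 : (sh0 e2).1 = (sh0 e3).1 -> e2 = e3.
  move=> E23; have := sh0_over e2; rewrite E23 sh0_over => /sp_edge_inj.
  have := sh0P e2; have := sh0P e3; move: E23.
  case: e2 e3 => [a|[a c]] [b|[b c']] /= E23 H3 H2 Eab.
  - by congr inl; apply: val_inj.
  - by have := valP a; rewrite /= -Eab (valP b).
  - by have := valP b; rewrite /= Eab (valP a).
  move: Eab => /val_inj Eab; subst b.
  move: H3 H2 E23 => [e1 [k [-> E1]]] [e1' [k' [-> E1']]] /= [Ee Ek].
  by rewrite Ee Ek -E1 in E1'; have [->] := sp_half_inj E1'.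
have sh0_surj e' : 0 < (x e' : R) -> exists e2, e' = (sh0 e2).1.
  move=> xe; have eC : over e' \notin contracted i.
    apply/negP => eC; have := over_le_tot e' x0; rewrite i_zero //; lra.
  have := eC; rewrite -codom_sp_edge => /codomP[a Ea].
  have [aF|aF] := boolP (a \in F).
    have [e1 E1] := exc_over aF; rewrite -Ea in E1.
    have [c' Ec] := over_inr (esym E1).
    have [[a' c] Eh] := @contracted_half _ _ i (val e1, c') ltac:(by rewrite E1).
    have Ea' : a' = a.
      by apply: (@sp_edge_inj _ _ i); rewrite -Ea -E1 -[sp_edge i _]/(sp_edge i (a', c).1) -(sp_half_edge i) Eh.
    rewrite {}Ea' in Eh.
    exists (inr (exist (fun e => e \in F) a aF, c)).
    have [e2 [c2 [-> /=]]] := sh0P (inr (exist (fun e => e \in F) a aF, c)).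
    by rewrite Eh Ec => -[/val_inj -> ->].
  exists (inl (exist (fun e => e \notin F) a aF)).
  have [+ xl L1 L2] := sh0P (inl (exist (fun e => e \notin F) a aF)).
  move: xl L1 L2; move: (sh0 _) => h xl L1 L2 /=; rewrite -Ea => Eo.
  have [eE|eE] := boolP (over e' \in E); last first.
    case: e' h.1 xe Eo eE {Ea eC xl} => [b|[b c]] [b'|[b' c']] //= _ Eo.
    - by move=> _; congr inl; apply: val_inj.
    - by rewrite -Eo (valP b').
    - by rewrite (valP b).
    - by rewrite (valP b).
  pose e1 : {e | e \in E} := exist (fun e => e \in E) _ eE.
  have [c Ec] := @over_inr _ _ _ _ T e' e1 erefl.
  have [c' Ec'] := @over_inr _ _ _ _ T h.1 e1 Eo.
  (* Were [e'] the other piece, the edge would have length [len a + x e'], which is too long. *)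
  rewrite Ec Ec'; congr (inr (_, _)); apply: contrapT => N.
  have Nc : c = ~~ c' by move: N; case: (c) (c') => -[].
  have := tot_inr x e1; rewrite [val e1]Ea -i_len.
  have : (x (inr (e1, false)) : R) + x (inr (e1, true)) = x h.1 + (x e' : R).
    by rewrite Ec Ec' Nc; case: (c') => //=; rewrite addrC.
  by rewrite xl /= => -> ; lra.
pose sh (h : half (subdiv F)) := if h.2 then flip (sh0 h.1) else sh0 h.1.
have sh_edge h : (sh h).1 = (sh0 h.1).1 by rewrite /sh; case: h.2.
have sh_flip h : sh (flip h) = flip (sh h) by rewrite /sh; case: h => e []; rewrite //= flipK.
have sh_inj : injective sh.
  move=> h h' Eh; have /sh0_inj : (sh0 h.1).1 = (sh0 h'.1).1 by rewrite -!sh_edge Eh.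
  case: h h' Eh => e b [e' b'] /= + Ee; rewrite -{}Ee /sh /=.
  case: b b' => [] [] // /(congr1 snd) /=; by case: (_.2).
have sh_root h : sub_vert (root (sh h)) = root h.
  by case: h => e [] /=; have [H1 H2] := sh0_root e.
have shZ : [set e | (e, false) \notin codom sh] = Z.
  apply/setP => e; rewrite !inE; apply/idP/idP => [|/eqP xe].
    apply: contraR => xe; have [|e2 E2] := sh0_surj e; first by rewrite lt_neqAle eq_sym xe x0.
    apply/codomP; have [b2|b2] := boolP (sh0 e2).2.
      exists (e2, true); rewrite /sh /= /flip b2 -E2 //.
    by exists (e2, false); rewrite /sh /= E2 -(negbTE b2) -surjective_pairing.
  apply/negP => /codomP[h Eh]; have := edge_length_gt0 h.1.
  by rewrite -sh0_len -sh_edge -Eh xe ltxx.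
have sv_surj v' : exists u, sub_vert u = v'.
  case: v' => [v|[a aF]]; first by have [u <-] := sp_surj i v; exists (inl u).
  by have [e1 E1] := exc_over aF; exists (inr e1); apply: sub_vert_exc.
have sv_fibre u1 u2 : sub_vert u1 = sub_vert u2 <->
    connect (adj [set e | (e, false) \notin codom sh]) u1 u2.
  rewrite shZ; split=> [|/connect_zero_loc]; last by rewrite /sub_vert => ->.
  case E2 : (sub_vert u2) => [v|a] E1.
    have [v1 C1 V1] := loc_vertex_connect (proj1 (sub_vert_inl _ _) E1).
    have [v2 C2 V2] := loc_vertex_connect (proj1 (sub_vert_inl _ _) E2).
    apply: connect_trans C1 _; rewrite adj_connect_sym; apply: connect_trans C2 _.
    by apply: sp_vert_connect; rewrite V1 V2.
  have [e1 -> H1] := sub_vert_inr E1; have [e2 -> H2] := sub_vert_inr E2.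
  by have -> : e1 = e2 by apply: val_inj; rewrite H1 H2.
pose s := @Specialization (psd_subdiv T) (subdiv F) sub_vert sh sh_inj sh_flip sh_root sv_surj sv_fibre.
exists s; split=> //.
- case=> [v|[a aF]].
    rewrite /= i_div /push; apply: eq_bigl => u; rewrite inE.
    by apply/eqP/eqP; rewrite -sub_vert_inl.
  have [e1 E1] := exc_over aF.
  rewrite /push (big_pred1 (inr e1)) ?pd_exc // => u; rewrite inE.
  apply/eqP/eqP => [/sub_vert_inr[e2 -> E2]|->]; last exact: sub_vert_exc.
  by congr inr; apply: val_inj; rewrite E1 E2.
- by move=> e'; rewrite /contracted /= shZ inE => /eqP.
Qed.

End SubdivSpec.

(** * Polystability of the realizations *)

Section Beta.
Variables (R : realType) (G : graph) (mu : vert G -> R) (P : pseudo_divisor G).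
Notation S := (pd_edges P).

(* Twice the contribution of [e] to [beta mu P V]. *)
Definition edge_weight (V : {set vert G}) (e : edge G) : R :=
  ((e \notin S) && (e \in cut V))%:R -
  (e \in S)%:R * ((root (e, false) \in V)%:R + (root (e, true) \in V)%:R).

Lemma sum_half_edge (A : nmodType) (F : half G -> A) :
  \sum_h F h = \sum_(e : edge G) (F (e, false) + F (e, true)).
Proof.
rewrite (eq_bigr (fun h => F (h.1, h.2))); last by case.
rewrite -(pair_bigA _ (fun e b => F (e, b))) /=.
by apply: eq_bigr => e _; rewrite big_bool addrC.
Qed.

Lemma betaE V : beta mu P V = \sum_(v in V) (pd_div P (inl v))%:~R - \sum_(v in V) mu v
  + 2^-1 * \sum_e edge_weight V e.
Proof.
rewrite /beta big_split /= -mulr_sumr -natr_sum sum_val_in /edge_weight sumrB.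
have -> : #|[set h : half G | (h.1 \in S) && (root h \in V)]|%:R =
    \sum_e (e \in S)%:R * ((root (e, false) \in V)%:R + (root (e, true) \in V)%:R) :> R.
  rewrite -sum1_card natr_sum big_mkcond /= sum_half_edge; apply: eq_bigr => e _.
  by rewrite !inE /= mulrDr; case: (e \in S); case: (_ \in V); case: (_ \in V); rewrite /= ?(mul0r, mul1r, mulr1, mulr0).
have -> : (delta (G := del_edges S) V)%:R = \sum_e ((e \notin S) && (e \in cut V))%:R :> R.
  rewrite /delta -(card_imset _ val_inj) -sum1_card natr_sum big_mkcond /=.
  apply: eq_bigr => e _.
  suff -> : (e \in [set \val a | a in cut (G := del_edges S) V]) = (e \notin S) && (e \in cut V).
    by case: ifP.
  apply/imsetP/andP => [[[a aS] + ->]|[eS ec]]; first by rewrite !inE.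
  by exists (exist (fun e => e \notin S) e eS); rewrite // !inE in ec *.
lra.
Qed.

End Beta.

Section Homs.
Variables (R : realType) (g : nat) (d : int) (mu : universal_polarization R g d).

Lemma realizes_hom (T : psd mu) (x : edge_space T) (P : trop_pair mu) :
  orthant x -> realizes x (@tp_div _ _ _ _ P) ->
  exists f : psd_hom T (pair_psd P), extend f (pair_vec P) = x.
Proof.
move=> x0 [i iw il iz iD]; have [s [sV sO sD sL sC]] := subdiv_spec x0 il iz iD.
have sub e : e \in pd_edges (psd_pd (pair_psd P)) -> sp_edge i e \in pd_edges (psd_pd T).
  by move=> eF; have [e1 <-] := exc_over il iD eF; apply: valP.
exists (@PsdHom _ _ _ _ T (pair_psd P) i iw sub s sV sO sD).
apply/ffunP => e'; rewrite ffunE /=.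
have [eC|eC] := boolP (e' \in contracted s).
  rewrite sC // big1 // => e2 /eqP E2.
  by case/negP: (sp_edge_ncontracted s e2); rewrite E2.
have := eC; rewrite -codom_sp_edge => /codomP[e2 ->].
rewrite (big_pred1 e2) => [|e3]; last exact: inj_eq (@sp_edge_inj _ _ s) _ _.
by rewrite ffunE sL.
Qed.

Lemma push_degree (G G' : graph) (i : specialization G G') (f : vert G -> int) :
  \sum_v' push i f v' = \sum_v f v.
Proof.
rewrite [RHS](partition_big (sp_vert i) xpredT) //=.
by apply: eq_bigr => v' _; apply: eq_bigl => v; rewrite inE.
Qed.

Definition zeros (T : psd mu) (x : edge_space T) : nat := #|[set e | (x e : R) == 0]|.

Lemma cut_equivalence (T : psd mu) :
  Equivalence (fun x y : edge_space T => y - x \in cut_space T).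
Proof.
split=> [x|x y H|x y z H H']; first by rewrite subrr mem0v.
  by rewrite -opprB memvN.
by rewrite -[z](subrK y) -addrA; apply: memvD.
Qed.

Section Contract.
Variables (T : psd mu) (x : edge_space T) (Y : tropical_curve R g) (D : point Y -> int).
Variable i : specialization T Y.
Hypothesis iw : wspecialization i.
Hypothesis x0 : orthant x.
Hypothesis i_len : forall e, len e = tot x (sp_edge i e).
Hypothesis i_zero : forall e, e \in contracted i -> tot x e = 0.
Hypothesis i_div : forall p, D p = \sum_(u | loc i x u == p) pd_div (psd_pd T) u.
Variable V' : {set vert Y}.
Notation E := (pd_edges (psd_pd T)).
Notation F := (exc_edges D).
Let V := [set v | sp_vert i v \in V'].

Let in_V' (p : point Y) : bool := if p is inl v then v \in V' else false.

Let exc_in (e : edge T) : bool :=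
  if insub e is Some e1 then in_V' (loc i x (inr e1)) else false.

(* The exceptional vertices over cut edges that have been pushed to the end
   outside [V']. *)
Definition pushed_out (e : edge Y) : bool :=
  [&& sp_edge i e \in E, e \notin F, e \in cut V' & ~~ exc_in (sp_edge i e)].

Lemma V_half h : (root (sp_half i h) \in V) = (root h \in V').
Proof. by rewrite inE sp_root. Qed.

Lemma nexc_loc e (e1 : {e | e \in E}) : e \notin F -> val e1 = sp_edge i e ->
  exists b, loc i x (inr e1) = inl (root (e, b)).
Proof.
move=> eF E1; have Eh : sp_half i (e, false) = (val e1, (sp_half i (e, false)).2).
  by rewrite E1; apply: sp_half_fst.
have L := loc_hseg i_len Eh; have [r0 r1] := andP (loc_range x0 i_len Eh).
move: L r0 r1; set t := (x _ : R) => L r0 r1.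
have [I|/negP I] := boolP (0 < t < len e).
  by have := loc_exc i_len i_div (t := t) I L; rewrite (negbTE eF).
have [Z0|Z1] : t = 0 \/ t = len e by rewrite /= in r1; lra.
  by exists false; rewrite L Z0 hseg0.
by exists true; rewrite L Z1 (@hseg_len _ _ Y (e, false)).
Qed.

Lemma cut_sp_edge e : (sp_edge i e \in cut V) = (e \in cut V').
Proof.
have := V_half (e, false); have := V_half (flip (e, false)).
rewrite sp_half_flip sp_half_fst /flip /= !inE.
by case: (sp_half i (e, false)).2 => /= -> ->; rewrite // eq_sym.
Qed.

(** When the exceptional point reaches an end, the edge stops being exceptional. Its weight rises
    from -2 to 0 if both ends are in [V'], from -1 to 1 if it is cut, and stays 0 otherwise; a cut
    edge is accounted for by exactly one of [exc_in] and [pushed_out]. *)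
Lemma edge_weight_sp_edge e :
  edge_weight R (comb_type D) V' e =
  edge_weight R (psd_pd T) V (sp_edge i e) + 2 * (exc_in (sp_edge i e))%:R + 2 * (pushed_out e)%:R.
Proof.
have ends : (root (sp_edge i e, false) \in V)%:R + (root (sp_edge i e, true) \in V)%:R =
    (root (e, false) \in V')%:R + (root (e, true) \in V')%:R :> R.
  rewrite -(V_half (e, false)) -(V_half (flip (e, false))) sp_half_flip sp_half_fst /flip /=.
  by case: (sp_half i (e, false)).2; rewrite //= addrC.
rewrite /edge_weight {}ends cut_sp_edge /pushed_out /=.
have [eF|eF] := boolP (e \in F).
  have [e1 E1] := exc_over i_len i_div eF.
  have eE : sp_edge i e \in E by rewrite -E1; apply: valP.
  rewrite eE /exc_in -E1 valK; have /exc_edgeP[t /(exc_positionP i_len i_div)[Ht [e2 E2 L]]] := eF.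
  have -> : e1 = e2 by apply: val_inj; rewrite E1 E2.
  by rewrite L (seg_interior Ht) /=; lra.
have [eE|eE] := boolP (sp_edge i e \in E); last by rewrite /exc_in insubN //=; lra.
pose e1 : {e | e \in E} := exist (fun e => e \in E) _ eE.
have -> : exc_in (sp_edge i e) = in_V' (loc i x (inr e1)).
  by rewrite /exc_in -[sp_edge i e]/(val e1) valK.
have [b ->] := nexc_loc (e1 := e1) eF erefl.
rewrite /= inE; case: b; case: (root (e, false) \in V'); case: (root (e, true) \in V') => /=; lra.
Qed.

(** Each exceptional point absorbed into [V'] lowers the divisor there by 1, and the gain of 2 in
    the edge weight, halved, compensates it. Only the points pushed out of [V'] along cut edges
    leave a surplus. *)
Lemma beta_contract : beta (@upol _ _ _ mu Y) (comb_type D) V' =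
  beta (@upol _ _ _ mu T) (psd_pd T) V + \sum_e (pushed_out e)%:R.
Proof.
rewrite !betaE.
have -> : \sum_(v in V') upol mu v = \sum_(v in V) upol mu v.
  rewrite [RHS](partition_big (sp_vert i) (mem V')) /=; last by move=> v; rewrite inE.
  apply: eq_bigr => v' v'V; rewrite (upol_compat mu iw) /push; apply: eq_bigl => v.
  by rewrite !inE; case: eqP => [->|]; rewrite ?andbF // v'V.
have -> : \sum_(v in V') (pd_div (comb_type D) (inl v))%:~R =
    \sum_(v in V) (pd_div (psd_pd T) (inl v))%:~R - \sum_(e in E) (exc_in e)%:R :> R.
  transitivity (\sum_(u | in_V' (loc i x u)) (pd_div (psd_pd T) u)%:~R : R).
    transitivity (\sum_(v in V') \sum_(u | in_V' (loc i x u) && (loc i x u == inl v))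
        (pd_div (psd_pd T) u)%:~R : R).
      apply: eq_bigr => v vV; rewrite /= i_div rmorph_sum /=; apply: eq_bigl => u.
      by case: eqP => [->|]; rewrite ?andbF //= vV.
    rewrite (exchange_big_dep (fun u => in_V' (loc i x u))) /=; last by move=> v u _ /andP[].
    apply: eq_bigr => u; rewrite /in_V'; case L : (loc i x u) => [v|//] vV.
    rewrite (big_pred1 v) // => v1; rewrite vV andTb (inj_eq inl_inj) eq_sym.
    by case: (eqVneq v1 v) => [->|/negbTE N] /=; rewrite ?N ?andbF ?vV ?eqxx.
  rewrite big_sumType /=; congr (_ + _); first by apply: eq_bigl => v; rewrite !inE.
  rewrite [X in - X]big_sub -sumrN [LHS]big_mkcond /=; apply: eq_bigr => e1 _.
  rewrite pd_exc /exc_in -[sval e1]/(val e1) valK; case: ifP => _; rewrite ?oppr0 //.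
have -> : \sum_e edge_weight R (comb_type D) V' e =
    \sum_e edge_weight R (psd_pd T) V e + 2 * \sum_(e in E) (exc_in e)%:R + 2 * \sum_e (pushed_out e)%:R.
  pose Ft e := edge_weight R (psd_pd T) V e + 2 * (exc_in e)%:R.
  have exc_inN e : e \notin E -> exc_in e = false by move=> eE; rewrite /exc_in insubN.
  rewrite (eq_bigr (fun e => Ft (sp_edge i e) + 2 * (pushed_out e)%:R)); last first.
    by move=> e _; apply: edge_weight_sp_edge.
  rewrite big_split /= -mulr_sumr; congr (_ + _).
  transitivity (\sum_e Ft e); last first.
    rewrite big_split /= -mulr_sumr; congr (_ + 2 * _).
    by rewrite [RHS]big_mkcond; apply: eq_bigr => e _; case: ifPn => // /exc_inN ->.
  rewrite [RHS](bigID (mem (contracted i))) /= [X in _ = X + _]big1 ?add0r; last first.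
    move=> e eC; rewrite /Ft /edge_weight.
    have Er := @sp_contracted _ _ i (e, false) eC; rewrite /flip /= in Er.
    have -> : e \in cut V = false by rewrite !inE Er eqxx.
    rewrite !inE Er; have [eE|eE] := boolP (e \in E); last by rewrite exc_inN //=; lra.
    pose e1 : {e | e \in E} := exist (fun e => e \in E) e eE.
    have -> : exc_in e = in_V' (loc i x (inr e1)) by rewrite /exc_in -[e]/(val e1) valK.
    by rewrite (@loc_contracted _ _ _ _ _ x _ i e1 true eC) /=; lra.
  rewrite (eq_bigl (mem (sp_edge i @: [set: edge Y]))) /=; last first.
    move=> e; rewrite -codom_sp_edge; apply/codomP/imsetP => -[e' ]; first by exists e'.
    by exists e'.
  by rewrite big_imset /= => [|e e' _ _ /sp_edge_inj //]; apply: eq_bigl => e; rewrite inE.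
lra.
Qed.

End Contract.

Lemma pos_lower_bound (I : finType) (P : pred I) (f : I -> R) :
  (forall j, P j -> 0 < f j) -> exists2 m : R, 0 < m & forall j, P j -> m <= f j.
Proof.
move=> H; exists (\big[Num.min/1]_(j | P j) f j); last by move=> j Pj; apply: bigmin_le_cond.
by elim/big_ind: _ => // u v u0 v0; rewrite lt_min u0.
Qed.

(* If the contraction of [x] were not polystable, moving the points of some cut
   into the interior of their edges would give a vector with fewer zeros. *)
Lemma realizes_polystable (T : psd mu) (x : edge_space T) (Y : tropical_curve R g)
    (D : point Y -> int) : orthant x ->
  (forall x' : edge_space T, orthant x' -> x' - x \in cut_space T -> (zeros x <= zeros x')%N) ->
  realizes x D -> trop_polystable mu D.
Proof.
move=> x0 xmin [i iw il iz iD]; split.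
- exact: exc_position_uniq il iD.
- exact: exc_position_value il iD.
have [s [sV sO sD sL sC]] := subdiv_spec x0 il iz iD.
have [degT polT] := psd_polystable T.
split; first by rewrite -degT /pd_degree (eq_bigr _ (fun v _ => sD v)); apply: push_degree.
move=> V'; have bE := beta_contract iw x0 il iD V'.
set V := [set v | sp_vert i v \in V'] in bE.
have [bT bT'] := polT V.
have po0 : 0 <= \sum_e (pushed_out x D i V' e)%:R :> R by apply: sumr_ge0.
split=> [|/subsetPn[e eV]]; first by rewrite bE addr_ge0.
rewrite [pd_edges _]/(exc_edges D) => eF.
rewrite lt_neqAle bE addr_ge0 // andbT eq_sym; apply/negP; rewrite paddr_eq0 // => /andP[/eqP bT0 po].
have cVE : cut V \subset pd_edges (psd_pd T).
  by apply: contraT => /bT'; rewrite bT0 ltxx.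
have {}po e' : pushed_out x D i V' e' = false.
  apply: contraTF po => po; rewrite (bigD1 e') //= po gt_eqF //.
  by rewrite ltr_pwDl // sumr_ge0.
pose phi (v : vert T) : R := (v \in V)%:R.
have phiE e' : e' \notin pd_edges (psd_pd T) -> phi (root (e', false)) = phi (root (e', true)).
  move=> eE; have : e' \notin cut V by apply: contra eE; apply/subsetP.
  by rewrite inE negbK /phi => /eqP ->.
(* Vanishing of [beta] on the contraction excludes points pushed out of [V'], so on every cut edge
   there is room to slide the point away from [V]. *)
have side (e1 : {e | e \in pd_edges (psd_pd T)}) c : root (val e1, c) \notin V ->
    root (val e1, ~~ c) \in V -> 0 < (x (inr (e1, c)) : R).
  move=> N1 N2; rewrite lt_neqAle x0 andbT eq_sym; apply/negP => /eqP xz.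
  have eC : val e1 \notin contracted i.
    apply/negP => eC; have := @sp_contracted _ _ i (val e1, c) eC.
    by move: N1 N2; rewrite !inE /flip /= => + + E; rewrite E => /negP.
  have [h Eh] := @contracted_half _ _ i (val e1, c) eC.
  have L := loc_hseg il Eh; rewrite xz hseg0 in L.
  have Ee : val e1 = sp_edge i h.1 by rewrite -sp_half_edge Eh.
  have e1E : val e1 \in pd_edges (psd_pd T) := valP e1.
  have := po h.1; rewrite /pushed_out -Ee e1E valK L /=.
  have -> : h.1 \in cut V'.
    rewrite -(cut_sp_edge i V') -Ee inE.
    by move: N1 N2; rewrite -/V; case: (c) => /= /negbTE -> ->.
  have -> : root h \notin V' by rewrite -(sp_root i h) Eh; move: N1; rewrite inE.
  rewrite !andbT => /negbFE hF.
  have := sub_vert_exc il iD hF Ee.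
  by rewrite /sub_vert L.
pose Q (e' : edge (psd_subdiv T)) := if e' is inr (e1, c) then
  (root (val e1, c) \notin V) && (root (val e1, ~~ c) \in V) else false.
have [m m0 mQ] := @pos_lower_bound _ Q (fun e' => x e') ltac:(by case=> // -[e1 c] /andP[]; apply: side).
(* [Q] selects the pieces that get shorter; they have length at least [m], so losing [m / 2] keeps
   them positive. *)
pose x' : edge_space T := x + grad (fun v => m / 2 * phi v).
have x'E e' : (x' e' : R) = x e' + match e' with inl _ => 0
    | inr (e1, c) => m / 2 * phi (root (val e1, c)) - m / 2 * phi (root (val e1, ~~ c)) end.
  by rewrite !ffunE.
have x'_gt e' : 0 < (x e' : R) -> 0 < (x' e' : R).
  rewrite x'E; case: e' => [a|[e1 c]]; first by rewrite addr0.
  have := mQ (inr (e1, c)); rewrite /Q /phi.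
  by case: (_ \in V); case: (_ \in V) => /= H ?; try lra; have := H isT; lra.
have x'0 : orthant x'.
  move=> e'; have := x0 e'; rewrite le_eqVlt => /predU1P[x0'|/x'_gt/ltW //].
  rewrite x'E -x0' add0r; case: e' x0' => [//|[e1 c]] x0'.
  have := mQ (inr (e1, c)); rewrite /Q /phi -x0'.
  by case: (_ \in V); case: (_ \in V) => /= H; try lra; have := H isT; lra.
have : (zeros x <= zeros x')%N.
  apply: xmin => //; rewrite /x' addrAC subrr add0r; apply/cut_spaceP.
  by exists (fun v => m / 2 * phi v) => // e' /phiE ->.
apply/negP; rewrite -ltnNge; apply: proper_card; rewrite properE; apply/andP; split.
  apply/subsetP => e'; rewrite !inE; apply: contraLR => xe.
  by rewrite gt_eqF // x'_gt // lt_neqAle eq_sym xe x0.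
have eT : sp_edge i e \in cut V by rewrite cut_sp_edge.
pose e1 : {e | e \in pd_edges (psd_pd T)} :=
  exist (fun e => e \in pd_edges (psd_pd T)) _ (subsetP cVE _ eT).
(* [e] is cut but not exceptional for [D], so one of its pieces vanishes. By [side] it is the one
   touching [V], and it becomes positive in [x']. *)
have [c xc] : exists c, (x (inr (e1, c)) : R) = 0.
  have Eh : sp_half i (e, false) = (val e1, (sp_half i (e, false)).2) := sp_half_fst i (e, false).
  have L := loc_hseg il Eh; have [r0 r1] := andP (loc_range x0 il Eh).
  have tE := tot_inr x e1; rewrite [tot _ _](esym (il e)) in tE.
  have [I|/negP I] := boolP (0 < (x (inr (e1, (sp_half i (e, false)).2)) : R) < len e).
    by have := loc_exc il iD I L; rewrite (negbTE eF).
  have [Z0|Z1] : (x (inr (e1, (sp_half i (e, false)).2)) : R) = 0 \/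
      (x (inr (e1, (sp_half i (e, false)).2)) : R) = len e by rewrite /= in r1; lra.
    by exists (sp_half i (e, false)).2.
  exists (~~ (sp_half i (e, false)).2); move: Z1 tE; case: (_.2) => /= -> ; lra.
apply/subsetPn; exists (inr (e1, c)); rewrite inE ?xc ?eqxx //.
rewrite x'E xc add0r /phi.
have := eT; rewrite inE -[sp_edge i e]/(val e1).
have := @side e1 c; rewrite xc ltxx.
case: c {xc} => /=; case: (_ \in V); case: (_ \in V) => //= H _; try by have := H isT isT.
  by rewrite gt_eqF //; lra.
by rewrite gt_eqF //; lra.
Qed.

Lemma min_zeros (T : psd mu) (a : quotient_space T) : in_cone a -> exists x : edge_space T,
  [/\ orthant x, a = proj x & forall x' : edge_space T, orthant x' ->
      x' - x \in cut_space T -> (zeros x <= zeros x')%N].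
Proof.
case=> x1 x10 ->.
pose P n := `[< exists x : edge_space T, [/\ orthant x, x - x1 \in cut_space T & zeros x = n] >].
have exP : exists n, P n.
  by exists (zeros x1); apply/asboolP; exists x1; rewrite subrr mem0v.
case: (ex_minnP exP) => n /asboolP[x [x0 xx1 <-]] nmin; exists x; split=> //.
  by apply/class_eq => //; apply: cut_equivalence.
move=> x' x'0 x'x; apply: nmin; apply/asboolP; exists x'; split=> //.
by rewrite -[x'](subrK x) -addrA; apply: memvD.
Qed.

End Homs.

(** * Linearly equivalent polystable divisors *)

Section SelfRealization.
Variables (R : realType) (g : nat) (d : int) (mu : universal_polarization R g d).

Lemma self_realizes (X : tropical_curve R g) (pd : pseudo_divisor X)
    (pol : polystable d (@upol _ _ _ mu X) pd) (T := Psd pol) (x : edge_space T)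
    (D : point X -> int) :
  (forall e, len e = tot x e) -> (forall v, D (inl v) = pd_div pd (inl v)) ->
  (forall e1, 0 < (x (inr (e1, false)) : R) < len (val e1)) ->
  (forall e t, 0 < t < len e -> D (seg e t) =
     if insub e is Some e1 then - (t == x (inr (e1, false)))%:R else 0) ->
  realizes x D.
Proof.
move=> xl Dv xI De; pose i : specialization T X := ci_spec (ci_id X).
have il e : len e = tot x (sp_edge i e) := xl e.
apply: (@Realizes _ _ _ _ T _ X _ i) => //.
- exact: ci_spec_weight.
- by move=> e eC; case/negP: (ci_spec_contracted (ci_id X) e).
have locE e1 : loc i x (inr e1) = seg (val e1) (x (inr (e1, false))).
  by rewrite (@loc_hseg _ _ _ _ T x X i il (val e1, false) e1 false).
move=> p; case: (pointP p) => [v|e t Ht].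
  rewrite (big_pred1 (inl v)) ?Dv // => -[u|e1]; first by [].
  by apply/negbTE/eqP; rewrite locE; apply: seg_interior_neq.
rewrite De //; case: insubP => [e1 _ Ee|eE]; last first.
  rewrite big1 // => -[v /eqP L|e1]; first by case: (seg_interior_neq Ht (esym L)).
  move/eqP; rewrite locE => /esym /(seg_inj Ht)[Ee _].
  by have := valP e1; rewrite /= -Ee (negbTE eE).
have [Et|Nt] := eqVneq t (x (inr (e1, false))).
  rewrite (big_pred1 (inr e1)) ?pd_exc // => -[v|e2].
    by apply/negbTE/eqP => L; case: (seg_interior_neq Ht (esym L)).
  rewrite locE; apply/eqP/eqP => [/esym/(seg_inj Ht)[E2 _]|[->]]; last by rewrite -Ee Et.
  by congr inr; apply: val_inj; rewrite Ee E2.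
rewrite big1 ?oppr0 // => -[v /eqP L|e2]; first by case: (seg_interior_neq Ht (esym L)).
move/eqP; rewrite locE => /esym/(seg_inj Ht)[E2 E3].
have e12 : e1 = e2 by apply: val_inj; rewrite Ee E2.
by rewrite e12 -E3 eqxx in Nt.
Qed.

End SelfRealization.

Lemma in_cut (G : graph) (V : {set vert G}) e :
  (e \in cut V) = ((root (e, false) \in V) != (root (e, true) \in V)).
Proof. by rewrite inE. Qed.

Section SameCurve.
Variables (R : realType) (g : nat) (d : int) (mu : universal_polarization R g d).
Variable X : tropical_curve R g.

(* Away from the exceptional edges this is the junk value [len e / 2]. *)
Definition exc_pos (D : point X -> int) (e : edge X) : R :=
  if e \in exc_edges D then xget 0 (exc_position D e) else len e / 2.

Lemma exc_pos_in D e : e \in exc_edges D -> exc_position D e (exc_pos D e).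
Proof.
by move=> eF; rewrite /exc_pos eF; move: eF; rewrite inE => /asboolP[t Ht]; apply: xgetPex (ex_intro _ t Ht).
Qed.

Lemma exc_pos_range D e : 0 < exc_pos D e < len e.
Proof.
have [/exc_pos_in[]//|eF] := boolP (e \in exc_edges D).
by rewrite /exc_pos (negbTE eF); have := len_gt0 e; lra.
Qed.

Lemma exc_pos_div D e s : trop_polystable mu D -> 0 < s < len e ->
  D (seg e s) = - ((e \in exc_edges D) && (s == exc_pos D e))%:R.
Proof.
move=> [uniq val_exc _] Hs; have [D0|D1] := eqVneq (D (seg e s)) 0.
  rewrite D0; case: andP => // -[/exc_pos_in[_ +] /eqP E].
  by rewrite -E D0 eqxx.
have Es : exc_position D e s by [].
have eF : e \in exc_edges D by rewrite inE; apply/asboolP; exists s.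
by rewrite eF (uniq _ _ _ (exc_pos_in eF) Es) eqxx (val_exc _ _ Es).
Qed.

(** Measured from the exceptional point to the end opposite to [root h]. *)
Definition end_dist (D : point X -> int) (h : half X) : R :=
  if h.2 then exc_pos D h.1 else len h.1 - exc_pos D h.1.

Lemma end_dist_range D h : 0 < end_dist D h < len h.1.
Proof. by have := exc_pos_range D h.1; rewrite /end_dist; case: h.2; lra. Qed.

Variables (D1 D2 : point X -> int) (f : point X -> R).
Hypothesis pol1 : trop_polystable mu D1.
Hypothesis pol2 : trop_polystable mu D2.
Hypothesis fpl : pl_function f.
Hypothesis fE : forall p, D1 p - D2 p = ord f p.
Notation b1 e := ((e \in exc_edges D1)%:R).
Notation b2 e := ((e \in exc_edges D2)%:R).
Let sl h := incoming_slope f h 0.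
Let fv v := f (inl v).

Lemma edge_slopes e : exists k : int, [/\ sl (e, true) = k, sl (e, false) = b1 e - b2 e - k &
  fv (root (e, true)) - fv (root (e, false)) =
  k%:~R * len e - b1 e * exc_pos D1 e + b2 e * exc_pos D2 e].
Proof.
apply: edge_shape; rewrite ?exc_pos_range // => s Hs.
by rewrite -fE !(exc_pos_div pol1, exc_pos_div pol2) // opprK addrC.
Qed.

Lemma slope_sum e : sl (e, false) + sl (e, true) = b1 e - b2 e.
Proof. by have [k [-> -> _]] := edge_slopes e; rewrite subrK. Qed.

Lemma slope_diff h : fv (root h) - fv (root (flip h)) =
  (sl h)%:~R * len h.1 - b1 h.1 * end_dist D1 h + b2 h.1 * end_dist D2 h.
Proof.
case: h => e b; rewrite /end_dist /flip /=; have [k [E1 E2 E3]] := edge_slopes e.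
case: b => /=; first by rewrite E1.
by rewrite E2 !rmorphB /= !mulrz_nat; lra.
Qed.

(* The contribution of [e] to [beta D2 V + beta D1 (~: V)]. *)
Let cut_term (V : {set vert X}) e : R :=
  let a := root (e, false) \in V in let b := root (e, true) \in V in
  (a && ~~ b)%:R * (1 - b2 e - (sl (e, false))%:~R) +
  (b && ~~ a)%:R * (1 - b2 e - (sl (e, true))%:~R).

(** Expressing the sum of [D1] over [~: V] through its total, the degree [d] cancels against the
    total of [mu]. The sum of [D1 - D2] over [V] is a sum of slopes at half-edges, so what is left
    splits over the edges, and those outside the cut cancel. *)
Lemma sum_beta V : beta (@upol _ _ _ mu X) (comb_type D2) V +
  beta (@upol _ _ _ mu X) (comb_type D1) (~: V) = \sum_e cut_term V e.
Proof.
pose a e := (root (e, false) \in V)%:R : R; pose b e := (root (e, true) \in V)%:R : R.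
(* Each exceptional vertex contributes -1 to the degree. *)
have degD : \sum_(v : vert X) (D1 (inl v))%:~R = d%:~R + \sum_e b1 e :> R.
  have [_ _ [degP _]] := pol1; rewrite -degP /pd_degree big_sumType /= rmorphD !rmorph_sum /=.
  rewrite -addrA -[LHS]addr0; congr (_ + _).
  rewrite -(big_sub (mem (exc_edges D1)) (fun _ => -1 : R)) big_mkcond /= -big_split big1 // => e _.
  by rewrite /=; case: (e \in _); rewrite ?addNr ?addr0.
have ordV : \sum_(v in V) (D1 (inl v))%:~R - \sum_(v in V) (D2 (inl v))%:~R =
    \sum_e (a e * (sl (e, false))%:~R + b e * (sl (e, true))%:~R) :> R.
  rewrite -sumrB (eq_bigr (fun v => (ord f (inl v))%:~R)); last by move=> v _; rewrite -fE rmorphB.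
  transitivity (\sum_(v in V) \sum_(h | root h == v) (sl h)%:~R : R).
    by apply: eq_bigr => v _; rewrite /ord rmorph_sum.
  transitivity (\sum_(h | root h \in V) (sl h)%:~R : R).
    rewrite [RHS](partition_big (@root X) (mem V)) //=; apply: eq_bigr => v vV.
    by apply: eq_bigl => h; case: eqP => [->|]; rewrite ?andbF // vV.
  rewrite big_mkcond sum_half_edge; apply: eq_bigr => e _; rewrite /a /b.
  by case: ifP => _; case: ifP => _; rewrite ?mul1r ?mul0r.
have compl (F : vert X -> R) : \sum_(v in ~: V) F v = \sum_v F v - \sum_(v in V) F v.
  rewrite [X in _ = X - _](bigID (mem V)) /= addrAC subrr add0r.
  by apply: eq_bigl => v; rewrite inE.
rewrite !betaE /= !compl degD upol_degree.
have -> : \sum_e cut_term V e = \sum_e (b1 e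
    - (a e * (sl (e, false))%:~R + b e * (sl (e, true))%:~R)
    + 2^-1 * (edge_weight R (comb_type D2) V e + edge_weight R (comb_type D1) (~: V) e)).
  apply: eq_bigr => e _; rewrite /cut_term /edge_weight /a /b /= !in_cut !in_setC.
  have := slope_sum e => /(congr1 (fun z : int => z%:~R : R)); rewrite rmorphB rmorphD /= !mulrz_nat.
  move: (sl _) (sl _) => u v; case: (e \in exc_edges D1); case: (e \in exc_edges D2);
    case: (_ \in V); case: (_ \in V) => /=; lra.
move: (edge_weight R (comb_type D2) V) (edge_weight R (comb_type D1) (~: V)) => w2 w1.
rewrite big_split /= sumrB -mulr_sumr [X in _ = _ + _ * X]big_split /= -ordV.
lra.
Qed.

(** By [slope_diff] the growth of [f] along the edge bounds [sl h * len h.1] strictly below by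
    [- b2 * len h.1]; integrality of the slope supplies the extra 1. *)
Lemma slope_ge h : fv (root (flip h)) < fv (root h) -> 1 - b2 h.1 <= sl h :> int.
Proof.
move=> H; have := slope_diff h; have := end_dist_range D1 h; have := end_dist_range D2 h.
have := len_gt0 h.1 => l0 R2 R1 E.
have b1pos : 0 <= b1 h.1 * end_dist D1 h by rewrite mulr_ge0 //; lra.
suff : - (b2 h.1)%:~R < (sl h)%:~R :> R.
  rewrite -rmorphN ltr_int; case: (h.1 \in exc_edges D2); lia.
rewrite -(ltr_pM2r l0); move: E H b1pos; case: (h.1 \in exc_edges D2) => /=; lra.
Qed.

(** The threshold is the value at [root h], so that [h.1] itself is cut. A nonnegative sum of
    nonpositive terms has only zero terms, and the term of [h.1] is [- sl h] once the edge is
    exceptional for [D2]. *)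
Lemma slope_cut h : fv (root (flip h)) < fv (root h) ->
  [/\ h.1 \in exc_edges D1, h.1 \in exc_edges D2 & sl h = 0].
Proof.
move=> lt_h; pose V := [set v | fv (root h) <= fv v].
have inV v : (v \in V) = (fv (root h) <= fv v) by rewrite inE.
have term_le e : cut_term V e <= 0.
  have half_le h' : root h' \in V -> root (flip h') \notin V -> 1 - b2 h'.1 - (sl h')%:~R <= 0 :> R.
    rewrite !inV -ltNge => H1 H2; have := slope_ge (lt_le_trans H2 H1).
    by rewrite -(ler_int R) rmorphB /= mulrz_nat; lra.
  have := half_le (e, false); have := half_le (e, true); rewrite /cut_term /flip /=.
  case: (_ \in V); case: (_ \in V) => /= H1 H2; rewrite ?mul1r ?mul0r ?addr0 ?add0r //.
    exact: H1.
  exact: H2.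
have [_ _ [_ P1]] := pol1; have [_ _ [_ P2]] := pol2.
have [ge1 st1] := P1 (~: V); have [ge2 st2] := P2 V; have sE := sum_beta V.
have sle : \sum_e cut_term V e <= 0 by apply: sumr_le0.
have hV : h.1 \in cut V.
  have : (root h \in V) != (root (flip h) \in V) by rewrite !inV lexx leNgt lt_h.
  by case: (h) => e [] /=; rewrite /flip /= in_cut // eq_sym.
have hV' : h.1 \in cut (~: V).
  by move: hV; rewrite !in_cut !in_setC; case: (_ \in V); case: (_ \in V).
have c2 : cut V \subset exc_edges D2 by apply: contraT => /st2; lra.
have c1 : cut (~: V) \subset exc_edges D1 by apply: contraT => /st1; lra.
have hF2 := subsetP c2 _ hV; have hF1 := subsetP c1 _ hV'.
split=> //; have t0 : cut_term V h.1 = 0.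
  apply/eqP; rewrite eq_le term_le /=.
  have : \sum_(e | e != h.1) cut_term V e <= 0 by apply: sumr_le0.
  by move: sE; rewrite (bigD1 h.1) //=; lra.
have hin : root h \in V by rewrite inV.
have hout : root (flip h) \notin V by rewrite inV -ltNge.
apply/eqP; rewrite -(intr_eq0 R); move: t0; rewrite /cut_term hF2.
case: (h) hin hout => e [] /=; rewrite /flip /= => -> /negbTE -> /=; lra.
Qed.

(** Superlevel sets do not see an edge whose ends have equal values of [f]. There [slope_diff] is 0,
    and since both distances lie strictly between 0 and the length, the slope lies strictly between
    -1 and 1; a single exceptional point would then leave a nonzero term. *)
Lemma slope_zero h : sl h = 0 /\ (h.1 \in exc_edges D1) = (h.1 \in exc_edges D2).
Proof.
have sums : sl h + sl (flip h) = b1 h.1 - b2 h.1.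
  by rewrite -slope_sum; case: (h) => e [] //; rewrite addrC.
have [lt|lt|eq] := ltgtP (fv (root h)) (fv (root (flip h))).
- have [|h1 h2 s0] := @slope_cut (flip h); first by rewrite flipK.
  by move: sums h1 h2; rewrite s0 addr0 => -> /= -> ->; rewrite subrr.
- by have [-> -> ->] := slope_cut lt.
have := slope_diff h; rewrite eq subrr.
have := end_dist_range D1 h; have := end_dist_range D2 h; have := len_gt0 h.1 => l0 R2 R1 E.
have s0 : sl h = 0.
  have : -1 < (sl h)%:~R :> R.
    rewrite -(ltr_pM2r l0); move: E.
    by case: (h.1 \in exc_edges D1); case: (h.1 \in exc_edges D2) => /=; lra.
  have : (sl h)%:~R < 1 :> R.
    rewrite -(ltr_pM2r l0); move: E.
    by case: (h.1 \in exc_edges D1); case: (h.1 \in exc_edges D2) => /=; lra.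
  rewrite -[1]/(1%:~R) -rmorphN !ltr_int; lia.
split=> //; move: E; rewrite s0.
by case: (h.1 \in exc_edges D1); case: (h.1 \in exc_edges D2) => //=; lra.
Qed.

Lemma lin_equiv_exc : exc_edges D1 = exc_edges D2.
Proof. by apply/setP => e; have [_ ->] := slope_zero (e, false). Qed.

Lemma lin_equiv_vertex v : D1 (inl v) = D2 (inl v).
Proof.
apply/eqP; rewrite -subr_eq0 fE /ord big1 // => h _.
by have [] := slope_zero h.
Qed.

Lemma lin_equiv_pos e : fv (root (e, true)) - fv (root (e, false)) =
  if e \in exc_edges D1 then exc_pos D2 e - exc_pos D1 e else 0.
Proof.
have [s0 bE] := slope_zero (e, true); have := slope_diff (e, true).
rewrite /end_dist /flip /= s0 -bE => ->; case: (e \in _) => /=; lra.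
Qed.

End SameCurve.

Section SameCurvePairs.
Variables (R : realType) (g : nat) (d : int) (mu : universal_polarization R g d).

Lemma pair_realizes (P : trop_pair mu) : realizes (pair_vec P) (@tp_div _ _ _ _ P).
Proof.
set D := @tp_div _ _ _ _ P.
have xE (a : {e | e \in exc_edges D}) : (pair_vec P (inr (a, false)) : R) = exc_pos D (val a).
  by rewrite ffunE /= /exc_pos (valP a).
apply: (@self_realizes _ _ _ mu P (comb_type D) (pair_comb_polystable P)) => //.
- move=> e; have [eE|eE] := boolP (e \in exc_edges D).
    pose a := exist (fun e => e \in exc_edges D) e eE.
    by rewrite -[e in RHS]/(val a) (tot_inr (T := pair_psd P)) !ffunE /=; lra.
  pose a := exist (fun e => e \notin exc_edges D) e eE.
  by rewrite -[e in RHS]/(val a) (tot_inl (T := pair_psd P)) ffunE.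
- by move=> a; rewrite xE; apply: exc_pos_range.
move=> e t Ht; have polP : trop_polystable mu D := tp_polystable P.
rewrite (exc_pos_div polP Ht).
by case: insubP => [a -> Ea|/negbTE -> //]; rewrite xE Ea.
Qed.

(** Equal combinatorial types allow [D] to be described in the cone of [P]; by [lin_equiv_pos] its
    vector differs from that of [P] by the gradient of [- f]. *)
Lemma same_curve_realizes (P : trop_pair mu) (D : point P -> int) :
  trop_polystable mu D -> linearly_equivalent (@tp_div _ _ _ _ P) D ->
  exists y : edge_space (pair_psd P), [/\ orthant y, y - pair_vec P \in cut_space (pair_psd P)
    & inhabited (realizes y D)].
Proof.
move=> pol [f fpl fE]; have polP := tp_polystable P.
set DP := @tp_div _ _ _ _ P in polP fE *.
have Eexc := lin_equiv_exc polP pol fpl fE.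
have Epos := lin_equiv_pos polP pol fpl fE.
pose phi (v : vert P) := - f (inl v).
pose y : edge_space (pair_psd P) := pair_vec P + grad (T := pair_psd P) phi.
have yl a : (y (inl a) : R) = len (val a) by rewrite !ffunE addr0.
have yr (a : {e | e \in exc_edges DP}) c :
    (y (inr (a, c)) : R) = if c then len (val a) - exc_pos D (val a) else exc_pos D (val a).
  have := Epos (val a); have aE := valP a; rewrite /= in aE; rewrite aE => E.
  have pE : xget 0 (exc_position DP (val a)) = exc_pos DP (val a) by rewrite /exc_pos aE.
  rewrite !ffunE /= pE /phi; case: c => /=; lra.
have yI (a : {e | e \in exc_edges DP}) : 0 < (y (inr (a, false)) : R) < len (val a).
  by rewrite yr; apply: exc_pos_range.
exists y; split.
- case=> [a|[a c]]; first by rewrite yl ltW // len_gt0.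
  by rewrite yr; have := exc_pos_range D (val a); case: c; lra.
- rewrite /y addrAC subrr add0r; apply/(cut_spaceP (T := pair_psd P)); exists phi => // e eE.
  by have := Epos e; rewrite (negbTE eE) /phi; lra.
constructor; apply: (@self_realizes _ _ _ mu P (comb_type DP) (pair_comb_polystable P) y) => //.
- move=> e; have [eE|eE] := boolP (e \in exc_edges DP).
    pose a := exist (fun e => e \in exc_edges DP) e eE.
    by rewrite -[e in RHS]/(val a) (tot_inr (T := pair_psd P)) !yr /=; lra.
  pose a := exist (fun e => e \notin exc_edges DP) e eE.
  by rewrite -[e in RHS]/(val a) (tot_inl (T := pair_psd P)) yl.
- by move=> v; rewrite /= (lin_equiv_vertex polP pol fpl fE).
move=> e t Ht; rewrite (exc_pos_div pol Ht) -Eexc.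
case: insubP => [a -> Ea|/negbTE -> //]; by rewrite (yr a false) Ea.
Qed.

End SameCurvePairs.

(** * The colimit *)

Section Parametrization.
Variables (R : realType) (g : nat) (d : int) (mu : universal_polarization R g d).
Implicit Types P Q : trop_pair mu.

Definition pair_point P : cone_point mu := ConePoint (pair_vec_in_cone P).

Lemma Ptrop_equivalence :
  Equivalence (clos_refl_sym_trans (cone_point mu) (@face_rel R g d mu)).
Proof.
split=> [p|p q|p q r]; [exact: rst_refl|exact: rst_sym|exact: rst_trans].
Qed.

Lemma pair_vec_gt0 P e : 0 < (pair_vec P e : R).
Proof.
rewrite ffunE; case: e => [e|[e c]] /=; first exact: len_gt0.
have := valP e; rewrite inE => /asboolP[t Ht].
have [] := xgetPex 0 (ex_intro _ t Ht); rewrite /in_interior => I _.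
by case: c; lra.
Qed.

Lemma face_rel_realizes P (p : cone_point mu) (x : edge_space (cp_psd p)) :
  orthant x -> cp_point p = proj x -> realizes x (@tp_div _ _ _ _ P) ->
  face_rel (pair_point P) p.
Proof.
move=> x0 px /(realizes_hom x0)[f fE]; exists f, (pair_vec P).
by split=> [e||]; rewrite ?fE // ltW // pair_vec_gt0.
Qed.

(** The divisor of [Q] is pulled back to the curve of [P], where the same-curve analysis describes
    it by a vector [y] in the class of [pair_vec P]. Since [y] also realizes the divisor of [Q], a
    morphism of triples relates the two cone points. *)
Lemma pair_equiv_associated_point P Q : pair_equiv P Q ->
  associated_point P = associated_point Q.
Proof.
case=> i [k [ik [f fpl fE]]]; have [c [Ei Ek]] := is_iso_curve_iso ik.
have /(realizes_iso (ci_inv c)) rQ := pair_realizes Q.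
have Q0 : orthant (pair_vec Q) by move=> e; rewrite ltW // pair_vec_gt0.
have {}rQ := rQ Q0; set D := fun p : point P => _ in rQ.
have DE p : D p = tp_div (ci_pt c p) by [].
(* The vector of [Q] has no zero coordinate, so its number of zeros is trivially minimal. *)
have polD : trop_polystable mu D.
  apply: realizes_polystable Q0 _ rQ => x' _ _; rewrite /zeros.
  suff -> : [set e | (pair_vec Q e : R) == 0] = set0 by rewrite cards0.
  by apply/setP => e; rewrite !inE gt_eqF // pair_vec_gt0.
have [|y [y0 yP [ry]]] := same_curve_realizes (P := P) polD.
  exists (f \o ci_pt c); first exact: pl_ci_pt.
  by move=> p; rewrite ord_ci_pt // -fE DE Ek ci_ptK.
have {}ry : realizes y (@tp_div _ _ _ _ Q).
  have -> : @tp_div _ _ _ _ Q = fun q => D (ci_pt (ci_inv c) q).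
    have cK : cancel (ci_pt (ci_inv c)) (ci_pt c) := ci_ptK (ci_inv c).
    by apply: funext => q; rewrite DE cK.
  exact: realizes_iso ry.
apply/(class_eq Ptrop_equivalence)/rst_sym/rst_step.
apply: (face_rel_realizes (p := pair_point P) y0) => //=.
by apply/(class_eq (cut_equivalence _)).
Qed.

Lemma realizes_same_point (T : psd mu) (x x' : edge_space T) (X Y : tropical_curve R g)
    (D : point X -> int) (D' : point Y -> int) : orthant x -> orthant x' ->
  proj x = proj x' -> realizes x D -> realizes x' D' -> dequiv D D'.
Proof.
move=> x0 x0' /(class_eq (cut_equivalence _)) xx' rD rD'.
have [D1 [[rD1] DD1]] := realizes_cut_space x0 x0' xx' rD.
apply: (@dequiv_trans _ _ _ _ _ _ D1); last exact: realizes_uniq rD1 rD'.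
by exists id, id; split; first by split.
Qed.

(** Neither a representative of a point of a cone nor its realization is canonical, so the induction
    quantifies over all of them; at a transitivity step some realization of the middle point is
    chosen. *)
Lemma realizes_colimit (p q : cone_point mu) :
  clos_refl_sym_trans _ (@face_rel R g d mu) p q ->
  forall (x : edge_space (cp_psd p)) (y : edge_space (cp_psd q)) (X Y : tropical_curve R g)
    (D : point X -> int) (D' : point Y -> int), orthant x -> orthant y ->
  cp_point p = proj x -> cp_point q = proj y -> realizes x D -> realizes y D' -> dequiv D D'.
Proof.
elim=> {p q} [p2 p1 [f [x2 [x20 p2E p1E]]]|p|p q _ IH|p q r _ IH1 _ IH2] x y X Y D D' x0 y0 pE qE rx ry.
- have [Z [D2 [r2]]] := realization_ex x20.
  have e0 : orthant (extend f x2) by move=> e; rewrite ffunE sumr_ge0.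
  apply: (@dequiv_trans _ _ _ _ _ _ D2).
    by apply: realizes_same_point x0 x20 _ rx r2; rewrite -pE.
  by apply: realizes_same_point e0 y0 _ (realizes_extend f x20 r2) ry; rewrite -p1E.
- by apply: realizes_same_point x0 y0 _ rx ry; rewrite -pE.
- by apply: dequiv_sym; apply: IH ry rx.
have [z z0 zE] := cp_in_cone q; have [Z [D2 [rz]]] := realization_ex z0.
by apply: dequiv_trans (IH1 _ _ _ _ _ _ x0 z0 pE zE rx rz) (IH2 _ _ _ _ _ _ z0 y0 zE qE rz ry).
Qed.

Lemma associated_point_inj P Q : associated_point P = associated_point Q -> pair_equiv P Q.
Proof.
move/(class_eq Ptrop_equivalence)/realizes_colimit; apply => //; last 2 first.
- exact: pair_realizes.
- exact: pair_realizes.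
- by move=> e; rewrite ltW // pair_vec_gt0.
- by move=> e; rewrite ltW // pair_vec_gt0.
Qed.

Lemma associated_point_surj (q : Ptrop mu) : exists P, associated_point P = q.
Proof.
have [p ->] := quot_ex q; have [x [x0 px xmin]] := min_zeros (cp_in_cone p).
have [Y [D [rD]]] := realization_ex x0.
have fin : finitely_supported D by case: rD => i _ _ _; apply: real_finitely_supported.
exists (TropPair fin (realizes_polystable x0 xmin rD)).
by apply/(class_eq Ptrop_equivalence)/rst_step/(face_rel_realizes x0 px).
Qed.

End Parametrization.

Theorem proposition6p14 (R : realType) (g : nat) (d : int)
    (mu : universal_polarization R g d) (g_ge2 : (2 <= g)%N) :
  Equivalence (@pair_equiv R g d mu) /\
  exists F : quot (@pair_equiv R g d mu) -> Ptrop mu,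
    (forall P : trop_pair mu, F (class _ P) = associated_point P) /\
    bijective F.
Proof.
have eqv := pair_equiv_equivalence mu; split=> //.
(* [r] chooses a pair in each class and [s] a preimage of each point of the colimit; by [FE] the map
   does not depend on [r]. *)
have [r rE] := choice (@quot_ex _ (@pair_equiv R g d mu)).
have [s sE] := choice (@associated_point_surj R g d mu).
have FE P : associated_point (r (class _ P)) = associated_point P.
  by apply: pair_equiv_associated_point; apply/(class_eq eqv); rewrite -rE.
exists (fun q => associated_point (r q)); split=> //.
exists (fun q => class _ (s q)) => q; last by rewrite FE sE.
rewrite [q in RHS]rE; apply/(class_eq eqv)/associated_point_inj.
exact: sE.
Qed.
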